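(* Let $(X,d,\mu)$ be a quasiconvex uniform metric measure space that supports a local weak $(1,1)$-Poincar\'e inequality up to scale $R_P$. Let $0<\varepsilon\le\min\{2,R_P/4\}$, let $N(X,\varepsilon)\ni o$ be a maximal $\varepsilon$-net, where $\mu(\{o\})=0$, and let $\varrho\colon[0,\infty)\to[0,\infty)$ be a control function. Then the following are equivalent: (1) $(X,d,\mu)$ satisfies $(S_{1,1}^\varrho)$; (2) there exists $C_1>0$ such that for every $v\colon N(X,\varepsilon)\to\mathbb R$ with finite support $$\sum_{p\in N(X,\varepsilon)}|v(p)|\,\mu(B(p,\varepsilon))\le C_1\sum_{p\in N(X,\varepsilon)}\sum_{q\sim p}|v(p)-v(q)|\,\varrho(|(p,q)|)\,\mu(B(p,\varepsilon));$$ (3) there exists $C_2>0$ such that for every $v\colon N(X,\varepsilon)\to\mathbb R$ with finite support $$\sum_{p\in N(X,\varepsilon)}|v(p)|\le C_2\sum_{p\in N(X,\varepsilon)}\sum_{q\sim p}|v(p)-v(q)|\,\varrho(|(p,q)|);$$ (4) $0=[\Gamma]\in H_0^\varrho(\Gamma)$ for any quasi-lattice $\Gamma\subseteq X$.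
   Context: A metric measure space $(X,d,\mu)$ is a metric space $(X,d)$ with a Borel regular outer measure $\mu$ such that $\mu(X)>0$ and $\mu(B(x,r))<\infty$ for all $x\in X$, $r>0$; $B(x,r)$ denotes the open ball. It is quasiconvex if there is $Q\ge 1$ such that any $x,y\in X$ are joined by a rectifiable path of length at most $Q\,d(x,y)$. It is uniform if there are non-decreasing functions $f,g\colon(0,\infty)\to(0,\infty)$ with $f(r)\le\mu(B(x,r))\le g(r)$ for all $x\in X$ and $0<r<\infty$. Upper gradients: a Borel function $g\colon X\to[0,\infty]$ is an upper gradient of $u$ if $|u(\gamma(a))-u(\gamma(b))|\le\int_\gamma g\,ds$ for every rectifiable path $\gamma\colon[a,b]\to X$, and a $1$-weak upper gradient if this holds for all rectifiable paths outside a family of $1$-modulus zero. $N^{1,1}(X,d,\mu)$ is the Newton-Sobolev space of (equivalence classes of) integrable functions $u\colon X\to[-\infty,\infty]$ having an integrable upper gradient, and $|\nabla u|$ is the minimal $1$-weak upper gradient of $u$. The space supports a local weak $(1,1)$-Poincar\'e inequality up to scale $R_P>0$ if there are $C_P>0$ and $\tau\ge1$ such that for all balls $B(x,r)\subseteq X$ with $0<r\le R_P$ one has $0<\mu(B(x,\tau r))<\infty$ and $$\frac1{\mu(B(x,r))}\int_{B(x,r)}|u-u_{B(x,r)}|\,d\mu\le C_P\,r\,\frac1{\mu(B(x,\tau r))}\int_{B(x,\tau r)}g_u\,d\mu$$ for every $u\colon X\to\mathbb R$ with $u\in L^1(B(x,\tau r),d,\mu)$, where $g_u\colon X\to[0,\infty]$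 is its minimal $1$-weak upper gradient and $u_A=\frac1{\mu(A)}\int_A u\,d\mu$. A control function is a non-decreasing $\varrho\colon[0,\infty)\to[0,\infty)$ with $\varrho(0)=1$ for which there are functions $L,M\colon(0,\infty)\to(0,\infty)$ with $\varrho(\varepsilon+t)\le L(\varepsilon)\varrho(t)$ and $\varrho(\varepsilon t)\le M(\varepsilon)\varrho(t)$ for all $t,\varepsilon>0$. $(X,d,\mu)$ satisfies $(S_{1,1}^\varrho)$ if there exist $C>0$ and a point $o'\in X$ such that $\int_X|u|\,d\mu\le C\int_X|\nabla u|\,\varrho(d(o',\cdot))\,d\mu$ for every $u\in N^{1,1}(X,d,\mu)$ with bounded support. A maximal $\varepsilon$-net $N(X,\varepsilon)$ is a subset of $X$ with $\{x\in X:d(x,N(X,\varepsilon))<\varepsilon\}=X$ and $d(x,y)\ge\varepsilon$ for distinct $x,y\in N(X,\varepsilon)$. For $p,q\in N(X,\varepsilon)$ write $q\sim p$ if $0<d(p,q)\le3\varepsilon$. Notation: $|(p,q)|=\max\{d(o,p),d(o,q)\}$. A quasi-lattice in $X$ is a set $\Gamma\subseteq X$ that is cobounded (there is $C>0$ with $\{x\in X: d(x,\Gamma)<C\}=X$) and uniformly locally finite (there is $N\colon(0,\infty)\to\mathbb N$ with $\#(\Gamma\cap B(x,r))\le N(r)$ for every ball $B(x,r)\subseteq X$). Controlled coarse homology: let $\Gamma$ be a quasi-lattice with basepoint $o\in\Gamma$. On $\Gamma^{q+1}$ use the max metric $d(\bar x,\bar y)=\max_i d(x_i,y_i)$ and $\bar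 o=(o,\dots,o)$. $C_q^\varrho(\Gamma)$ is the real vector space of functions $c\colon\Gamma^{q+1}\to\mathbb R$ such that: (a) there is $K(c)\ge0$ with $|c(\bar x)|\le K(c)\varrho(d(\bar x,\bar o))$ for all $\bar x$; (b) $c$ is alternating, $c(x_{\sigma(0)},\dots,x_{\sigma(q)})=\mathrm{sign}(\sigma)c(x_0,\dots,x_q)$ for all permutations $\sigma$; (c) there is $P(c)\ge0$ with $c(x_0,\dots,x_q)=0$ whenever $\max_{i\ne j}d(x_i,x_j)>P(c)$. This does not depend on the basepoint (for a quasi-lattice not containing the given $o$ any other basepoint in it is used). Writing $c=\sum c(x_0,\dots,x_q)[x_0,\dots,x_q]$, the boundary $\partial_q\colon C_q^\varrho(\Gamma)\to C_{q-1}^\varrho(\Gamma)$ is the linear extension of $\partial_q[x_0,\dots,x_q]=\sum_{i=0}^q(-1)^i[x_0,\dots,\hat x_i,\dots,x_q]$ for $q\ge1$, and $\partial_0=0$; $H_q^\varrho(\Gamma)=\ker\partial_q/\mathrm{im}\,\partial_{q+1}$. The fundamental class $[\Gamma]\in H_0^\varrho(\Gamma)$ is the class of $\chi_\Gamma=\sum_{x\in\Gamma}[x]\in C_0^\varrho(\Gamma)$ (the constant function $1$ on $\Gamma$). *)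

(* Defs.v *)
(* MathComp + MathComp-Analysis. *)
From HB Require Import structures.
From mathcomp Require Export all_boot all_order all_algebra all_fingroup.
From mathcomp Require Export all_classical all_reals all_analysis measurable_realfun.

Set Implicit Arguments.
Unset Strict Implicit.
Unset Printing Implicit Defensive.

Export Order.TTheory GRing.Theory Num.Theory.
Export numFieldNormedType.Exports.

#[global] Open Scope classical_set_scope.
#[global] Open Scope ring_scope.

(* Measurable types are pointed in MathComp-Analysis, so a metric space carries
   a point; this only excludes the empty space. No property of it is used. *)
#[short(type="pmetricType")]
HB.structure Definition PointedMetric (K : numDomainType) :=
  { M of Metric K M & isPointed M }.

Section MetricMeasureSpace.
Context {R : realType} {X : pmetricType R}.
Local Open Scope ereal_scope.

Definition borel_set : set (set X) := <<s (@open X)>>.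

Definition borel_fun (g : X -> \bar R) : Prop :=
  measurable_fun [set: g_sigma_algebraType (@open X)] g.

Definition borel_regular (mu : {outer_measure set X -> \bar R}) : Prop :=
  (forall A, borel_set A -> mu.-caratheodory A) /\
  (forall A, exists B, [/\ borel_set B, A `<=` B & mu B = mu A]).

Definition metric_measure_space (mu : {outer_measure set X -> \bar R}) : Prop :=
  [/\ borel_regular mu, 0 < mu [set: X] &
      forall (x : X) (r : R), (0 < r)%R -> mu (ball x r) < +oo].

Definition uniform_space (mu : {outer_measure set X -> \bar R}) : Prop :=
  exists f g : R -> R,
    [/\ (forall r, 0 < r -> 0 < f r /\ 0 < g r)%R,
        (forall r s, 0 < r -> r <= s -> f r <= f s /\ g r <= g s)%R &
        forall (x : X) (r : R), (0 < r)%R ->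
          (f r)%:E <= mu (ball x r) <= (g r)%:E].

(* A path [a, b] -> X is given by any function R -> X continuous within
   [a, b]; its values outside [a, b] play no role below. *)
Record curve := Curve {
  cstart : R;
  cend : R;
  cfun :> R -> X;
  cstart_le_end : (cstart <= cend)%R;
  cfun_continuous : {within `[cstart, cend], continuous cfun} }.

Definition arc_length (f : R -> X) (a b : R) : \bar R :=
  ereal_sup [set (\sum_(0 <= n < size s)
                    mdist (f (nth b (a :: s) n)) (f (nth b (a :: s) n.+1)))%:E
            | s in [set s | itv_partition a b s]].

Definition clength (c : curve) : \bar R := arc_length c (cstart c) (cend c).

Definition rectifiable (c : curve) : Prop := clength c < +oo.

(* The arc-length parametrization s |-> c t, for any t such that c has length s
   on [cstart c, t]; c t does not depend on the choice of such a t. *)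
Definition arc_param (c : curve) (s : R) : X :=
  c (xget (cstart c)
       [set t | (cstart c <= t <= cend c)%R /\
                arc_length c (cstart c) t = s%:E]).

Definition line_integral (g : X -> \bar R) (c : curve) : \bar R :=
  \int[lebesgue_measure]_(s in `[0%R, fine (clength c)]) g (arc_param c s).

Definition quasiconvex : Prop :=
  exists Q : R, (1 <= Q)%R /\
    forall x y : X, exists c : curve,
      [/\ c (cstart c) = x, c (cend c) = y, rectifiable c &
          clength c <= (Q * mdist x y)%:E].

Variable mu : {outer_measure set X -> \bar R}.

(* mu restricted to its Caratheodory-measurable sets. *)
Definition cmeasure : {measure set (caratheodory_type mu) -> \bar R} := mu.

Definition modulus1 (F : set curve) : \bar R :=
  ereal_inf [set \int[cmeasure]_x rho x | rho in
    [set rho : X -> \bar R | [/\ borel_fun rho, (forall x, 0 <= rho x) &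
       forall c, F c -> rectifiable c -> 1 <= line_integral rho c]]].

(* u may take infinite values, with |oo - oo| = oo (as given by the library
   operations). Constant paths are therefore left out: there the inequality is
   trivial when u is finite and undefined otherwise. *)
Definition upper_gradient_along (u g : X -> \bar R) (c : curve) : Prop :=
  `|u (c (cstart c)) - u (c (cend c))| <= line_integral g c.

Definition upper_gradient (u g : X -> \bar R) : Prop :=
  [/\ borel_fun g, forall x, 0 <= g x &
      forall c, 0 < clength c < +oo -> upper_gradient_along u g c].

Definition weak_upper_gradient (u g : X -> \bar R) : Prop :=
  [/\ borel_fun g, forall x, 0 <= g x &
      exists F : set curve, modulus1 F = 0 /\
        forall c, 0 < clength c < +oo -> ~ F c -> upper_gradient_along u g c].

(* "Minimal" means mu-a.e. least among the integrable 1-weak upper gradients.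
   Comparing with non-integrable ones as well would be wrong: on the real line
   a finite a.e. function with infinite integral on every interval is an upper
   gradient of every function, and so are its positive multiples. *)
Definition minimal_weak_upper_gradient (u g : X -> \bar R) : Prop :=
  [/\ weak_upper_gradient u g, cmeasure.-integrable setT g &
      forall h, weak_upper_gradient u h -> cmeasure.-integrable setT h ->
        {ae cmeasure, forall x, g x <= h x}].

(* Representatives of the elements of N^{1,1}(X, d, mu). *)
Definition newton11 (u : X -> \bar R) : Prop :=
  cmeasure.-integrable setT u /\
  exists2 g, upper_gradient u g & cmeasure.-integrable setT g.

Definition bounded_support (u : X -> \bar R) : Prop :=
  exists (x : X) (r : R), closure [set y | u y != 0] `<=` ball x r.

Definition average (A : set X) (h : X -> \bar R) : \bar R :=
  ((fine (mu A))^-1)%:E * \int[cmeasure]_(y in A) h y.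

Definition local_poincare11 (RP : R) : Prop :=
  (0 < RP)%R /\
  exists CP tau : R, [/\ (0 < CP)%R, (1 <= tau)%R &
    forall (x : X) (r : R), (0 < r <= RP)%R ->
      0 < mu (ball x (tau * r)%R) < +oo /\
      forall (u : X -> R) (g : X -> \bar R),
        cmeasure.-integrable (ball x (tau * r)%R) (EFin \o u) ->
        minimal_weak_upper_gradient (EFin \o u) g ->
        average (ball x r)
          (fun y => `|(u y)%:E - average (ball x r) (EFin \o u)|)
        <= (CP * r)%:E * average (ball x (tau * r)%R) g].

(* (S_{1,1}^rho), where g is |grad u|. *)
Definition sobolev11 (rho : R -> R) : Prop :=
  exists (C : R) (o' : X), (0 < C)%R /\
    forall u g : X -> \bar R, newton11 u -> bounded_support u ->
      minimal_weak_upper_gradient u g ->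
      \int[cmeasure]_x `|u x| <=
        C%:E * \int[cmeasure]_x (g x * (rho (mdist o' x))%:E).

End MetricMeasureSpace.

Arguments quasiconvex {R} X.

Definition control_function {R : realType} (rho : R -> R) : Prop :=
  [/\ forall t, 0 <= t -> 0 <= rho t,
      forall s t, 0 <= s -> s <= t -> rho s <= rho t,
      rho 0 = 1 &
      exists L M : R -> R,
        (forall e, 0 < e -> 0 < L e /\ 0 < M e) /\
        (forall t e, 0 < t -> 0 < e ->
           rho (e + t) <= L e * rho t /\ rho (e * t) <= M e * rho t)].

Section NetsAndLattices.
Context {R : realType} {X : pmetricType R}.

Definition maximal_net (N : set X) (eps : R) : Prop :=
  (forall x, exists2 y, N y & mdist x y < eps) /\
  (forall x y, N x -> N y -> x <> y -> eps <= mdist x y).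

Definition net_neighbours (N : set X) (eps : R) (p : N) : set N :=
  [set q | 0 < mdist (val p) (val q) <= 3 * eps].

Definition edge_norm (o p q : X) : R := Num.max (mdist o p) (mdist o q).

Definition quasi_lattice (G : set X) : Prop :=
  (exists2 C : R, 0 < C & forall x, exists2 y, G y & mdist x y < C) /\
  (exists n : R -> nat, forall (x : X) (r : R), 0 < r ->
     (G `&` ball x r #<= `I_(n r))%card).

End NetsAndLattices.

Section CoarseHomology.
Context {R : realType} {X : pmetricType R} {G : set X}.
Variables (rho : R -> R) (b : G).

Definition tuple_dist n (x y : n.-tuple G) : R :=
  \big[Num.max/0]_(i < n) mdist (val (tnth x i)) (val (tnth y i)).

Definition tuple_spread n (x : n.-tuple G) : R :=
  \big[Num.max/0]_(i < n) \big[Num.max/0]_(j < n | j != i)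
    mdist (val (tnth x i)) (val (tnth x j)).

Definition chain q : set (q.+1.-tuple G -> R) :=
  [set c | [/\ exists2 K : R, 0 <= K &
                 forall x, `|c x| <= K * rho (tuple_dist x [tuple b | _ < q.+1]),
               forall (s : 'S_q.+1) x,
                 c [tuple tnth x (s i) | i < q.+1] = (-1) ^+ s * c x &
               exists2 P : R, 0 <= P &
                 forall x, P < tuple_spread x -> c x = 0]].

Definition face q (i : 'I_q.+2) (x : q.+2.-tuple G) : q.+1.-tuple G :=
  [tuple tnth x (lift i j) | j < q.+1].

(* The coefficient at y of the boundary of the simplex [x]. *)
Definition simplex_boundary q (x : q.+2.-tuple G) (y : q.+1.-tuple G) : R :=
  \sum_(i < q.+2) (-1) ^+ i * (face i x == y)%:R.

(* The sum has finitely many nonzero terms when c is a chain and G is uniformly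
   locally finite. The codomain for q = 0 is immaterial, the boundary being 0. *)
Definition boundary q : (q.+1.-tuple G -> R) -> (q.-1.+1.-tuple G -> R) :=
  match q with
  | 0 => fun _ => 0
  | q'.+1 => fun c y => \sum_(x \in [set: q'.+2.-tuple G])
                          c x * simplex_boundary x y
  end.

Definition homology_class q (c : q.+1.-tuple G -> R) :
    set (q.+1.-tuple G -> R) :=
  [set c + boundary e | e in @chain q.+1].

(* The underlying set of ker / im, whose zero is [homology_class 0]. *)
Definition coarse_homology q : set (set (q.+1.-tuple G -> R)) :=
  [set homology_class c | c in [set c | chain c /\ boundary c = 0]].

Definition fundamental_class : set (1.-tuple G -> R) :=
  homology_class (q := 0) (fun _ => 1).

End CoarseHomology.

(* Main.v *)
Require Import Defs.
From HB Require Import structures.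
From mathcomp Require Import ring lra.

Set Implicit Arguments.
Unset Strict Implicit.
Unset Printing Implicit Defensive.

(** (1) => (3): a finitely supported v on the net is extended to X by a Lipschitz
    partition of unity subordinate to balls around net points.  Near p the extension
    has Lipschitz constant at most a multiple of the sum of |v p - v q| over q ~ p and
    differs from v p by at most that sum, so the Sobolev inequality for it gives (3).
    Applying (S_{1,1}) requires a minimal 1-weak upper gradient to exist: it is the
    infimum of a minimizing sequence, because along almost every curve two bounds for
    the increments of u can be pasted along an arbitrary Borel set of parameters.

    (2) <=> (3): uniformity bounds the measures of the balls from both sides.

    (3) => (4): the inequality passes to any quasi-lattice through nearest-point maps.
    There it says that the functional sending the coboundary of v to the sum of v is
    bounded by a weighted l^1 seminorm; a Hahn-Banach extension, evaluated on the
    indicators of edges, is a 1-chain with boundary 1 and the required growth.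

    (4) => (1): a 1-chain on the net with boundary 1 turns the sum of |v p| into a sum
    of |v p - v q| over edges of bounded length, where v p is the mean of u over
    B(p, eps).  Chaining balls along a quasiconvex curve and the Poincaré inequality
    bound |v p - v q| by the integral of the gradient over a large ball around p,
    and these balls have bounded overlap. *)

(** * Arc length in metric spaces *)

(** The minimum of two weak upper gradients must again be one, yet the set where the first is
    smaller is an arbitrary Borel set. So bounds along a curve are required on all its subarcs, at
    the cost of a null family of curves, and pasting becomes a statement about functions on an
    interval.

    Three points shape the rest. Weights move between nearby points and between base points, which
    [control_shift] absorbs in a factor. A ball of radius [4 * eps] about [z] contains the
    [eps]-balls about all points within [3 * eps] of [z], and [4 * eps <= RP] makes the Poincaré
    inequality available there. A 1-chain only has some bound [P] on the length of its edges, so the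
    way from (4) to (1) keeps an inequality of range [P], and quasiconvexity cuts each long edge
    into boundedly many steps of length at most [3 * eps]. *)

Section ArcLength.
Context {R : realType} {X : pmetricType R}.
Implicit Types (f : R -> X) (a b : R).

Fixpoint polygon_length f (x : R) (s : seq R) : R :=
  if s is y :: s' then mdist (f x) (f y) + polygon_length f y s' else 0.

Lemma polygon_lengthE f (d x : R) (s : seq R) :
  \sum_(0 <= n < size s)
     mdist (f (nth d (x :: s) n)) (f (nth d (x :: s) n.+1)) =
  polygon_length f x s.
Proof.
elim: s x => [x|y s IH x]; first by rewrite big_nil.
by rewrite big_nat_recl//= -IH.
Qed.

Lemma polygon_length_cat f x s t :
  polygon_length f x (s ++ t) =
  polygon_length f x s + polygon_length f (last x s) t.
Proof. by elim: s x => [x|y s IH x] /=; rewrite ?add0r// IH addrA. Qed.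

Lemma arc_lengthE f a b : arc_length f a b =
  ereal_sup [set (polygon_length f a s)%:E | s in itv_partition a b].
Proof.
rewrite /arc_length; congr ereal_sup.
by apply/seteqP; split => _ [s sP <-]; exists s => //; rewrite polygon_lengthE.
Qed.

Lemma arc_length_ubound f a b s : itv_partition a b s ->
  ((polygon_length f a s)%:E <= arc_length f a b)%E.
Proof. by move=> sP; rewrite arc_lengthE; apply: ereal_sup_ubound; exists s. Qed.

Lemma arc_length_lub f a b (M : \bar R) :
  (forall s, itv_partition a b s -> ((polygon_length f a s)%:E <= M)%E) ->
  (arc_length f a b <= M)%E.
Proof.
by move=> H; rewrite arc_lengthE; apply: ub_ereal_sup => _ [s sP <-]; exact: H.
Qed.

Lemma arc_lengthxx f a : arc_length f a a = 0%E.
Proof.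
apply/eqP; rewrite eq_le; apply/andP; split.
  by apply: arc_length_lub => s /itv_partitionxx ->.
by have := @arc_length_ubound f a a [::]; apply; split => /=.
Qed.

Lemma arc_length_ge_mdist f a b : a <= b ->
  ((mdist (f a) (f b))%:E <= arc_length f a b)%E.
Proof.
rewrite le_eqVlt => /predU1P[->|ab]; first by rewrite mdistxx arc_lengthxx.
have := @arc_length_ubound f a b [:: b] (itv_partition1 ab).
by rewrite /= addr0.
Qed.

Lemma arc_length_ge0 f a b : a <= b -> (0 <= arc_length f a b)%E.
Proof.
by move=> /(arc_length_ge_mdist f); apply: le_trans; rewrite lee_fin mdist_ge0.
Qed.

(** By the triangle inequality, adding [m] to the partition does not shorten the polygon; the
    induction moves along until it meets the interval containing [m]. *)
Lemma polygon_length_split f a m b s : itv_partition a b s -> a <= m -> m <= b ->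
  ((polygon_length f a s)%:E <= arc_length f a m + arc_length f m b)%E.
Proof.
elim: s a => [a ab am mb|x s IH a].
  by rewrite adde_ge0 // arc_length_ge0.
move=> abs am mb; have xbs := itv_partition_cons abs.
have ax : a < x by case: abs => /= /andP[].
have [xm|mx] := leP x m.
  have {}IH := IH x xbs xm mb.
  apply: (@le_trans _ _ ((mdist (f a) (f x))%:E + (arc_length f x m +
     arc_length f m b))%E); first by rewrite /= EFinD leeD2l.
  rewrite addeA leeD2r//; rewrite addeC -leeBrDr//; apply: arc_length_lub => t tP.
  rewrite leeBrDr//; have := @arc_length_ubound f a m (x :: t).
  rewrite /= EFinD addeC; apply; case: tP => t1 t2.
  by split => //=; rewrite ax.
apply: (@le_trans _ _ ((mdist (f a) (f m))%:E + ((mdist (f m) (f x))%:E +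
   (polygon_length f x s)%:E))%E).
  by rewrite addeA /= !EFinD leeD2r// -EFinD lee_fin metric_triangle.
apply: leeD; first exact: arc_length_ge_mdist.
have := @arc_length_ubound f m b (x :: s).
rewrite /= EFinD; apply; case: xbs => t1 t2.
by split => //=; rewrite mx.
Qed.

Lemma arc_lengthD f a m b : a <= m -> m <= b ->
  arc_length f a b = (arc_length f a m + arc_length f m b)%E.
Proof.
move=> am mb; apply/eqP; rewrite eq_le; apply/andP; split.
  by apply: arc_length_lub => s sP; exact: polygon_length_split.
have H s t : itv_partition a m s -> itv_partition m b t ->
    ((polygon_length f a s)%:E + (polygon_length f m t)%:E <=
      arc_length f a b)%E.
  move=> sP tP; have := arc_length_ubound f (itv_partition_cat sP tP).
  by rewrite polygon_length_cat; case: sP => _ /eqP ->.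
have H1 s : itv_partition a m s ->
    ((polygon_length f a s)%:E + arc_length f m b <= arc_length f a b)%E.
  move=> sP; rewrite addeC -leeBrDr//; apply: arc_length_lub => t tP.
  by rewrite leeBrDr// addeC; exact: H.
have mb0 := arc_length_ge0 f mb.
(* Only a finite length can be moved to the other side. If this one is infinite, a single partition
   of [[a, m]] already makes the total infinite. *)
case E : (arc_length f m b) (mb0) H1 => [r| |]// _ H1; last first.
  rewrite addey//; last by have := arc_length_ge0 f am; case: arc_length.
  have [s sP] : exists s, itv_partition a m s.
    move: am; rewrite le_eqVlt => /predU1P[->|am]; first by exists [::]; split => /=.
    by exists [:: m]; exact: itv_partition1.
  by have := H1 s sP; rewrite addey//.
rewrite -leeBrDr//; apply: arc_length_lub => s sP.
by rewrite leeBrDr//; exact: H1.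
Qed.

Lemma arc_length_sub f a b (s t : R) : a <= s -> s <= t -> t <= b ->
  (arc_length f s t <= arc_length f a b)%E.
Proof.
move=> as_ st tb; rewrite (@arc_lengthD f a s b)//; last exact: le_trans tb.
rewrite (@arc_lengthD f s t b)//.
rewrite (@le_trans _ _ (arc_length f s t + arc_length f t b))%E//.
  by rewrite leeDl// arc_length_ge0.
by rewrite leeDr// arc_length_ge0.
Qed.

(** The pieces outside [[s, t]] are at least as long as their chords, and the chord from [f a] to
    [f b] is at most the broken line through [f s] and [f t]; so the excess of length over chord can
    only decrease. *)
Lemma tight_arc_sub f a b (s t e : R) : a <= s -> s <= t -> t <= b ->
  (arc_length f a b <= (mdist (f a) (f b) + e)%:E)%E ->
  (arc_length f s t <= (mdist (f s) (f t) + e)%:E)%E.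
Proof.
move=> as_ st tb H.
have sb : s <= b by exact: le_trans tb.
have fin : (arc_length f a b < +oo)%E by rewrite (le_lt_trans H) ?ltry.
move: H; rewrite (@arc_lengthD f a s b)// (@arc_lengthD f s t b)//.
have := arc_length_ge_mdist f as_; have := arc_length_ge_mdist f tb.
have : (arc_length f s t \is a fin_num)%E.
  by rewrite ge0_fin_numE ?arc_length_ge0// (le_lt_trans _ fin)// arc_length_sub.
have : (arc_length f a s \is a fin_num)%E.
  rewrite ge0_fin_numE ?arc_length_ge0// (le_lt_trans _ fin)// arc_length_sub//.
have : (arc_length f t b \is a fin_num)%E.
  rewrite ge0_fin_numE ?arc_length_ge0// (le_lt_trans _ fin)// arc_length_sub//.
  exact: le_trans st.
case: (arc_length f t b) => // x1 _; case: (arc_length f a s) => // x2 _.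
case: (arc_length f s t) => // x3 _.
rewrite -!EFinD !lee_fin.
have := metric_triangle (f a) (f s) (f b).
have := metric_triangle (f s) (f t) (f b).
lra.
Qed.

(** If a polygon misses the total length by at most [e], so does each of its edges. The partition
    interval around [t0] thus gives an arc ending at [t0] that is nearly as short as its chord: one
    half of the continuity of arc length. *)
Lemma tight_arc_left f x b s t0 (e : R) : itv_partition x b s ->
  (arc_length f x b <= (polygon_length f x s + e)%:E)%E -> x < t0 -> t0 <= b ->
  exists2 y, y < t0 & (x <= y) /\
    (arc_length f y t0 <= (mdist (f y) (f t0) + e)%:E)%E.
Proof.
elim: s x => [x [_ /= /eqP ->] _ xt tb|y s IH x sP].
  by move: (lt_le_trans xt tb); rewrite ltxx.
move=> Hl xt tb; have ysP := itv_partition_cons sP.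
have xy : x < y by case: sP => /= /andP[].
have yb := itv_partition_le ysP.
have D := arc_lengthD f (ltW xy) yb.
have fin : (arc_length f x b < +oo)%E by rewrite (le_lt_trans Hl) ?ltry.
have [f1 f2] : (arc_length f x y \is a fin_num /\ arc_length f y b \is a fin_num)%E.
  by split; rewrite ge0_fin_numE ?arc_length_ge0// ?(ltW xy)// (le_lt_trans _ fin)//
    arc_length_sub// ltW.
have g1 := arc_length_ge_mdist f (ltW xy).
have g2 := arc_length_ubound f ysP.
have [yt|ty] := ltP y t0.
  have [|z zt [yz Hz]] := IH y ysP _ yt tb.
    move: Hl; rewrite D /=; move: f1 f2 g1 g2.
    case: (arc_length f x y) => // r1 _; case: (arc_length f y b) => // r2 _.
    by rewrite -EFinD !lee_fin; lra.
  by exists z => //; split => //; rewrite (le_trans (ltW xy)).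
exists x => //; split => //.
apply: (@tight_arc_sub f x y) => //; first exact: ltW.
move: Hl; rewrite D /=; move: f1 f2 g1 g2.
case: (arc_length f x y) => // r1 _; case: (arc_length f y b) => // r2 _.
by rewrite -EFinD !lee_fin; lra.
Qed.

Lemma tight_arc_right f x b s t0 (e : R) : itv_partition x b s ->
  (arc_length f x b <= (polygon_length f x s + e)%:E)%E -> x <= t0 -> t0 < b ->
  exists2 y, t0 < y & (y <= b) /\
    (arc_length f t0 y <= (mdist (f t0) (f y) + e)%:E)%E.
Proof.
elim: s x => [x [_ /= /eqP ->] _ xt tb|y s IH x sP].
  by move: (le_lt_trans xt tb); rewrite ltxx.
move=> Hl xt tb; have ysP := itv_partition_cons sP.
have xy : x < y by case: sP => /= /andP[].
have yb := itv_partition_le ysP.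
have D := arc_lengthD f (ltW xy) yb.
have fin : (arc_length f x b < +oo)%E by rewrite (le_lt_trans Hl) ?ltry.
have [f1 f2] : (arc_length f x y \is a fin_num /\ arc_length f y b \is a fin_num)%E.
  by split; rewrite ge0_fin_numE ?arc_length_ge0// ?(ltW xy)// (le_lt_trans _ fin)//
    arc_length_sub// ltW.
have g1 := arc_length_ge_mdist f (ltW xy).
have g2 := arc_length_ubound f ysP.
have [yt|ty] := leP y t0.
  apply: (IH y ysP _ yt tb).
  move: Hl; rewrite D /=; move: f1 f2 g1 g2.
  case: (arc_length f x y) => // r1 _; case: (arc_length f y b) => // r2 _.
  by rewrite -EFinD !lee_fin; lra.
exists y => //; split => //.
apply: (@tight_arc_sub f x y) => //; first exact: ltW.
move: Hl; rewrite D /=; move: f1 f2 g1 g2.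
case: (arc_length f x y) => // r1 _; case: (arc_length f y b) => // r2 _.
by rewrite -EFinD !lee_fin; lra.
Qed.

End ArcLength.

Section ArcParam.
Context {R : realType} {X : pmetricType R}.
Implicit Types (c : @curve R X) (s t : R).

Definition len c : R := fine (clength c).

Lemma curve_continuous c t e : cstart c <= t <= cend c -> 0 < e ->
  exists2 d, 0 < d & forall u, cstart c <= u <= cend c -> `|t - u| < d ->
    mdist (c t) (c u) < e.
Proof.
move=> tc e0; have /subspace_continuousP/(_ t) := @cfun_continuous _ _ c.
have tc' : [set` `[cstart c, cend c]] t by rewrite /= in_itv.
move=> /(_ tc') /metricType_numDomainType.cvgrPdist_lt/(_ e e0).
rewrite near_withinE => /nbhs_ballP[d /= d0 H]; exists d => // u uc ut.
by apply: H => //=; rewrite in_itv.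
Qed.

Lemma near_tight_partition c (e : R) : rectifiable c -> 0 < e ->
  exists2 s, itv_partition (cstart c) (cend c) s &
    (clength c <= (polygon_length c (cstart c) s + e)%:E)%E.
Proof.
move=> rc e0; apply: contrapT => H.
have c0 : (0 <= clength c)%E by apply: arc_length_ge0; exact: cstart_le_end.
have cf : clength c \is a fin_num by rewrite ge0_fin_numE.
have : (clength c <= clength c - e%:E)%E.
  apply: arc_length_lub => s sP; rewrite leeBrDr// -EFinD leNgt; apply/negP => Hs.
  by apply: H; exists s => //; exact: ltW.
move: cf; case: (clength c) => // r _; rewrite -EFinB lee_fin; lra.
Qed.

(** One half of [e] is the excess over the chord left by a near-optimal partition; the other bounds
    the chord, by continuity of [c]. *)
Lemma small_arc c t (e : R) : rectifiable c -> cstart c <= t <= cend c -> 0 < e ->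
  exists2 d, 0 < d & forall u, cstart c <= u <= cend c -> `|t - u| < d ->
    (arc_length c (Num.min t u) (Num.max t u) <= e%:E)%E.
Proof.
move=> rc tc e0; have e20 : 0 < e / 2 by lra.
have [s sP sH] := near_tight_partition rc e20.
have [d0 d00 Hd0] := curve_continuous tc e20.
have [d1 d10 H1] : exists2 d, 0 < d & forall u, cstart c <= u -> u <= t ->
    t - u < d -> (arc_length c u t <= (mdist (c u) (c t) + e / 2)%:E)%E.
  have [ta|at_] := leP t (cstart c).
    exists 1 => // u au ut _; have -> : u = t by lra.
    by rewrite arc_lengthxx lee_fin mdistxx; lra.
  have [y yt [ay Hy]] := tight_arc_left sP sH at_ (proj2 (andP tc)).
  exists (t - y); first by rewrite subr_gt0.
  by move=> u au ut tu; apply: (tight_arc_sub _ _ _ Hy) => //; lra.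
have [d2 d20 H2] : exists2 d, 0 < d & forall u, t <= u -> u <= cend c ->
    u - t < d -> (arc_length c t u <= (mdist (c t) (c u) + e / 2)%:E)%E.
  have [bt|tb] := leP (cend c) t.
    exists 1 => // u tu ub _; have -> : u = t by lra.
    by rewrite arc_lengthxx lee_fin mdistxx; lra.
  have [y yt [yb Hy]] := tight_arc_right sP sH (proj1 (andP tc)) tb.
  exists (y - t); first by rewrite subr_gt0.
  by move=> u tu ub ut; apply: (tight_arc_sub _ _ _ Hy) => //; lra.
exists (Num.min d0 (Num.min d1 d2)); first by rewrite !lt_min d00 d10.
move=> u /andP[au ub]; rewrite !lt_min => /and3P[ud0 ud1 ud2].
have Hu := Hd0 u _ ud0.
have [tu|ut] := leP t u.
  rewrite ler0_norm in ud2; last by lra.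
  apply: (le_trans (H2 u tu ub _)); first by lra.
  by rewrite lee_fin; have := Hu; rewrite au ub => /(_ isT); lra.
rewrite ger0_norm in ud1; last by lra.
apply: (le_trans (H1 u au (ltW ut) ud1)).
by rewrite lee_fin metric_sym; have := Hu; rewrite au ub => /(_ isT); lra.
Qed.

Lemma arc_fin_num c s t : rectifiable c -> cstart c <= s -> s <= t ->
  t <= cend c -> arc_length c s t \is a fin_num.
Proof.
move=> rc as_ st tb; rewrite ge0_fin_numE ?arc_length_ge0//.
by rewrite (le_lt_trans _ rc)// arc_length_sub.
Qed.

Lemma len_ge0 c : 0 <= len c.
Proof. by rewrite fine_ge0// arc_length_ge0//; exact: cstart_le_end. Qed.

Lemma lenE c : rectifiable c -> clength c = (len c)%:E.
Proof. by move=> rc; rewrite fineK// arc_fin_num//; exact: cstart_le_end. Qed.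

Lemma arc_length_surj c s : rectifiable c -> 0 <= s <= len c ->
  exists2 t, cstart c <= t <= cend c & arc_length c (cstart c) t = s%:E.
Proof.
move=> rc /andP[s0 sl].
pose f t := fine (arc_length c (cstart c) t).
have ab := @cstart_le_end _ _ c.
have fE t : cstart c <= t <= cend c -> arc_length c (cstart c) t = (f t)%:E.
  by move=> /andP[at_ tb]; rewrite fineK// arc_fin_num.
have fcont : {within `[cstart c, cend c], continuous f}.
  apply/subspace_continuousP => t; rewrite /= in_itv/= => tc.
  apply/cvgrPdist_le => e e0; rewrite near_withinE.
  have [d d0 H] := small_arc rc tc e0.
  apply/nbhs_ballP; exists d => // u ut; rewrite /= in_itv/= => uc.
  move: (H u uc ut) => {}H.
  have /andP[at_ tb] := tc; have /andP[au ub] := uc.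
  have Et := fE t tc; have Eu := fE u uc.
  move: H; case: (leP t u) => [tu|ltut] H.
    move: Eu; rewrite (@arc_lengthD _ _ c _ t)// Et.
    have := @arc_length_ge0 _ _ c _ _ tu.
    move: H; case: (arc_length c t u) => [r| |] //.
    rewrite !lee_fin -EFinD => re r0 [E]; change (`|f t - f u| <= e); rewrite -E.
    by rewrite opprD addrA subrr add0r normrN ger0_norm.
  have ut' := ltW ltut.
  move: Et; rewrite (@arc_lengthD _ _ c _ u)// Eu.
  have := @arc_length_ge0 _ _ c _ _ ut'.
  move: H; case: (arc_length c u t) => [r| |] //.
  rewrite !lee_fin -EFinD => re r0 [E]; change (`|f t - f u| <= e); rewrite -E.
  by rewrite addrAC subrr add0r ger0_norm.
have fa : f (cstart c) = 0 by rewrite /f arc_lengthxx.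
have fb : f (cend c) = len c by [].
have [|t tP ft] := IVT ab fcont (v := s).
  by rewrite fa fb ge_min le_max s0 sl orbT.
rewrite in_itv/= in tP; exists t => //; by rewrite fE// ft.
Qed.

(** A curve may rest, so the parameter reached after a given length is not unique; the point is,
    since an arc of length zero has a zero chord. Hence the choice made by [xget] in [arc_param]
    does not matter. *)
Lemma arc_length_inj c s t : rectifiable c -> cstart c <= s <= cend c ->
  cstart c <= t <= cend c ->
  arc_length c (cstart c) s = arc_length c (cstart c) t -> c s = c t.
Proof.
move=> rc; wlog st : s t / s <= t => [H|].
  move=> sc tc E; have [st|ts] := leP s t; first exact: H.
  by apply/esym/H => //; exact: ltW.
move=> /andP[as_ sb] /andP[at_ tb]; rewrite (@arc_lengthD _ _ c _ s t)//.
have := arc_fin_num rc (lexx _) as_ sb.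
have := arc_fin_num rc as_ st tb.
have := arc_length_ge_mdist c st.
case: (arc_length c s t) => // r rd _; case: (arc_length c _ s) => // r' _ [] rr.
apply: mdist_positivity; apply/eqP; rewrite eq_le mdist_ge0 andbT.
by move: rd; rewrite lee_fin; lra.
Qed.

Lemma arc_paramE c s t : rectifiable c -> cstart c <= t <= cend c ->
  arc_length c (cstart c) t = s%:E -> arc_param c s = c t.
Proof.
move=> rc tc E; rewrite /arc_param.
set P := [set u | _]; have /(xgetI (cstart c)) [H1 H2] : P t by split.
by apply: arc_length_inj => //; rewrite H2.
Qed.

Lemma arc_param0 c : rectifiable c -> arc_param c 0 = c (cstart c).
Proof.
move=> rc; apply: arc_paramE => //; last exact: arc_lengthxx.
by rewrite lexx cstart_le_end.
Qed.

Lemma arc_param_len c : rectifiable c -> arc_param c (len c) = c (cend c).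
Proof.
move=> rc; apply: arc_paramE => //; last exact: lenE.
by rewrite lexx cstart_le_end.
Qed.

Lemma arc_param_sub c s t : rectifiable c -> 0 <= s -> s <= t -> t <= len c ->
  exists u v, [/\ cstart c <= u, u <= v, v <= cend c,
    arc_length c (cstart c) u = s%:E & arc_length c (cstart c) v = t%:E].
Proof.
move=> rc s0 st tl.
have [|u /andP[au ub] Eu] := @arc_length_surj c s rc; first by rewrite s0 (le_trans st).
have [|v /andP[av vb] Ev] := @arc_length_surj c t rc; first by rewrite tl (le_trans s0).
have [uv|vu] := leP u v; first by exists u, v.
(* If [v < u], monotonicity of length forces [s = t], and [u] serves for both. *)
exists u, u; split => //; rewrite Eu; congr EFin.
have := arc_length_sub c (lexx _) av (ltW vu); rewrite Eu Ev lee_fin; lra.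
Qed.

Lemma arc_param_lipschitz c s t : rectifiable c -> 0 <= s -> s <= t ->
  t <= len c -> mdist (arc_param c s) (arc_param c t) <= t - s.
Proof.
move=> rc s0 st tl; have [u [v [au uv vb Eu Ev]]] := arc_param_sub rc s0 st tl.
rewrite (arc_paramE rc _ Eu); last by rewrite au (le_trans uv).
rewrite (arc_paramE rc _ Ev); last by rewrite vb (le_trans au).
move: Ev; rewrite (@arc_lengthD _ _ c _ u v)// Eu.
have := arc_length_ge_mdist c uv.
case: (arc_length c u v) => // r; rewrite lee_fin -EFinD => dr [<-].
by rewrite addrAC subrr add0r.
Qed.

(** Upper gradient inequalities concern the two ends of a curve. Realizing an interval of arc length
    as a curve of its own makes them available between any two points of [c]. *)
Lemma subcurve_exists c s t : rectifiable c -> 0 <= s -> s <= t -> t <= len c ->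
  exists c', [/\ rectifiable c', clength c' = (t - s)%:E &
    forall x, 0 <= x <= t - s -> arc_param c' x = arc_param c (s + x)].
Proof.
move=> rc s0 st tl; have [u [v [au uv vb Eu Ev]]] := arc_param_sub rc s0 st tl.
have cont : {within `[u, v], continuous c}.
  apply: continuous_subspaceW (@cfun_continuous _ _ c) => x /=.
  by rewrite !in_itv/= => /andP[ux xv]; rewrite (le_trans au)//= (le_trans xv).
pose c' := Curve uv cont.
have lc' : clength c' = (t - s)%:E.
  move: Ev; rewrite (@arc_lengthD _ _ c _ u v)// Eu /clength /=.
  case: (arc_length c u v) => // r; rewrite -EFinD => -[<-].
  by rewrite addrAC subrr add0r.
have rc' : rectifiable c' by rewrite /rectifiable lc' ltry.
exists c'; split => // x xl.
have [|y /= /andP[uy yv] Hy] := @arc_length_surj c' x rc'.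
  by rewrite /len lc'.
apply: (etrans (arc_paramE rc' _ Hy)); first by rewrite /= uy.
apply/esym/arc_paramE => //; first by rewrite (le_trans au)//= (le_trans yv).
by rewrite (@arc_lengthD _ _ c _ u y)// Eu Hy.
Qed.

(* Clamping the parameter to [0, len c] makes the path 1-Lipschitz on the whole line. *)
Definition arc_path c (s : R) : X := arc_param c (Num.max 0 (Num.min s (len c))).

Lemma arc_pathE c s : 0 <= s <= len c -> arc_path c s = arc_param c s.
Proof. by move=> /andP[s0 sl]; rewrite /arc_path min_l// max_r. Qed.

Lemma arc_path_lipschitz c s t : rectifiable c ->
  mdist (arc_path c s) (arc_path c t) <= `|s - t|.
Proof.
move=> rc; wlog st : s t / s <= t => [H|].
  have [st|ts] := leP s t; first exact: H.
  by rewrite metric_sym distrC; apply: H; exact: ltW.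
have l0 := len_ge0 c.
rewrite ler0_norm ?subr_le0// opprB.
have Hm : Num.min s (len c) <= Num.min t (len c).
  by rewrite le_min !ge_min st lexx orbT.
have Hd : Num.min t (len c) - Num.min s (len c) <= t - s.
  have h : Num.min t (len c) <= t by rewrite ge_min lexx.
  have h' : Num.min t (len c) <= len c by rewrite ge_min lexx orbT.
  have [sl|ls] := leP s (len c); lra.
have Hl : Num.min t (len c) <= len c by rewrite ge_min lexx orbT.
rewrite /arc_path; move: Hm Hd Hl; set x := Num.min s _; set y := Num.min t _.
move=> xy yx yl; apply: (le_trans (@arc_param_lipschitz _ _ _ rc _ _ _)).
- by rewrite le_max lexx.
- by rewrite ge_max !le_max lexx/= xy orbT.
- by rewrite ge_max l0.
have h : 0 <= Num.max 0 x by rewrite le_max lexx.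
have h' : x <= Num.max 0 x by rewrite le_max lexx orbT.
have [y0|y0] := leP 0 y; lra.
Qed.

Lemma arc_path_continuous c : rectifiable c -> continuous (arc_path c : R -> X).
Proof.
move=> rc s; apply/metricType_numDomainType.cvgrPdist_lt => e e0.
apply/nbhs_ballP; exists e => // t st.
exact: le_lt_trans (arc_path_lipschitz _ _ rc) st.
Qed.

End ArcParam.

(** * Pasting bounds for increments on an interval *)

Lemma ge0_integral_itv_split (R : realType) (G : R -> \bar R) (s c t : R) :
  measurable_fun [set: R] G -> (forall x, 0 <= G x)%E -> s <= c -> c <= t ->
  (\int[lebesgue_measure]_(x in `[s, t]) G x =
   \int[lebesgue_measure]_(x in `[s, c]) G x +
   \int[lebesgue_measure]_(x in `[c, t]) G x)%E.
Proof.
move=> mG G0 sc ct; have mG' (D : set R) : measurable_fun D G.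
  exact: measurable_funS mG.
rewrite -(@integral_itv_bndo_bndc _ (BLeft s) c G)//.
rewrite (@itv_bndbnd_setU _ _ (BLeft s) (BLeft c) (BRight t)) ?bnd_simp//.
rewrite ge0_integral_setU//; first exact: mG'.
apply/disj_setPS => x [] /=.
by rewrite !in_itv/= => /andP[_ xc] /andP[]; rewrite leNgt xc.
Qed.

Section GradientBound.
Context {R : realType}.
Local Notation leb := (@lebesgue_measure R).
Variables (f : R -> R) (l : R).
Local Open Scope ereal_scope.

(** Later [f] is a function along a curve and [G] a weak upper gradient along it. Quantifying over
    subintervals makes pasting possible; the finite total integral supplies the dominating function
    for limits. *)
Definition bounds_increments (G : R -> \bar R) :=
  [/\ measurable_fun [set: R] G, (forall x, 0 <= G x),
      \int[leb]_(x in `[0%R, l]) G x < +oo &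
      forall s t : R, (0 <= s)%R -> (s <= t)%R -> (t <= l)%R ->
        (`|f s - f t|%R)%:E <= \int[leb]_(x in `[s, t]) G x].

Definition paste (A : set R) (G1 G2 : R -> \bar R) (x : R) : \bar R :=
  if x \in A then G1 x else G2 x.

(* These sets form a sigma-algebra (dominated convergence for countable unions)
   containing the rays, hence comprise all Borel sets. *)
Let pasteable : set (set R) := [set A | measurable A /\
  forall G1 G2, bounds_increments G1 -> bounds_increments G2 ->
    bounds_increments (paste A G1 G2)].

Lemma paste_measurable A G1 G2 : measurable A -> measurable_fun [set: R] G1 ->
  measurable_fun [set: R] G2 -> measurable_fun [set: R] (paste A G1 G2).
Proof.
move=> mA m1 m2; apply: measurable_fun_ifT => //.
apply: (measurable_fun_bool true); rewrite setTI.
suff -> : (fun x => x \in A) @^-1` [set true] = A by [].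
by apply/seteqP; split => x /=; [move/set_mem|move/mem_set].
Qed.

Let le_itv0 (G : R -> \bar R) (s t : R) : measurable_fun [set: R] G ->
  (forall x, 0 <= G x) -> (0 <= s)%R -> (t <= l)%R ->
  \int[leb]_(x in `[s, t]) G x <= \int[leb]_(x in `[0%R, l]) G x.
Proof.
move=> mG G0 s0 tl; apply: ge0_subset_integral => //.
  exact: measurable_funS mG.
by move=> x /=; rewrite !in_itv/= => /andP[sx xt]; rewrite (le_trans s0)//= (le_trans xt).
Qed.

Lemma paste_le A G1 G2 x : (forall x, 0 <= G1 x) -> (forall x, 0 <= G2 x) ->
  paste A G1 G2 x <= G1 x + G2 x.
Proof.
by move=> p1 p2; rewrite /paste; case: ifP => _; rewrite ?leeDl ?leeDr.
Qed.

Lemma paste_ge0 A G1 G2 x : (forall x, 0 <= G1 x) -> (forall x, 0 <= G2 x) ->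
  0 <= paste A G1 G2 x.
Proof. by move=> p1 p2; rewrite /paste; case: ifP. Qed.

Lemma integrable_sum G1 G2 : bounds_increments G1 -> bounds_increments G2 ->
  \int[leb]_(x in `[0%R, l]) (G1 x + G2 x) < +oo.
Proof.
move=> [m1 p1 i1 _] [m2 p2 i2 _]; rewrite ge0_integralD//.
- exact: lte_add_pinfty.
- exact: measurable_funS m1.
- exact: measurable_funS m2.
Qed.

Lemma paste_integral A G1 G2 : measurable A ->
  bounds_increments G1 -> bounds_increments G2 ->
  \int[leb]_(x in `[0%R, l]) paste A G1 G2 x < +oo.
Proof.
move=> mA h1 h2; apply: le_lt_trans (integrable_sum h1 h2).
have [m1 p1 i1 _] := h1; have [m2 p2 i2 _] := h2.
apply: ge0_le_integral => //.
- by move=> x _; exact: paste_ge0.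
- by apply: (measurable_funS measurableT) => //; exact: paste_measurable.
- by apply: (measurable_funS measurableT) => //; exact: emeasurable_funD.
- by move=> x _; exact: paste_le.
Qed.

Let pasteable_ray (c : R) : pasteable `]c, +oo[%classic.
Proof.
split => // G1 G2 h1 h2; have [m1 p1 i1 b1] := h1; have [m2 p2 i2 b2] := h2.
have mp : measurable_fun [set: R] (paste `]c, +oo[%classic G1 G2).
  exact: paste_measurable.
split => //; [by move=> x; exact: paste_ge0|exact: paste_integral|].
have right s t : (c <= s)%R -> \int[leb]_(x in `[s, t]) paste `]c, +oo[%classic G1 G2 x =
    \int[leb]_(x in `[s, t]) G1 x.
  move=> cs; rewrite -[LHS]integral_itv_obnd_cbnd; last first.
    exact: measurable_funS mp.
  rewrite -[RHS]integral_itv_obnd_cbnd; last first.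
    exact: measurable_funS m1.
  apply: eq_integral => x; rewrite inE/= in_itv/= => /andP[sx _].
  by rewrite /paste mem_set//= in_itv/= andbT (le_lt_trans cs).
have left s t : (t <= c)%R -> \int[leb]_(x in `[s, t]) paste `]c, +oo[%classic G1 G2 x =
    \int[leb]_(x in `[s, t]) G2 x.
  move=> tc; apply: eq_integral => x; rewrite inE/= in_itv/= => /andP[_ xt].
  by rewrite /paste memNset//= in_itv/= andbT; apply/negP; rewrite -leNgt (le_trans xt).
move=> s t s0 st tl; have [cs|sc] := leP c s; first by rewrite right//; exact: b1.
have [tc|ct] := leP t c; first by rewrite left//; exact: b2.
rewrite (@ge0_integral_itv_split _ _ s c t) ?(ltW sc) ?(ltW ct)//; last by move=> x;
  exact: paste_ge0.
rewrite (right c t)// (left s c)//.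
apply: (@le_trans _ _ ((`|f s - f c|)%:E + (`|f c - f t|)%:E)).
  by rewrite -EFinD lee_fin ler_distD.
by apply: leeD; [apply: b2|apply: b1]; lra.
Qed.

Let pasteableC A : pasteable A -> pasteable (~` A).
Proof.
move=> [mA hA]; split; first exact: measurableC.
move=> G1 G2 h1 h2; suff -> : paste (~` A) G1 G2 = paste A G2 G1 by exact: hA.
by apply/funext => x; rewrite /paste in_setC; case: (x \in A).
Qed.

Let pasteableU A B : pasteable A -> pasteable B -> pasteable (A `|` B).
Proof.
move=> [mA hA] [mB hB]; split; first exact: measurableU.
move=> G1 G2 h1 h2.
suff -> : paste (A `|` B) G1 G2 = paste A G1 (paste B G1 G2).
  by apply: hA => //; exact: hB.
by apply/funext => x; rewrite /paste in_setU; case: (x \in A).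
Qed.

Let pasteable0 : pasteable set0.
Proof.
split => // G1 G2 h1 h2; suff -> : paste set0 G1 G2 = G2 by [].
by apply/funext => x; rewrite /paste in_set0.
Qed.

Let pasteable_bigU (A : (set R)^nat) n : (forall i, pasteable (A i)) ->
  pasteable (\big[setU/set0]_(i < n) A i).
Proof.
move=> hA; elim: n => [|n IH]; first by rewrite big_ord0.
by rewrite big_ord_recr; exact: pasteableU.
Qed.

Let pasteable_bigcup (A : (set R)^nat) : (forall i, pasteable (A i)) ->
  pasteable (\bigcup_i A i).
Proof.
move=> hA; have mA : measurable (\bigcup_i A i).
  by apply: bigcup_measurable => i _; have [] := hA i.
split => // G1 G2 h1 h2; have [m1 p1 i1 b1] := h1; have [m2 p2 i2 b2] := h2.
have mp := paste_measurable mA m1 m2.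
split => //; [by move=> x; exact: paste_ge0|exact: paste_integral|].
move=> s t s0 st tl.
pose B n := \big[setU/set0]_(i < n) A i.
have hB n : bounds_increments (paste (B n) G1 G2) by have [_] := pasteable_bigU n hA; exact.
have [||||||_ _ cvg] := @dominated_convergence _ _ _ leb `[s, t]%classic _
  (fun n => paste (B n) G1 G2) (paste (\bigcup_i A i) G1 G2) (G1 \+ G2).
- by [].
- by move=> n; have [m _ _ _] := hB n; exact: measurable_funS m.
- exact: measurable_funS mp.
- apply: aeW => x _; apply: cvg_near_cst.
  have [[i _ Aix]|nA] := pselect ((\bigcup_i A i) x).
    near=> n; rewrite /paste !mem_set//; first by exists i.
    rewrite /B -bigcup_mkord; exists i => //=; near: n; exact: nbhs_infty_gt.
  near=> n; rewrite /paste !memNset// /B -bigcup_mkord => -[k _ Akx].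
  by apply: nA; exists k.
- apply/integrableP; split.
    by apply: (measurable_funS measurableT) => //; exact: emeasurable_funD.
  under eq_integral do rewrite gee0_abs ?adde_ge0//.
  apply: le_lt_trans (integrable_sum h1 h2); apply: le_itv0 => //.
    exact: emeasurable_funD.
  by move=> x; exact: adde_ge0.
- apply: aeW => x n _; rewrite gee0_abs; last exact: paste_ge0.
  exact: paste_le.
rewrite -(cvg_lim _ cvg)//; apply: lime_ge; first by apply/cvg_ex; eexists; exact: cvg.
by apply: nearW => n; have [_ _ _] := hB n; exact.
Unshelve. all: by end_near. Qed.

Lemma bounds_increments_paste A G1 G2 : measurable A ->
  bounds_increments G1 -> bounds_increments G2 ->
  bounds_increments (paste A G1 G2).
Proof.
suff H : measurable `<=` pasteable by move=> /H[_]; exact.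
rewrite [X in X `<=` _]RGenOInfty.measurableE.
apply: smallest_sub => [|_ [c ->]]; last exact: pasteable_ray.
split => //; first by move=> B /pasteableC; rewrite setTD.
Qed.

(** The set where [G1 < G2] is measurable but otherwise arbitrary; this is why pasting along
    intervals would not suffice. *)
Lemma bounds_increments_min G1 G2 : bounds_increments G1 ->
  bounds_increments G2 -> bounds_increments (fun x => mine (G1 x) (G2 x)).
Proof.
move=> h1 h2; have [m1 _ _ _] := h1; have [m2 _ _ _] := h2.
have mA : measurable [set x | G1 x < G2 x].
  by rewrite -[X in measurable X]setTI; exact: emeasurable_fun_lt.
suff -> : (fun x => mine (G1 x) (G2 x)) = paste [set x | G1 x < G2 x] G1 G2.
  exact: bounds_increments_paste.
apply/funext => x; rewrite /paste /mine; congr (if _ then _ else _).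
by apply/idP/idP => [H|/set_mem//]; exact/mem_set.
Qed.

(** [einfs _ 0] is the infimum of the whole sequence, hence the limit of the decreasing finite
    minima [H n], all dominated by [G 0]. *)
Lemma bounds_increments_einfs (G : (R -> \bar R)^nat) :
  (forall n, bounds_increments (G n)) ->
  bounds_increments (fun x => einfs (G ^~ x) 0%N).
Proof.
move=> hG.
pose H n x := \big[mine/+oo]_(i < n.+1) G i x.
have HS n x : H n.+1 x = mine (H n x) (G n.+1 x) by rewrite /H big_ord_recr.
have hH n : bounds_increments (H n).
  elim: n => [|n IH].
    suff -> : H 0%N = G 0%N by [].
    by apply/funext => x; rewrite /H big_ord_recr big_ord0/= /mine ltNge leey.
  have -> : H n.+1 = fun x => mine (H n x) (G n.+1 x) by apply/funext => x.
  exact: bounds_increments_min.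
have mG : measurable_fun [set: R] (fun x => einfs (G ^~ x) 0%N).
  by apply: measurable_fun_einfs => n; have [] := hG n.
have pG x : 0 <= einfs (G ^~ x) 0%N.
  by apply: le_ereal_inf_tmp => _ [n _ <-]; have [_ + _ _] := hG n; apply.
have einfs_le n x : einfs (G ^~ x) 0%N <= G n x.
  by apply: ereal_inf_lbound; exists n.
have [m0 p0 i0 _] := hG 0%N.
split => //.
  apply: le_lt_trans i0; apply: ge0_le_integral => //.
  - exact: measurable_funS mG.
  - exact: measurable_funS m0.
move=> s t s0 st tl.
have [||||||_ _ cvg] := @dominated_convergence _ _ _ leb `[s, t]%classic _
  H (fun x => einfs (G ^~ x) 0%N) (G 0%N).
- by [].
- by move=> n; have [m _ _ _] := hH n; exact: measurable_funS m.
- exact: measurable_funS mG.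
- apply: aeW => x _.
  have Hdec : {homo (H ^~ x) : m n / (m <= n)%N >-> n <= m}.
    apply: homo_leq => [//|a b c ab bc|n]; first exact: le_trans ab.
    by rewrite HS ge_min lexx.
  suff -> : einfs (G ^~ x) 0%N = ereal_inf (range (H ^~ x)).
    exact: ereal_nonincreasing_cvgn.
  apply/eqP; rewrite eq_le; apply/andP; split.
    apply: le_ereal_inf_tmp => _ [n _ <-].
    elim: n => [|n IH]; first by rewrite /H big_ord_recr big_ord0/= le_min leey/= .
    by rewrite HS le_min IH/=.
  apply: le_ereal_inf_tmp => _ [n _ <-].
  apply: (@le_trans _ _ (H n x)); first by apply: ereal_inf_lbound; exists n.
  by rewrite /H big_ord_recr/= ge_min lexx orbT.
- apply/integrableP; split; first exact: measurable_funS m0.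
  under eq_integral do rewrite gee0_abs//.
  by apply: le_lt_trans i0; exact: le_itv0.
- apply: aeW => x n _; have [_ pH _ _] := hH n; rewrite gee0_abs//.
  elim: n {pH} => [|n IH]; first by rewrite /H big_ord_recr big_ord0/= ge_min lexx orbT.
  by rewrite HS ge_min IH.
rewrite -(cvg_lim _ cvg)//; apply: lime_ge; first by apply/cvg_ex; eexists; exact: cvg.
by apply: nearW => n; have [_ _ _] := hH n; exact.
Qed.

End GradientBound.

(** * Line integrals and families of curves of modulus zero *)

Section Translation.
Context {R : realType}.
Local Notation leb := (@lebesgue_measure R).
Local Open Scope ereal_scope.

Definition translation (s : R) (x : measurableTypeR R)  : measurableTypeR R := (s + x)%R.

Lemma measurable_translation s : measurable_fun setT (translation s).
Proof. exact: (@measurable_funD _ _ R setT (cst s) id). Qed.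

HB.instance Definition _ s :=
  isMeasurableFun.Build _ _ _ _ (translation s) (measurable_translation s).

Lemma translation_preimage s b1 b2 (a b : R) :
  translation s @^-1` [set` Interval (BSide b1 a) (BSide b2 b)] =
  [set` Interval (BSide b1 (a - s)%R) (BSide b2 (b - s)%R)].
Proof.
by apply/seteqP; split => x /=; rewrite /translation !in_itv; case: b1; case: b2;
  move=> /= /andP[? ?]; apply/andP; split; lra.
Qed.

Lemma lebesgue_measure_translation (s : R) (A : set R) : measurable A ->
  pushforward leb (translation s) A = leb A.
Proof.
move=> mA; apply/esym/lebesgue_measure_unique => //= _ [[a b]] _ <-.
rewrite /pushforward translation_preimage !lebesgue_measure_itv/=.
rewrite !lte_fin ltrD2r -!EFinD.
by case: ifP => // _; congr EFin; lra.
Qed.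

(** A subarc is parametrized from 0, the corresponding piece of the larger curve from [s];
    translation invariance identifies the two integrals. *)
Lemma ge0_integral_translation (s t : R) (G : R -> \bar R) :
  measurable_fun [set: R] G -> (forall x, 0 <= G x) ->
  \int[leb]_(x in `[0%R, (t - s)%R]) G (s + x)%R = \int[leb]_(x in `[s, t]) G x.
Proof.
move=> mG G0.
transitivity (\int[pushforward leb (translation s)]_(x in `[s, t]) G x); last first.
  apply: eq_measure_integral => A mA _; exact: lebesgue_measure_translation.
rewrite ge0_integral_pushforward//; last first.
  exact: measurable_funS mG.
by rewrite translation_preimage subrr.
Qed.

End Translation.

Section LineIntegral.
Context {R : realType} {X : pmetricType R}.
Local Notation leb := (@lebesgue_measure R).
Local Open Scope ereal_scope.
Implicit Types (c : @curve R X) (g : X -> \bar R).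

Lemma measurable_arc_path g c : borel_fun g -> rectifiable c ->
  measurable_fun [set: R] (fun s => g (arc_path c s)).
Proof.
move=> mg rc; pose p : R -> g_sigma_algebraType (@open X) := arc_path c.
have mp : measurable_fun [set: R] p.
  apply: (@measurability _ _ _ (g_sigma_algebraType (@open X)) setT p (@open X)) => //.
  move=> _ [B oB <-]; rewrite setTI.
  apply: open_measurable; have /continuousP := arc_path_continuous rc; exact.
exact: (measurableT_comp mg mp).
Qed.

Lemma line_integralE g c : rectifiable c ->
  line_integral g c = \int[leb]_(s in `[0%R, len c]) g (arc_path c s).
Proof.
by move=> rc; apply: eq_integral => s; rewrite inE/= in_itv/= => sl; rewrite arc_pathE.
Qed.

Lemma le_line_integral g h c : rectifiable c -> borel_fun g -> borel_fun h ->
  (forall x, 0 <= g x) -> (forall x, g x <= h x) ->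
  line_integral g c <= line_integral h c.
Proof.
move=> rc mg mh g0 gh; rewrite !line_integralE//; apply: ge0_le_integral => //.
- by apply: measurable_funS (measurable_arc_path mg rc).
- by apply: measurable_funS (measurable_arc_path mh rc).
Qed.

Lemma line_integralZ (k : R) g c : rectifiable c -> borel_fun g ->
  (forall x, 0 <= g x) -> (0 <= k)%R ->
  line_integral (fun x => k%:E * g x) c = k%:E * line_integral g c.
Proof.
move=> rc mg g0 k0; rewrite !line_integralE// ge0_integralZl//.
by apply: measurable_funS (measurable_arc_path mg rc).
Qed.

Definition subarc c' c (s t : R) := [/\ rectifiable c', clength c' = (t - s)%:E &
  forall x, (0 <= x <= t - s)%R -> arc_param c' x = arc_param c (s + x)].

Lemma line_integral_subarc g c c' (s t : R) : rectifiable c -> subarc c' c s t ->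
  (0 <= s)%R -> (s <= t)%R -> (t <= len c)%R -> borel_fun g -> (forall x, 0 <= g x) ->
  line_integral g c' = \int[leb]_(x in `[s, t]) g (arc_path c x).
Proof.
move=> rc [rc' lc' E] s0 st tl mg g0.
rewrite -[RHS](@ge0_integral_translation _ s t (fun x => g (arc_path c x)))//; last first.
  exact: measurable_arc_path.
rewrite /line_integral lc' /=; apply: eq_integral => x; rewrite inE/= in_itv/= => xts.
by rewrite E// arc_pathE//; lra.
Qed.

Lemma le_line_integral_subarc g c c' (s t : R) : rectifiable c -> subarc c' c s t ->
  (0 <= s)%R -> (s <= t)%R -> (t <= len c)%R -> borel_fun g -> (forall x, 0 <= g x) ->
  line_integral g c' <= line_integral g c.
Proof.
move=> rc sc s0 st tl mg g0; rewrite (line_integral_subarc rc sc)// line_integralE//.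
apply: ge0_subset_integral => //.
  by apply: measurable_funS (measurable_arc_path mg rc).
by move=> x /=; rewrite !in_itv/= => /andP[sx xt]; apply/andP; split; lra.
Qed.

End LineIntegral.

Section NullFamily.
Context {R : realType} {X : pmetricType R}.
Variable mu : {outer_measure set X -> \bar R}.
Hypothesis mu_borel : forall A, borel_set A -> mu.-caratheodory A.
Local Notation cmu := (cmeasure mu).
Local Open Scope ereal_scope.
Implicit Types (c : @curve R X) (g h : X -> \bar R) (F : set (@curve R X)).

Lemma borel_cmeasurable g : borel_fun g ->
  measurable_fun [set: caratheodory_type mu] g.
Proof.
move=> mg _ Y mY; rewrite setTI; apply: mu_borel.
by have := mg measurableT Y mY; rewrite setTI.
Qed.

Definition null_family F := modulus1 mu F = 0.

Definition admissible F (rho : X -> \bar R) :=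
  [/\ borel_fun rho, forall x, 0 <= rho x &
      forall c, F c -> rectifiable c -> 1 <= line_integral rho c].

Lemma null_familyP F : null_family F <->
  forall e : R, (0 < e)%R -> exists2 rho, admissible F rho & \int[cmu]_x rho x <= e%:E.
Proof.
split=> [F0 e e0|H].
  have : modulus1 mu F < e%:E by rewrite F0 lte_fin.
  by move=> /ereal_inf_lt[_ [rho [? ? ?] <-]] /ltW; exists rho.
apply/eqP; rewrite eq_le; apply/andP; split.
  apply/lee_addgt0Pr => e e0; rewrite add0e; have [rho rhoP le] := H e e0.
  by apply: le_trans le; apply: ereal_inf_lbound; exists rho.
by apply: le_ereal_inf_tmp => _ [rho [_ r0 _] <-]; exact: integral_ge0.
Qed.

(** With a density of integral at most [e / 2 ^ n.+1] for each [F n], the sum of the densities is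
    admissible for the union, since it dominates each of them. *)
Lemma null_family_bigcup (F : (set (@curve R X))^nat) :
  (forall n, null_family (F n)) -> null_family (\bigcup_n F n).
Proof.
move=> F0; apply/null_familyP => e e0.
have e2 n : (0 < e / (2 ^ n.+1)%:R)%R by rewrite divr_gt0// ltr0n expn_gt0.
have /choice[rho rhoP] n : exists rho, admissible (F n) rho /\
    \int[cmu]_x rho x <= (e / (2 ^ n.+1)%:R)%:E.
  by have /null_familyP/(_ _ (e2 n))[rho ? ?] := F0 n; exists rho.
have rho0 n x : 0 <= rho n x by have [[_ + _] _] := rhoP n; exact.
have mrho n : borel_fun (rho n) by have [[]] := rhoP n.
exists (fun x => \sum_(n <oo) rho n x).
  have mS : borel_fun (fun x => \sum_(n <oo) rho n x).
    apply: (@ge0_emeasurable_sum _ (g_sigma_algebraType (@open X)) R setT rho xpredT).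
      by move=> k x _ _; exact: rho0.
    by move=> k _; exact: mrho.
  split => //; first by move=> x; exact: nneseries_ge0.
  move=> c [n _ Fnc] rc; have [[_ _ /(_ c Fnc rc) H1] _] := rhoP n.
  apply: le_trans H1 _; apply: le_line_integral => // x.
  apply: le_trans (@nneseries_lim_ge _ (rho ^~ x) xpredT 0%N n.+1 (fun k _ _ => rho0 k x)).
  by rewrite big_nat_recr//= leeDr// sume_ge0.
rewrite integral_nneseries//; last by move=> n; exact: borel_cmeasurable.
apply: (@le_trans _ _ (\sum_(n <oo) (e / (2 ^ n.+1)%:R)%:E)).
  apply: lee_nneseries; first by move=> n _ _; apply: integral_ge0 => x _; exact: rho0.
  by move=> n _; have [_] := rhoP n; exact.
have := @epsilon_trick R (fun=> 0) e xpredT (fun=> lexx _) (ltW e0).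
under eq_eseriesr do rewrite add0e.
by rewrite [X in _ <= X + _]eseries0 ?add0e.
Qed.

Lemma null_family_sub F F' : (forall c, rectifiable c -> F c -> F' c) ->
  null_family F' -> null_family F.
Proof.
move=> FF' /null_familyP H; apply/null_familyP => e /H[rho [? ? h] ?].
by exists rho => //; split => // c Fc rc; apply: h => //; exact: FF'.
Qed.

Lemma null_familyU F F' : null_family F -> null_family F' -> null_family (F `|` F').
Proof.
move=> h h'; pose G n := if n is 0%N then F else F'.
apply: (@null_family_sub _ (\bigcup_n G n)); last by apply: null_family_bigcup => -[].
by move=> c _ []; [exists 0%N|exists 1%N].
Qed.

(** The integral of a density over a curve is at least that over a subarc, so a density admissible
    for [F] serves unchanged. *)
Lemma null_family_subarc F : null_family F -> null_family
  [set c | exists c' s t, [/\ (0 <= s)%R, (s <= t)%R, (t <= len c)%R, subarc c' c s t & F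
    c']].
Proof.
move=> /null_familyP H; apply/null_familyP => e /H[rho [mr r0 h] le].
exists rho => //; split => // c [c' [s [t [s0 st tl sc Fc']]]] rc.
apply: le_trans (le_line_integral_subarc rc sc s0 st tl mr r0).
by apply: h => //; case: sc.
Qed.

(** Every positive multiple of [h] is admissible for these curves, and its integral can be made as
    small as desired. *)
Lemma null_family_infinite h : borel_fun h -> (forall x, 0 <= h x) ->
  cmu.-integrable setT h -> null_family [set c | line_integral h c = +oo].
Proof.
move=> mh h0 /integrableP[_ ih0]; apply/null_familyP => e e0.
have ih : \int[cmu]_x h x < +oo.
  apply: le_lt_trans ih0; rewrite le_eqVlt; apply/orP; left; apply/eqP.
  by apply: eq_integral => x _; rewrite gee0_abs.
have I0 : 0 <= \int[cmu]_x h x by exact: integral_ge0.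
have [I IE] : exists I : R, \int[cmu]_x h x = I%:E.
  by exists (fine (\int[cmu]_x h x)); rewrite fineK// ge0_fin_numE.
rewrite IE lee_fin in I0.
(* The [+ 1] keeps the denominator positive when [h] has integral zero. *)
pose k := (e / (I + 1))%R.
have k0 : (0 < k)%R by rewrite divr_gt0//; lra.
exists (fun x => k%:E * h x); last first.
  rewrite ge0_integralZl//; [|exact: borel_cmeasurable|by rewrite lee_fin ltW].
  rewrite IE -EFinM lee_fin /k mulrAC ler_pdivrMr; last lra.
  by rewrite ler_pM2l//; lra.
split.
- by apply: measurable_funeM.
- by move=> x; rewrite mule_ge0// lee_fin ltW.
- move=> c /= cI rc; rewrite line_integralZ//; last exact: ltW.
  rewrite cI.
  have -> : k%:E * +oo = +oo :> \bar R by rewrite gt0_muley ?lte_fin.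
  exact: leey.
Qed.

End NullFamily.

(** * Minimal weak upper gradients *)

Section MinimalGradient.
Context {R : realType} {X : pmetricType R}.
Variable mu : {outer_measure set X -> \bar R}.
Hypothesis mu_borel : forall A, borel_set A -> mu.-caratheodory A.
Local Notation cmu := (cmeasure mu).
Local Open Scope ereal_scope.
Implicit Types (c : @curve R X) (g h : X -> \bar R).

Lemma upper_gradient_along_subarc (u : X -> R) g c c' (s t : R) :
  rectifiable c -> subarc c' c s t -> (0 <= s)%R -> (s <= t)%R -> (t <= len c)%R ->
  borel_fun g -> (forall x, 0 <= g x) -> upper_gradient_along (EFin \o u) g c' ->
  (`|u (arc_path c s) - u (arc_path c t)|%R)%:E <=
    \int[lebesgue_measure]_(x in `[s, t]) g (arc_path c x).
Proof.
move=> rc sc s0 st tl mg g0; have [rc' lc' E] := sc.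
rewrite /upper_gradient_along (line_integral_subarc rc sc)//=.
rewrite -arc_param0// -arc_param_len//.
rewrite /len lc' /= !E; [|lra|lra].
rewrite !arc_pathE ?addr0//; [|lra|lra].
by rewrite addrCA subrr addr0.
Qed.

(** The exceptional family is replaced by the curves with a subarc in it, so that the inequality
    survives on every subinterval, together with the curves along which [g] has infinite
    integral. *)
Lemma weak_upper_gradient_bounds (u : X -> R) g :
  weak_upper_gradient mu (EFin \o u) g -> cmu.-integrable setT g ->
  exists2 F, null_family mu F & forall c, rectifiable c -> ~ F c ->
    bounds_increments (u \o arc_path c) (len c) (g \o arc_path c).
Proof.
move=> [mg g0 [F [F0 H]]] ig.
exists ([set c | exists c' s t,
     [/\ (0 <= s)%R, (s <= t)%R, (t <= len c)%R, subarc c' c s t & F c']] `|`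
     [set c | line_integral g c = +oo]).
  apply: null_familyU => //; first exact: null_family_subarc.
  exact: null_family_infinite.
move=> c rc Fc; split.
- exact: measurable_arc_path.
- by move=> x; exact: g0.
- rewrite ltey; apply/negP => /eqP E; apply: Fc; right.
  by rewrite /= line_integralE.
move=> s t s0 st tl.
(* Constant curves are excluded from the weak upper gradient inequality, so [s = t] is treated
   apart. *)
move: st; rewrite le_eqVlt => /predU1P[<-|st].
  by rewrite subrr normr0; apply: integral_ge0 => x _; exact: g0.
have [c' [rc' lc' E]] := subcurve_exists rc s0 (ltW st) tl.
have sc : subarc c' c s t by [].
apply: (upper_gradient_along_subarc rc sc) => //; first exact: ltW.
apply: H; first by rewrite lc' lte_fin subr_gt0 st ltry.
by move=> Fc'; apply: Fc; left; exists c', s, t; split => //; exact: ltW.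
Qed.

Lemma bounds_weak_upper_gradient (u : X -> R) g F : borel_fun g ->
  (forall x, 0 <= g x) -> null_family mu F ->
  (forall c, rectifiable c -> ~ F c ->
    bounds_increments (u \o arc_path c) (len c) (g \o arc_path c)) ->
  weak_upper_gradient mu (EFin \o u) g.
Proof.
move=> mg g0 F0 H; split => //; exists F; split => // c /andP[c0 rc] Fc.
have [_ _ _ /(_ 0%R (len c) (lexx _) (len_ge0 c) (lexx _))] := H c rc Fc.
rewrite /upper_gradient_along line_integralE//=.
by rewrite !arc_pathE ?lexx ?len_ge0// arc_param0// arc_param_len.
Qed.

Definition integrable_gradient (u : X -> R) : set (X -> \bar R) :=
  [set g | weak_upper_gradient mu (EFin \o u) g /\ cmu.-integrable setT g].

Lemma integrable_gradient_einfs (u : X -> R) (g : (X -> \bar R)^nat) :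
  (forall n, integrable_gradient u (g n)) ->
  integrable_gradient u (fun x => einfs (g ^~ x) 0%N).
Proof.
move=> hg.
have mg n : borel_fun (g n) by have [[]] := hg n.
have g0 n x : 0 <= g n x by have [[_ + _] _] := hg n; exact.
have m : borel_fun (fun x => einfs (g ^~ x) 0%N).
  exact: (@measurable_fun_einfs _ (g_sigma_algebraType (@open X)) R setT g mg).
have p x : 0 <= einfs (g ^~ x) 0%N by apply: le_ereal_inf_tmp => _ [n _ <-].
split; last first.
  have [_ ig0] := hg 0%N; apply: le_integrable ig0 => //.
    exact: borel_cmeasurable.
  move=> x _; rewrite !gee0_abs//; apply: ereal_inf_lbound; by exists 0%N.
have /choice[F HF] n : exists F, null_family mu F /\ forall c, rectifiable c -> ~ F c ->
    bounds_increments (u \o arc_path c) (len c) (g n \o arc_path c).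
  have [h1 h2] := hg n.
  by have [F F0 HF] := weak_upper_gradient_bounds h1 h2; exists F.
apply: (@bounds_weak_upper_gradient u _ (\bigcup_n F n)) => //.
  by apply: null_family_bigcup => // n; have [] := HF n.
move=> c rc Fc; apply: (@bounds_increments_einfs _ _ _ (fun n => g n \o arc_path c)) => n.
by have [_] := HF n; apply => // Fnc; apply: Fc; exists n.
Qed.

(** The infimum [G] of a minimizing sequence has the least integral. Its minimum with a competitor
    is again a competitor, below [G] and of no smaller integral, hence equal to [G] almost
    everywhere. *)
Lemma minimal_weak_upper_gradient_exists (u : X -> R) h : integrable_gradient u h ->
  exists g, minimal_weak_upper_gradient mu (EFin \o u) g.
Proof.
move=> hh; pose V := [set \int[cmu]_x g x | g in integrable_gradient u].
have [|v vI cv] := @ereal_inf_seq _ V; first by apply/set0P; exists (\int[cmu]_x h x);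
  exists h.
have /choice[g Hg] n : exists g, integrable_gradient u g /\ \int[cmu]_x g x = v n.
  by have [g gu gv] := vI n; exists g.
have hg n : integrable_gradient u (g n) by have [] := Hg n.
pose G x := einfs (g ^~ x) 0%N.
have [wG iG] : integrable_gradient u G by exact: integrable_gradient_einfs.
have ge0 k x : integrable_gradient u k -> 0 <= k x by move=> [[_ + _] _]; exact.
have meas k : integrable_gradient u k -> measurable_fun [set: caratheodory_type mu] k.
  by move=> [_ /integrableP[]].
have Gle : \int[cmu]_x G x <= ereal_inf V.
  rewrite -(cvg_lim _ cv)//; apply: lime_ge; first by apply/cvg_ex; eexists; exact: cv.
  apply: nearW => n; have [_ <-] := Hg n; apply: ge0_le_integral => //.
  - by move=> x _; exact: ge0.
  - exact: meas.
  - exact: meas.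
  - by move=> x _; apply: ereal_inf_lbound; exists n.
exists G; split => // k wk ik; have hk : integrable_gradient u k by [].
(* The minimum of [G] and [k], written as the infimum of a sequence so that
   [integrable_gradient_einfs] applies. *)
pose kk n := if n is 0%N then G else k.
pose K x := einfs (kk ^~ x) 0%N.
have [wK iK] : integrable_gradient u K by apply: integrable_gradient_einfs => -[].
have KG x : K x <= G x by apply: ereal_inf_lbound; exists 0%N.
have Kk x : K x <= k x by apply: ereal_inf_lbound; exists 1%N.
have GK : \int[cmu]_x G x = \int[cmu]_x K x.
  apply/eqP; rewrite eq_le; apply/andP; split.
    by apply: (le_trans Gle); apply: ereal_inf_lbound; exists K.
  apply: ge0_le_integral => //.
  - by move=> x _; exact: ge0.
  - exact: meas.
  - exact: meas.
have fG := integrable_ae measurableT iG.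
have fK := integrable_ae measurableT iK.
have iGK : cmu.-integrable setT (G \- K) by exact: integrableB.
have : ae_eq cmu setT (G \- K) (cst 0).
  apply/ae_eq_integral_abs => //; first by have /integrableP[] := iGK.
  rewrite (@ae_eq_integral _ _ _ cmu _ (G \- K))//.
  - rewrite integralB// GK subee//.
    exact: integrable_fin_num.
  - by apply: measurableT_comp => //; have /integrableP[] := iGK.
  - by have /integrableP[] := iGK.
  - apply: filterS2 fG fK => x /(_ I) Gx /(_ I) Kx _ /=.
    by rewrite gee0_abs// sube_ge0// Gx orbT.
move=> fE; apply: filterS3 fG fK fE => x /(_ I) Gx /(_ I) Kx /(_ I) /= E.
by apply: le_trans (Kk x); rewrite -sube_le0 E.
Qed.

End MinimalGradient.

From mathcomp Require Import finmap.

(** * Sums over uniformly locally finite sets *)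

Section Counting.
Context {R : realType}.
Local Open Scope ereal_scope.

(** Duplicate-free lists are the finite subfamilies in bounds for [esum]; this turns cardinality
    bounds into bounds on their lengths. *)
Lemma card_le_seqP (T : choiceType) (A : set T) (n : nat) :
  (A #<= `I_n)%card <->
  forall s : seq T, uniq s -> (forall x, x \in s -> A x) -> (size s <= n)%N.
Proof.
split=> [An s us sA|H].
  have fA : finite_set A by apply/finite_set_leP; exists n.
  apply: leq_trans (geq_card_fset_set An); apply: uniq_leq_size => // x xs.
  by rewrite in_fset_set// mem_set//; exact: sA.
have fA : finite_set A.
  apply: contrapT => /(infinite_set_fset n.+1)[B BA nB].
  have : (size (enum_fset B) <= n)%N by apply: H => [|x xB]; [exact: fset_uniq|exact: BA].
  by rewrite leqNgt nB.
move: (fA) => [m Am]; have := card_fset_set Am => sm.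
apply: (@card_le_trans _ _ _ `I_m); first by rewrite card_eq_le in Am; case/andP: Am.
rewrite card_le_II -sm; apply: H; first exact: fset_uniq.
by move=> x; rewrite in_fset_set// => /set_mem.
Qed.

Lemma sum_seq_le (T : eqType) (s : seq T) (a : T -> \bar R) (M : \bar R) :
  0 <= M -> (forall i, i \in s -> a i <= M) ->
  \sum_(i <- s) a i <= (size s)%:R%:E * M.
Proof.
move=> M0; elim: s => [|x s IH] H; first by rewrite big_nil mul0e.
rewrite big_cons /= -natr1 EFinD ge0_muleDl ?lee_fin// mul1e addeC leeD//.
  by apply: IH => i si; apply: H; rewrite inE si orbT.
by apply: H; rewrite mem_head.
Qed.

Lemma esum_le_fsets (T : choiceType) (A : set T) (a : T -> \bar R) (M : \bar R) :
  (forall s : seq T, uniq s -> (forall x, x \in s -> A x) -> \sum_(i <- s) a i <= M) ->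
  \esum_(i in A) a i <= M.
Proof.
move=> H; apply: ub_ereal_sup => _ [F [fF FA] <-].
rewrite fsbig_finite//; apply: H; first exact: fset_uniq.
by move=> x; rewrite in_fset_set// => /set_mem /FA.
Qed.

Lemma esum_ge_seq (T : choiceType) (A : set T) (a : T -> \bar R) (s : seq T) :
  uniq s -> (forall x, x \in s -> A x) -> \sum_(i <- s) a i <= \esum_(i in A) a i.
Proof.
move=> us sA; apply: ereal_sup_ubound; exists [set` s]; first by split => //;
  exact: finite_seq.
by rewrite -fsbig_seq.
Qed.

Lemma esum_card_le (T : choiceType) (A : set T) (a : T -> \bar R) (M : \bar R) n :
  (A #<= `I_n)%card -> 0 <= M -> (forall i, A i -> a i <= M) ->
  \esum_(i in A) a i <= n%:R%:E * M.
Proof.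
move=> /card_le_seqP An M0 aM; apply: esum_le_fsets => s us sA.
apply: (@le_trans _ _ ((size s)%:R%:E * M)).
  by apply: sum_seq_le => // i /sA; exact: aM.
by apply: lee_wpmul2r => //; rewrite lee_fin ler_nat; exact: An.
Qed.

Lemma esumZl (T : choiceType) (A : set T) (a : T -> \bar R) (k : R) :
  (0 <= k)%R -> (forall i, A i -> 0 <= a i) ->
  \esum_(i in A) (k%:E * a i) = k%:E * \esum_(i in A) a i.
Proof.
have le (r : R) (b : T -> \bar R) : (0 <= r)%R -> (forall i, A i -> 0 <= b i) ->
    \esum_(i in A) (r%:E * b i) <= r%:E * \esum_(i in A) b i.
  move=> r0 b0; apply: esum_le_fsets => s us sA.
  rewrite big_seq -ge0_sume_distrr; last by move=> i /sA /b0.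
  by rewrite -big_seq; apply: lee_wpmul2l; [rewrite lee_fin|exact: esum_ge_seq].
move=> k0 a0; apply/eqP; rewrite eq_le le//=.
have [->|kn0] := eqVneq k 0%R.
  by rewrite mul0e; apply: esum_ge0 => i _; rewrite mul0e.
have {kn0}k0 : (0 < k)%R by rewrite lt_neqAle eq_sym kn0.
have ka0 i : A i -> 0 <= k%:E * a i by move=> /a0 ai; rewrite mule_ge0// lee_fin ltW.
have := le k^-1%R (fun i => k%:E * a i).
rewrite invr_ge0 (ltW k0) => /(_ isT ka0).
rewrite (eq_esum (b := a)); last first.
  by move=> i _; rewrite muleA -EFinM mulVf ?mul1e// gt_eqF.
move=> h; apply: le_trans (lee_wpmul2l _ h) _; first by rewrite lee_fin ltW.
by rewrite muleA -EFinM mulfV ?mul1e// gt_eqF.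
Qed.

Lemma esum_subset (T : choiceType) (A B : set T) (a : T -> \bar R) :
  A `<=` B -> \esum_(i in A) a i <= \esum_(i in B) a i.
Proof.
move=> AB; apply: esum_le_fsets => s us sA; apply: esum_ge_seq => // x /sA; exact: AB.
Qed.

Lemma exchange_esum (T U : choiceType) (P : T -> U -> Prop) (a : T -> U -> \bar R) :
  (forall i j, P i j -> 0 <= a i j) ->
  \esum_(i in [set: T]) \esum_(j in [set j | P i j]) a i j =
  \esum_(j in [set: U]) \esum_(i in [set i | P i j]) a i j.
Proof.
move=> a0; rewrite esum_esum; last by move=> i j _; exact: a0.
rewrite esum_esum; last by move=> i j _; exact: a0.
apply: (reindex_esum _ _ (fun x => (x.2, x.1))); split => /=.
- by move=> [i j] [] /=.
- by move=> [i j] [k l] _ _ [-> ->].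
- by move=> [i j] /= [_ Pij]; exists (j, i).
Qed.

(** After exchanging the sums, [a j] is counted once for every [i] with [P i j]. *)
Lemma esum_neighbours_le (T U : choiceType) (P : T -> U -> Prop) (a : U -> \bar R) n :
  (forall j, ([set i | P i j] #<= `I_n)%card) -> (forall j, 0 <= a j) ->
  \esum_(i in [set: T]) \esum_(j in [set j | P i j]) a j <=
    n%:R%:E * \esum_(j in [set: U]) a j.
Proof.
move=> Pn a0; rewrite exchange_esum// -esumZl//.
by apply: le_esum => j _; exact: esum_card_le.
Qed.

End Counting.

(** * Control functions and counting points of a net *)

Section ControlFunction.
Context {R : realType} (rho : R -> R).
Hypothesis hrho : control_function rho.

Lemma control_ge1 t : 0 <= t -> 1 <= rho t.
Proof. by move: hrho => [_ mono <- _] t0; apply: mono. Qed.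

(** Moving a point or the base point by a bounded distance changes the weight by a bounded factor.
    The control inequality needs positive arguments: [a + 1] allows [a = 0], and [rho a] covers
    [t = 0], where [rho 0 = 1]. Clamping [s] at zero keeps it where [rho] is monotone. *)
Lemma control_shift (a : R) : 0 <= a -> exists2 L, 0 < L &
  forall t s, 0 <= t -> s <= t + a -> rho (Num.max 0 s) <= L * rho t.
Proof.
move=> a0; have [pos mono rho0 [L [M [LM H]]]] := hrho.
have a1 : 0 < a + 1 by lra.
exists (Num.max (L (a + 1)) (rho a)); first by rewrite lt_max (LM _ a1).1.
move=> t s t0 st; have rt := control_ge1 t0.
have hs : rho (Num.max 0 s) <= rho (t + a).
  by apply: mono; [rewrite le_max lexx|rewrite ge_max st; lra].
apply: (le_trans hs); move: t0; rewrite le_eqVlt => /predU1P[<-|t0].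
  by rewrite rho0 add0r mulr1 le_max lexx orbT.
apply: (@le_trans _ _ (L (a + 1) * rho t)); last first.
  by rewrite ler_wpM2r ?le_max ?lexx//; lra.
by apply: le_trans (H t (a + 1) t0 a1).1; apply: mono; lra.
Qed.

End ControlFunction.

Section NetCounting.
Context {R : realType} {X : pmetricType R}.
Variable mu : {outer_measure set X -> \bar R}.
Hypothesis mu_borel : forall A, borel_set A -> mu.-caratheodory A.

Lemma ball_open (x : X) (r : R) : open (ball x r).
Proof.
rewrite openE => y; rewrite ballEmdist/= => xy; apply/nbhs_ballP.
exists (r - mdist x y) => /=; first by rewrite subr_gt0.
move=> z; rewrite !ballEmdist/= => yz.
by have := metric_triangle x y z; lra.
Qed.

Lemma borel_ball (x : X) (r : R) : borel_set (ball x r).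
Proof. by apply: sub_sigma_algebra; exact: ball_open. Qed.

Lemma measurable_ball (x : X) (r : R) :
  measurable (ball x r : set (caratheodory_type mu)).
Proof. by apply: mu_borel; exact: borel_ball. Qed.

Lemma le_mu (A B : set X) : A `<=` B -> (mu A <= mu B)%E.
Proof. exact: le_outer_measure. Qed.

(** Packing: the balls of radius [eps / 2] about net points are disjoint and of measure at least
    [f (eps / 2)], and those centred in [ball x r] lie in [ball x (r + eps / 2)]. *)
Lemma net_uniformly_locally_finite (hunif : uniform_space mu) (N : set X) (eps : R) :
  0 < eps -> maximal_net N eps ->
  exists n : R -> nat, forall (x : X) (r : R), 0 < r -> (N `&` ball x r #<= `I_(n r))%card.
Proof.
move=> e0 [_ sep]; have [f [g [fg0 fgmono fgmu]]] := hunif.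
have e20 : 0 < eps / 2 by lra.
exists (fun r => Num.truncn (g (r + eps / 2) / f (eps / 2))) => x r r0.
apply/card_le_seqP => s us sN.
have re0 : 0 < r + eps / 2 by lra.
have [f0 _] := fg0 _ e20.
have dis (p q : X) : N p -> N q -> p <> q -> ball p (eps / 2) `&` ball q (eps / 2) = set0.
  move=> Np Nq pq; apply/seteqP; split => // z []; rewrite !ballEmdist/= => pz qz.
  by have := sep p q Np Nq pq; have := metric_triangle p z q; rewrite (metric_sym z); lra.
have tri : trivIset [set` [fset p in s]%fset] (fun p : X => ball p (eps / 2)).
  apply/trivIsetP => p q /=; rewrite !inE => /sN[Np _] /sN[Nq _] /eqP pq; exact: dis.
have U := @measure_fbigsetU _ _ _ (cmeasure mu) _ [fset p in s]%fset
   (fun p : X => ball p (eps / 2)) (fun p _ => measurable_ball p (eps / 2)) tri.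
have le1 : (\sum_(p <- s) mu (ball p (eps / 2)) <= (g (r + eps / 2))%:E)%E.
  apply: (@le_trans _ _ (mu (ball x (r + eps / 2)))); last first.
    by have /andP[] := fgmu x _ re0.
  rewrite [leLHS](perm_big (enum_fset [fset p in s]%fset)) /=; last first.
    by apply: uniq_perm => // p; rewrite inE.
  rewrite -[leLHS]U; apply: le_mu; rewrite -bigcup_fset => z [p /=]; rewrite inE => /sN[_].
  rewrite !ballEmdist/= => xp pz; have := metric_triangle x p z; lra.
have le2 : (((size s)%:R * f (eps / 2))%:E <= (g (r + eps / 2))%:E)%E.
  apply: le_trans le1.
  have -> : (size s)%:R * f (eps / 2) = \sum_(p <- s) f (eps / 2).
    by rewrite big_const_seq count_predT iter_addr addr0 mulr_natl.
  rewrite -sumEFin; by apply: lee_sum => p _; have /andP[] := fgmu p _ e20.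
rewrite lee_fin -ler_pdivlMr// in le2.
by rewrite truncn_ge_nat// (le_trans _ le2).
Qed.

End NetCounting.

(** * Hahn-Banach *)

Section HahnBanach.
Context {R : realType} (V : lmodType R) (D : set V) (p : V -> R).
Hypothesis D_lin : forall (a : R) x y, D x -> D y -> D (a *: x + y).
Hypothesis pD : forall x y, D x -> D y -> p (x + y) <= p x + p y.
Hypothesis pZ : forall (a : R) x, 0 <= a -> D x -> p (a *: x) = a * p x.

(* Partially defined linear functionals are handled as their graphs in V * R. *)
Let lin (A : set (V * R)) := forall (a : R) z w, A z -> A w ->
  A (a *: z.1 + w.1, a * z.2 + w.2).

Let dominated (A : set (V * R)) := forall z, A z -> D z.1 /\ z.2 <= p z.1.

Let lin0 A : lin A -> A !=set0 -> A (0, 0).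
Proof.
move=> lA [z Az]; have := lA (-1) z z Az Az.
by rewrite scaleN1r addNr mulN1r addNr.
Qed.

Let linZ A a z : lin A -> A z -> A (a *: z.1, a * z.2).
Proof.
move=> lA Az; have := lA a z (0, 0) Az (lin0 lA (ex_intro _ z Az)).
by rewrite /= !addr0.
Qed.

(** Two values over [v] differ by a value over 0, which is at most [p 0 = 0]; so linear dominated
    graphs are graphs of functions. *)
Let lin_inj A v r s : lin A -> dominated A -> A (v, r) -> A (v, s) -> r = s.
Proof.
move=> lA dA.
have H x y : A (v, x) -> A (v, y) -> x <= y.
  move=> Ax Ay; have A0 : A (0, 0) by apply: lin0 => //; exists (v, x).
  have [D0 _] := dA _ A0.
  have := lA (-1) _ _ Ay Ax; rewrite /= scaleN1r addNr mulN1r => /dA[_ /=].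
  have := @pZ 0 0 (lexx _) D0; rewrite scale0r mul0r => ->; lra.
by move=> Ar As; apply/eqP; rewrite eq_le !H.
Qed.

(** Everything is relative to a subspace [D], because the seminorm of the application is meaningful
    only for finitely supported functions. That the initial graph [G] is single-valued need not be
    assumed: domination implies it. *)
Lemma hahn_banach (G : set (V * R)) : G !=set0 -> lin G -> dominated G ->
  exists psi : V -> R, [/\ forall v r, G (v, r) -> psi v = r,
    forall x, D x -> psi x <= p x &
    forall (a : R) x y, D x -> D y -> psi (a *: x + y) = a * psi x + psi y].
Proof.
move=> G0 lG dG.
pose P A := [/\ lin A, dominated A & A = set0 \/ G `<=` A].
have [A [[lA dA AG] Amax]] : exists A, P A /\ forall B, A `<` B -> ~ P B.
  apply: Zorn_bigcup => F FP tot; split.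
  - move=> a z w [A FA Az] [B FB Bw].
    have [AB|BA] := tot _ _ FA FB.
      by exists B => //; have [lB _ _] := FP _ FB; apply: lB => //; exact: AB.
    by exists A => //; have [lA _ _] := FP _ FA; apply: lA => //; exact: BA.
  - by move=> z [A FA Az]; have [_ dA _] := FP _ FA; exact: dA.
  - have [[z [A FA Az]]|H] := pselect ((\bigcup_(A in F) A) !=set0).
      right => w Gw; exists A => //.
      by have [_ _ [A0|]] := FP _ FA; [rewrite A0 in Az|exact].
    by left; apply/eqP/negP => /negP/set0P.
have {AG}GA : G `<=` A.
  case: AG => // A0; exfalso; apply: (Amax G); last by split => //; right.
  rewrite A0; split; first by [].
  by case: G0 => z Gz /(_ z Gz).
have A0 : A (0, 0) by apply: lin0 => //; case: G0 => z /GA Az; exists z.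
have total v0 : D v0 -> exists r, A (v0, r).
  move=> Dv0; apply: contrapT => nA.
  (* A value at [v0] must lie above all numbers on the left and below all those on the right.
     Subadditivity of [p] makes the two families compatible, and the supremum of the left one is
     taken. *)
  have key z w : A z -> A w -> z.2 - p (z.1 - v0) <= p (w.1 + v0) - w.2.
    move=> Az Aw; have [Dz _] := dA _ Az; have [Dw _] := dA _ Aw.
    have := lA 1 _ _ Az Aw; rewrite scale1r mul1r => /dA[_ /=].
    have -> : z.1 + w.1 = (z.1 - v0) + (w.1 + v0) by rewrite addrACA addNr addr0.
    have D1 : D (z.1 - v0) by rewrite addrC -scaleN1r; exact: D_lin.
    have D2 : D (w.1 + v0) by rewrite addrC -[v0]scale1r; exact: D_lin.
    have := pD D1 D2; lra.
  pose S := [set z.2 - p (z.1 - v0) | z in A].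
  pose a := sup S.
  have S0 : S !=set0 by exists (0 - p (0 - v0)); exists (0, 0).
  have ubS w : A w -> ubound S (p (w.1 + v0) - w.2).
    by move=> Aw _ [z Az <-]; exact: key.
  have a_ge z : A z -> z.2 - p (z.1 - v0) <= a.
    move=> Az; apply: ub_le_sup; last by exists z.
    by exists (p (0 + v0) - 0); exact: (ubS (0, 0)).
  have a_le w : A w -> a <= p (w.1 + v0) - w.2 by move=> /ubS; exact: ge_sup.
  pose B := [set u : V * R | exists z t, A z /\ u = (z.1 + t *: v0, z.2 + t * a)].
  apply: (Amax B); last first.
    split; last by right => z /GA Az; exists z, 0; split => //;
      rewrite scale0r mul0r !addr0; case: (z).
    - move=> k _ _ [z [t [Az ->]]] [w [s [Aw ->]]] /=.
      exists (k *: z.1 + w.1, k * z.2 + w.2), (k * t + s); split; first exact: lA.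
      congr pair => /=; last by lra.
      by rewrite scalerDr scalerDl scalerA addrACA.
    - move=> _ [z [t [Az ->]]] /=; have [Dz zp] := dA _ Az; split.
        by rewrite addrC; exact: D_lin.
      (* Dividing by the absolute value of [t] reduces to the coefficients 1 and -1, where [a_le]
         and [a_ge] apply. *)
      have [t0|t0|->] := ltrgtP t 0; last by rewrite scale0r mul0r !addr0.
      + have h := a_ge _ (linZ (- t)^-1 lA Az).
        have Dv : D ((- t)^-1 *: z.1 - v0).
          rewrite addrC -scaleN1r; apply: D_lin => //.
          by have [] := dA _ (linZ (- t)^-1 lA Az).
        have E : z.1 + t *: v0 = (- t) *: ((- t)^-1 *: z.1 - v0).
          by rewrite scalerBr scalerA mulfV ?scale1r ?scaleNr ?opprK// oppr_eq0 lt_eqF.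
        rewrite E pZ//; last lra.
        have : (- t) * ((- t)^-1 * z.2 - p ((- t)^-1 *: z.1 - v0)) <= (- t) * a.
          by apply: ler_wpM2l => //; lra.
        by rewrite mulrBr mulrA mulfV ?mul1r ?oppr_eq0 ?lt_eqF//; lra.
      + have h := a_le _ (linZ t^-1 lA Az).
        have Dv : D (t^-1 *: z.1 + v0).
          rewrite addrC -[v0]scale1r; apply: D_lin => //.
          by have [] := dA _ (linZ t^-1 lA Az).
        have E : z.1 + t *: v0 = t *: (t^-1 *: z.1 + v0).
          by rewrite scalerDr scalerA mulfV ?scale1r// gt_eqF.
        rewrite E pZ//; last exact: ltW.
        have : t * a <= t * (p (t^-1 *: z.1 + v0) - t^-1 * z.2).
          by apply: ler_wpM2l => //; exact: ltW.
        by rewrite mulrBr mulrA mulfV ?mul1r ?gt_eqF//; lra.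
  split.
    by move=> z Az; exists z, 0; split => //; rewrite scale0r mul0r !addr0; case: (z).
  move=> BA; apply: nA; exists a; apply: BA; exists (0, 0), 1; split => //=.
  by rewrite scale1r mul1r !add0r.
pose psi v := xget 0 [set r | A (v, r)].
have psiP v : D v -> A (v, psi v).
  by move=> /total[r Ar]; exact: (xgetI 0 (P := [set r | A (v, r)]) Ar).
exists psi; split.
- move=> v r /GA Avr; apply: (lin_inj lA dA _ Avr); apply: psiP.
  by have [] := dA _ Avr.
- by move=> x /psiP /dA[].
- move=> a x y Dx Dy; apply: (lin_inj lA dA (psiP _ (D_lin a Dx Dy))).
  exact: (lA a _ _ (psiP _ Dx) (psiP _ Dy)).
Qed.

End HahnBanach.

(** * Coarse homology in degrees 0 and 1 *)

Section Pairs.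
Context {R : realType} {X : pmetricType R} {G : set X}.
Implicit Types (x y : G) (t : 2.-tuple G).

Definition fst_vertex t : G := tnth t ord0.
Definition snd_vertex t : G := tnth t ord_max.
Definition edge (e : G * G) : 2.-tuple G := [tuple e.1; e.2].

Lemma edge_eta t : edge (fst_vertex t, snd_vertex t) = t.
Proof.
apply: eq_from_tnth => i; rewrite /edge /fst_vertex /snd_vertex.
case: i => -[|[|//]] Hi; rewrite (tnth_nth (tnth t ord0))/=.
  by congr tnth; exact: val_inj.
by congr tnth; exact: val_inj.
Qed.

Lemma fst_edge e : fst_vertex (edge e) = e.1.
Proof. by rewrite /fst_vertex (tnth_nth e.1). Qed.

Lemma snd_edge e : snd_vertex (edge e) = e.2.
Proof. by rewrite /snd_vertex (tnth_nth e.1). Qed.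

Lemma edge_bij : bijective edge.
Proof.
exists (fun t => (fst_vertex t, snd_vertex t)); last exact: edge_eta.
by move=> [a b]; rewrite fst_edge snd_edge.
Qed.

Lemma simplex_boundary_edge (e : G * G) (y : 1.-tuple G) :
  simplex_boundary (R := R) (edge e) y =
  (e.2 == thead y)%:R - (e.1 == thead y)%:R.
Proof.
rewrite /simplex_boundary !big_ord_recl big_ord0 addr0 expr0 mul1r expr1 mulN1r.
have E i : (face i (edge e) == y) = (tnth (edge e) (lift i ord0) == thead y).
  apply/eqP/eqP => [<-|H]; first by rewrite /thead tnth_mktuple.
  by apply: eq_from_tnth => j; rewrite tnth_mktuple !ord1.
by rewrite !E; congr (_%:R - _%:R); rewrite (tnth_nth e.1).
Qed.

Lemma tuple_dist_edge (e : G * G) (b : G) :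
  tuple_dist (R := R) (edge e) [tuple b | _ < 2] =
  Num.max (mdist (val e.1) (val b)) (mdist (val e.2) (val b)).
Proof.
rewrite /tuple_dist !big_ord_recl big_ord0 !tnth_mktuple.
rewrite !(tnth_nth e.1)/= [Num.max (mdist (val e.2) _) 0]max_l//.
exact: mdist_ge0.
Qed.

Lemma tuple_spread_edge (e : G * G) :
  tuple_spread (R := R) (edge e) = mdist (val e.1) (val e.2).
Proof.
apply/eqP; rewrite eq_le; apply/andP; split.
  apply: bigmax_le; first exact: mdist_ge0.
  move=> i _; apply: bigmax_le; first exact: mdist_ge0.
  case: i => -[|[|//]] Hi [[|[|//]] Hj] //= _; rewrite !(tnth_nth e.1)//=.
  by rewrite metric_sym.
apply: le_trans (le_bigmax _ _ (ord0 : 'I_2)).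
apply: le_trans (le_bigmax_cond _ (j := ord_max) _ _) => //.
Qed.

Lemma perm_ord2 (s : 'S_2) : s = 1%g \/ s = tperm ord0 ord_max.
Proof.
have H (i : 'I_2) : i = ord0 \/ i = ord_max.
  by case: i => -[|[|//]] Hi; [left|right]; exact: val_inj.
have [s0|s0] := H (s ord0); have [s1|s1] := H (s ord_max).
- by have /perm_inj := etrans s0 (esym s1).
- left; apply/permP => i; rewrite perm1.
  by have [->|->] := H i.
- right; apply/permP => i; have [->|->] := H i; first by rewrite tpermL.
  by rewrite tpermR.
- by have /perm_inj := etrans s0 (esym s1).
Qed.

Lemma edge_chain (rho : R -> R) (b : G) (c : G * G -> R) (K P : R) :
  0 <= K -> 0 <= P -> (forall e, c (e.2, e.1) = - c e) ->
  (forall e, `|c e| <= K * rho (Num.max (mdist (val e.1) (val b)) (mdist (val e.2) (val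
    b)))) ->
  (forall e, P < mdist (val e.1) (val e.2) -> c e = 0) ->
  chain rho b (q := 1) (fun t => c (fst_vertex t, snd_vertex t)).
Proof.
move=> K0 P0 anti bnd supp; split.
- by exists K => // t; rewrite -{3}(edge_eta t) tuple_dist_edge; exact: bnd.
- move=> s t; have [->|->] := perm_ord2 s.
    rewrite odd_perm1 expr0 mul1r; congr (c (_, _)); rewrite /fst_vertex /snd_vertex;
    by rewrite tnth_mktuple perm1.
  rewrite odd_tperm /= expr1 mulN1r -anti; congr (c (_, _));
  by rewrite /fst_vertex /snd_vertex tnth_mktuple ?tpermL ?tpermR.
- by exists P => // t; rewrite -{1}(edge_eta t) tuple_spread_edge; exact: supp.
Qed.

Lemma boundary_edge (c : 2.-tuple G -> R) (y : 1.-tuple G) :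
  boundary (q := 1) c y =
  \sum_(e \in [set: G * G]) c (edge e) * ((e.2 == thead y)%:R - (e.1 == thead y)%:R).
Proof.
rewrite /boundary (reindex_fsbigT edge); last exact: edge_bij.
by apply: eq_fsbigr => e _; rewrite simplex_boundary_edge.
Qed.

End Pairs.

Lemma fsbig_support (R : realType) (T : choiceType) (F : T -> R) (s : seq T) :
  uniq s -> (forall x, F x != 0 -> x \in s) ->
  \sum_(x \in [set: T]) F x = \sum_(x <- s) F x.
Proof.
move=> us Fs; rewrite [RHS]fsbig_seq//; apply/esym/fsbig_widen => // x [_ /= xs].
by apply/eqP; apply: contra_notT xs => /Fs.
Qed.

Lemma esum_support (R : realType) (T : choiceType) (F : T -> \bar R) (s : seq T) :
  uniq s -> (forall x, 0 <= F x)%E -> (forall x, F x != 0%E -> x \in s) ->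
  (\esum_(x in [set: T]) F x = \sum_(x <- s) F x)%E.
Proof.
move=> us F0 Fs; rewrite fsbig_seq// -esum_fset//.
rewrite [RHS]esum_mkcond; apply: eq_esum => x _.
have [//|xs] := boolP (x \in [set` s]).
apply/eqP; apply: contraNT xs => /Fs xs; exact/mem_set.
Qed.

(** * Flows of unit divergence *)

Section Flow.
Context {R : realType} {T : choiceType}.
Variables (w : T * T -> R).
Hypothesis w0 : forall e, 0 <= w e.
Hypothesis w_finite : forall x, finite_set [set e | w e != 0 /\ (e.1 = x \/ e.2 = x)].

Let fin : set (T * T -> R) := [set F | finite_set [set e | F e != 0]].

Let p (F : T * T -> R) : R := fine (\esum_(e in [set: T * T]) (`|F e| * w e)%:E).

Let fin_seq F : fin F -> exists2 s, uniq s & forall e, F e != 0 -> e \in s.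
Proof.
move=> fF; exists (enum_fset (fset_set [set e | F e != 0])); first exact: fset_uniq.
by move=> e Fe; rewrite in_fset_set//; exact/mem_set.
Qed.

Let pE F : fin F -> (p F)%:E = \esum_(e in [set: T * T]) (`|F e| * w e)%:E.
Proof.
move=> /fin_seq[s us Fs]; rewrite fineK// (esum_support us).
- by rewrite sumEFin.
- by move=> e; rewrite lee_fin mulr_ge0.
- by move=> e; rewrite eqe mulf_eq0 negb_or normr_eq0 => /andP[/Fs].
Qed.

Let finD (a : R) F F' : fin F -> fin F' -> fin (a *: F + F').
Proof.
move=> fF fF'; apply: (@sub_finite_set _ _ ([set e | F e != 0] `|` [set e | F' e != 0])).
  move=> e /= H; have [F0|] := eqVneq (F e) 0; last by left.
  right; move: H; have -> : (a *: F + F') e = a * F e + F' e by [].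
  by rewrite F0 mulr0 add0r.
by rewrite finite_setU.
Qed.

Let fin0 : fin 0.
Proof. by apply: (@sub_finite_set _ _ set0) => // e /=; rewrite eqxx. Qed.

Let pD F F' : fin F -> fin F' -> p (F + F') <= p F + p F'.
Proof.
move=> fF fF'; have fFF : fin (F + F') by rewrite -[F]scale1r; exact: finD.
rewrite -lee_fin EFinD !pE// -esumD; last 2 first.
- by move=> e _; rewrite lee_fin mulr_ge0.
- by move=> e _; rewrite lee_fin mulr_ge0.
apply: le_esum => e _; rewrite -EFinD lee_fin -mulrDl ler_wpM2r//.
exact: ler_normD.
Qed.

Let pZ (a : R) F : 0 <= a -> fin F -> p (a *: F) = a * p F.
Proof.
move=> a0 fF; have fa : fin (a *: F) by rewrite -[a *: F]addr0; exact: finD.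
apply: EFin_inj; rewrite EFinM !pE// -esumZl//; last first.
  by move=> e _; rewrite lee_fin mulr_ge0.
apply: eq_esum => e _; rewrite -EFinM; congr EFin.
by rewrite /= /GRing.scale/= normrM ger0_norm// mulrA.
Qed.

(* Restricting to the edges of nonzero weight makes the coboundary of a finitely
   supported v finitely supported. *)
Let coboundary (v : T -> R) (e : T * T) : R :=
  if w e == 0 then 0 else v e.2 - v e.1.

Let fin_coboundary v : finite_set [set x | v x != 0] -> fin (coboundary v).
Proof.
move=> fv; apply: (@sub_finite_set _ _ (\bigcup_(x in [set x | v x != 0])
   [set e | w e != 0 /\ (e.1 = x \/ e.2 = x)])).
  move=> e /=; rewrite /coboundary; case: ifPn; first by rewrite eqxx.
  move=> we H; have [v1|v1] := eqVneq (v e.1) 0; last by exists e.1 => //; split => //;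
    left.
  by exists e.2; [move: H; rewrite v1 subr0|split => //; right].
exact: bigcup_finite.
Qed.

(** The assumed inequality makes the sum of [v] depend on its coboundary only. An edge indicator has
    seminorm [w e], which bounds the flow; the divergence at [y] is the value of the functional on
    the coboundary of the indicator of [y], whose sum is 1. *)
Lemma flow_exists :
  (forall v : T -> R, finite_set [set x | v x != 0] ->
    (\esum_(x in [set: T]) (`|v x|)%:E <=
     \esum_(e in [set: T * T]) (`|v e.2 - v e.1| * w e)%:E)%E) ->
  exists c : T * T -> R, (forall e, `|c e| <= w e) /\
    forall y, \sum_(e \in [set: T * T]) c e * ((e.2 == y)%:R - (e.1 == y)%:R) = 1.
Proof.
move=> H.
pose G : set ((T * T -> R) * R) := [set z | exists v,
  [/\ finite_set [set x | v x != 0], z.1 = coboundary v &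
   z.2 = \sum_(x \in [set: T]) v x]].
have sumD (a : R) v v' : finite_set [set x | v x != 0] -> finite_set [set x | v' x != 0] ->
    finite_set [set x | (a *: v + v') x != 0] /\
    \sum_(x \in [set: T]) (a *: v + v') x =
    a * (\sum_(x \in [set: T]) v x) + \sum_(x \in [set: T]) v' x.
  move=> fv fv'; pose S := [set x | v x != 0] `|` [set x | v' x != 0].
  have fS : finite_set S by rewrite finite_setU.
  have sub x : (a *: v + v') x != 0 -> S x.
    move=> /= h; have [v0|] := eqVneq (v x) 0; last by left.
    right; move: h; have -> : (a *: v + v') x = a * v x + v' x by [].
    by rewrite v0 mulr0 add0r.
  split; first exact: sub_finite_set fS.
  have cov (u : T -> R) : (forall x, u x != 0 -> S x) ->
      \sum_(x \in [set: T]) u x = \sum_(x <- enum_fset (fset_set S)) u x.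
    move=> uS; apply: fsbig_support; first exact: fset_uniq.
    by move=> x /uS Sx; rewrite in_fset_set//; exact/mem_set.
  rewrite !cov//; [|by move=> x ?; right|by move=> x ?; left].
  by rewrite big_distrr/= -big_split.
have [|||psi [psiG psip psiD]] := @hahn_banach R _ fin p finD pD pZ G.
- exists (0, 0), 0; split => /=.
  + by apply: (@sub_finite_set _ _ set0) => // x /=; rewrite eqxx.
  + by apply/funext => e; rewrite /coboundary subrr if_same.
  + by rewrite fsbig1.
- move=> a [F r] [F' r'] [v [fv -> ->]] [v' [fv' -> ->]] /=.
  have [f s] := sumD a v v' fv fv'.
  exists (a *: v + v'); split => //=.
  apply/funext => e; have E x : (a *: v + v') x = a * v x + v' x by [].
  have -> : (a *: coboundary v + coboundary v') e =
    a * coboundary v e + coboundary v' e by [].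
  rewrite /coboundary !E.
  by case: ifP => _; [rewrite mulr0 addr0|lra].
- move=> [F r] [v [fv /= -> ->]]; split; first exact: fin_coboundary.
  rewrite -lee_fin pE; last exact: fin_coboundary.
  apply: (@le_trans _ _ (\esum_(x in [set: T]) (`|v x|)%:E)%E).
    pose s := enum_fset (fset_set [set x | v x != 0]).
    have us : uniq s by exact: fset_uniq.
    have vs x : v x != 0 -> x \in s by move=> vx; rewrite in_fset_set//; exact/mem_set.
    rewrite (fsbig_support us)// (esum_support us)//; last first.
      by move=> x; rewrite eqe normr_eq0; exact: vs.
    by rewrite sumEFin lee_fin; apply: ler_sum => x _; exact: ler_norm.
  apply: (le_trans (H v fv)); apply: le_esum => e _; rewrite lee_fin /coboundary.
  by case: ifPn => [/eqP ->|//]; rewrite !mulr0.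
pose one e : T * T -> R := fun e' => (e' == e)%:R.
have fin_one e : fin (one e).
  apply: (@sub_finite_set _ _ [set e]) => // e' /=.
  by rewrite /one pnatr_eq0 eqb0 negbK => /eqP.
have psi0 : psi 0 = 0.
  have := psiD 1 0 0 fin0 fin0; rewrite scale1r addr0; lra.
have psi_sum (s : seq (T * T)) (a : T * T -> R) :
    fin (\sum_(e <- s) a e *: one e) /\
    psi (\sum_(e <- s) a e *: one e) = \sum_(e <- s) a e * psi (one e).
  elim: s => [|e s [IH1 IH2]]; first by rewrite !big_nil.
  by rewrite !big_cons psiD// IH2; split => //; exact: finD.
have p_one e : p (one e) = w e.
  apply: EFin_inj; rewrite pE// (@esum_support _ _ _ [:: e])//.
  - by rewrite big_seq1 /one eqxx normr1 mul1r.
  - by move=> e'; rewrite lee_fin mulr_ge0.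
  - move=> e'; rewrite inE eqe mulf_eq0 negb_or normr_eq0 /one pnatr_eq0 eqb0 negbK.
    by case/andP.
have negE e e' : ((-1) *: one e + 0) e' = - one e e'.
  have -> : ((-1) *: one e + 0) e' = (-1) * one e e' + 0 by [].
  by rewrite mulN1r addr0.
exists (psi \o one); split.
  move=> e; rewrite ler_norml -p_one psip//= andbT lerNl.
  have -> : - psi (one e) = psi ((-1) *: one e + 0) by rewrite psiD// psi0; lra.
  have fe : fin ((-1) *: one e + 0) by exact: finD.
  apply: (le_trans (psip _ fe)); rewrite -lee_fin !pE//.
  by apply: le_esum => e' _; rewrite lee_fin negE normrN.
move=> y; pose v x : R := (x == y)%:R.
have fv : finite_set [set x | v x != 0].
  apply: (@sub_finite_set _ _ [set y]) => // x /=.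
  by rewrite /v pnatr_eq0 eqb0 negbK => /eqP.
have psi1 : psi (coboundary v) = 1.
  apply: psiG; exists v; split => //=.
  rewrite (@fsbig_support _ _ _ [:: y])//; first by rewrite big_seq1 /v eqxx.
  by move=> x; rewrite inE /v pnatr_eq0 eqb0 negbK.
(* Edges of weight zero were removed from the coboundary but still occur in the divergence; the
   functional vanishes on them. *)
have psi_w e : w e = 0 -> psi (one e) = 0.
  move=> we; have := psip _ (fin_one e); rewrite p_one we.
  have := psiD (-1) _ _ (fin_one e) fin0; rewrite psi0.
  have := psip _ (finD (-1) (fin_one e) fin0).
  have -> : p (-1 *: one e + 0) = p (one e).
    apply: EFin_inj; rewrite !pE//; last exact: finD.
    by apply: eq_esum => e' _; rewrite negE normrN.
  rewrite p_one we; lra.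
have [s us cs] := fin_seq (fin_coboundary fv).
have scE (a : R) e' e : (a *: one e') e = a * one e' e by [].
(* The coboundary of a vertex is a finite combination of edge indicators, so linearity suffices and
   no continuity of [psi] is involved. *)
have coE : coboundary v = \sum_(e <- s) coboundary v e *: one e.
  apply/funext => e; rewrite fct_sumE.
  have [es|es] := boolP (e \in s).
    rewrite (bigD1_seq e)//= [X in _ = _ + X]big1 ?addr0; last first.
      by move=> e' /negPf ne; rewrite scE /one eq_sym ne mulr0.
    by rewrite scE /one eqxx mulr1.
  rewrite big_seq big1 => [|e' es']; first by apply/eqP; apply: contraNT es; exact: cs.
  rewrite scE /one; case: eqP => [E|]; last by rewrite mulr0.
  by move: es; rewrite E es'.
rewrite -[RHS]psi1 [in RHS]coE (psi_sum s (coboundary v)).2.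
rewrite (fsbig_support us).
  apply: eq_bigr => e _ /=; rewrite /coboundary.
  case: (eqVneq (w e) 0) => [/psi_w ->|_]; first by rewrite !mul0r.
  by rewrite mulrC.
move=> e; rewrite mulf_eq0 negb_or => /andP[pe ve]; apply: cs.
rewrite /coboundary; case: (eqVneq (w e) 0) => [/psi_w E|//].
by move: pe; rewrite /= E eqxx.
Qed.

End Flow.

Lemma esum_pairs (R : realType) (T : choiceType) (P : T -> T -> bool)
    (a : T -> T -> \bar R) : (forall x y, P x y -> 0 <= a x y)%E ->
  (\esum_(x in [set: T]) \esum_(y in [set y | P x y]) a x y =
   \esum_(e in [set: T * T]) (if P e.1 e.2 then a e.1 e.2 else 0))%E.
Proof.
move=> a0; rewrite esum_esum; last by move=> x y _; exact: a0.
rewrite esum_mkcond; apply: eq_esum => -[x y] _ /=.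
suff -> : ((x, y) \in [set: T] `*`` (fun x => [set y | P x y])) = P x y by [].
by apply/idP/idP => [/set_mem[]//|Pxy]; apply/mem_set.
Qed.

(** * Vanishing of the fundamental class as an inequality *)

Section HomologyInequality.
Context {R : realType} {X : pmetricType R} {G : set X}.
Hypothesis G_finite : forall (x : G) (r : R),
  finite_set [set y : G | mdist (val x) (val y) <= r].
Variables (rho : R -> R) (b : G).
Hypothesis rho_ge1 : forall t, 0 <= t -> 1 <= rho t.

Definition vertex_norm (x : G) : R := mdist (val x) (val b).
Definition edge_weight (x y : G) : R :=
  rho (Num.max (vertex_norm x) (vertex_norm y)).
Definition incidence (y : G) (e : G * G) : R := (e.2 == y)%:R - (e.1 == y)%:R.

Lemma edge_weight_ge1 x y : 1 <= edge_weight x y.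
Proof. by apply: rho_ge1; rewrite le_max mdist_ge0. Qed.

Lemma edge_weightC x y : edge_weight x y = edge_weight y x.
Proof. by rewrite /edge_weight maxC. Qed.

Lemma incident_near_finite (P : R) (x : G) : finite_set
  [set e : G * G | mdist (val e.1) (val e.2) <= P /\ (e.1 = x \/ e.2 = x)].
Proof.
have f1 := finite_setX (finite_set1 x) (G_finite x P).
have f2 := finite_setX (G_finite x P) (finite_set1 x).
apply: sub_finite_set (_ : finite_set (_ `|` _)); last by rewrite finite_setU; split;
  [exact: f1|exact: f2].
move=> [u v] /= [uv [E|E]]; move: uv; rewrite E => uv; [left|right] => //.
by split => //=; rewrite metric_sym.
Qed.

Lemma incidence_neq0 y e : incidence y e != 0 -> e.1 = y \/ e.2 = y.
Proof.
rewrite /incidence; have [->|n2] := eqVneq e.2 y; first by right.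
by have [->|n1] := eqVneq e.1 y; [left|rewrite subrr eqxx].
Qed.

Definition near_supported (P : R) (c : G * G -> R) :=
  forall e, c e != 0 -> mdist (val e.1) (val e.2) <= P.

Lemma near_seq (P : R) (s0 : seq G) : exists2 s : seq (G * G), uniq s &
  forall e, mdist (val e.1) (val e.2) <= P -> e.1 \in s0 \/ e.2 \in s0 -> e \in s.
Proof.
pose S := \bigcup_(x in [set` s0])
  [set e : G * G | mdist (val e.1) (val e.2) <= P /\ (e.1 = x \/ e.2 = x)].
have fS : finite_set S.
  by apply: bigcup_finite => [|x _]; [exact: finite_seq|exact: incident_near_finite].
exists (enum_fset (fset_set S)); first exact: fset_uniq.
move=> e eP h; rewrite in_fset_set//; apply/mem_set; case: h => h.
  by exists e.1 => //; split => //; left.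
by exists e.2 => //; split => //; right.
Qed.

Lemma near_seq1 (P : R) (y : G) : exists2 s : seq (G * G), uniq s &
  forall e, mdist (val e.1) (val e.2) <= P -> e.1 = y \/ e.2 = y -> e \in s.
Proof.
have [s us cs] := near_seq P [:: y]; exists s => // e h H; apply: cs => //.
by rewrite !mem_seq1; case: H => ->; rewrite eqxx; [left|right].
Qed.

Lemma near_sum (P : R) (c : G * G -> R) y (s : seq (G * G)) : near_supported P c ->
  uniq s -> (forall e, mdist (val e.1) (val e.2) <= P -> e.1 = y \/ e.2 = y -> e \in s) ->
  \sum_(e \in [set: G * G]) c e * incidence y e = \sum_(e <- s) c e * incidence y e.
Proof.
move=> nc us cs; apply: fsbig_support => // e; rewrite mulf_eq0 negb_or => /andP[ce ie].
by apply: cs; [exact: nc|exact: incidence_neq0].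
Qed.

Lemma chain_near (c : 2.-tuple G -> R) : chain rho b (q := 1) c ->
  exists2 P : R, 0 <= P & near_supported P (c \o edge).
Proof.
move=> [_ _ [P P0 cP]]; exists P => // e /= ce; rewrite leNgt; apply/negP => eP.
by move: ce; rewrite cP ?eqxx// tuple_spread_edge.
Qed.

Lemma chain_lin (a : R) (c c' : 2.-tuple G -> R) : chain rho b (q := 1) c ->
  chain rho b (q := 1) c' -> chain rho b (q := 1) (fun t => c t + a * c' t).
Proof.
move=> [[K K0 cK] ca [P P0 cP]] [[K' K'0 cK'] ca' [P' P'0 cP']]; split.
- exists (K + `|a| * K'); first by rewrite addr_ge0// mulr_ge0.
  move=> t; apply: (le_trans (ler_normD _ _)); rewrite mulrDl lerD// normrM -mulrA.
  by rewrite ler_wpM2l.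
- by move=> s t; rewrite ca ca' mulrDr mulrCA.
- exists (Num.max P P'); first by rewrite le_max P0.
  by move=> t; rewrite gt_max => /andP[/cP -> /cP' ->]; rewrite mulr0 addr0.
Qed.

Lemma chain0 : chain rho b (q := 1) (fun=> 0).
Proof.
split; [exists 0 => // t; by rewrite normr0 mul0r|by move=> s t; rewrite mulr0|by exists 0].
Qed.

Lemma boundary_lin (a : R) (c c' : 2.-tuple G -> R) : chain rho b (q := 1) c ->
  chain rho b (q := 1) c' ->
  boundary (q := 1) (fun t => c t + a * c' t) =
  (fun y => boundary (q := 1) c y + a * boundary (q := 1) c' y).
Proof.
move=> hc hc'; apply/funext => y; rewrite !boundary_edge -!/(incidence _ _).
have [P _ nc] := chain_near hc; have [P' _ nc'] := chain_near hc'.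
have [s us cs'] := near_seq1 (Num.max P P') (thead y).
have H d : near_supported (Num.max P P') d ->
  \sum_(e \in [set: G * G]) d e * incidence (thead y) e =
  \sum_(e <- s) d e * incidence (thead y) e by move=> nd; exact: (near_sum nd us cs').
have n1 : near_supported (Num.max P P') (c \o edge).
  by move=> e /nc h; rewrite le_max h.
have n2 : near_supported (Num.max P P') (c' \o edge).
  by move=> e /nc' h; rewrite le_max h orbT.
have := H (fun e => c (edge e) + a * c' (edge e)); rewrite /incidence => ->.
  have := H _ n1; rewrite /incidence /= => ->.
  have := H _ n2; rewrite /incidence /= => ->.
  rewrite big_distrr/= -big_split/=; apply: eq_bigr => e _.
  by rewrite mulrDl mulrA.
move=> e h; have [E|] := eqVneq (c (edge e)) 0; last exact: n1.
by apply: n2; apply: contraNN h => /eqP /= ->; rewrite E mulr0 addr0.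
Qed.

Lemma chain1 : chain rho b (q := 0) (fun=> 1).
Proof.
split.
- exists 1 => // t; rewrite normr1 mul1r; apply: rho_ge1.
  exact: bigmax_ge_id.
- move=> s t; have -> : s = 1%g by apply/permP => i; rewrite !ord1.
  by rewrite odd_perm1 expr0 mul1r.
- exists 0 => // t; rewrite ltNge => /negP h; exfalso; apply: h.
  apply: bigmax_le => // i _; apply: bigmax_le => // j.
  by rewrite !ord1.
Qed.

(** Classes are cosets of the space of boundaries. A chain with boundary 1 shifts one coset onto the
    other; conversely, the constant 1 lies in the fundamental class, hence among the boundaries. *)
Lemma fundamental_class_zero :
  (exists2 c, chain rho b (q := 1) c & boundary (q := 1) c = fun=> 1) <->
  coarse_homology rho b (fundamental_class rho b) /\
  homology_class rho b (q := 0) 0 = fundamental_class rho b.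
Proof.
split=> [[c hc bc]|[_ E]].
  split; first by exists (fun=> 1) => //; split; [exact: chain1|].
  apply/seteqP; split => _ [d hd <-].
    exists (fun t => d t + (-1) * c t); first exact: chain_lin.
    rewrite boundary_lin// bc; apply/funext => y.
    rewrite -[LHS]/(1 + (boundary (q := 1) d y + (-1) * 1)).
    by rewrite -[RHS]/(0 + boundary (q := 1) d y); lra.
  exists (fun t => d t + 1 * c t); first exact: chain_lin.
  rewrite boundary_lin// bc; apply/funext => y.
  rewrite -[LHS]/(0 + (boundary (q := 1) d y + 1 * 1)).
  by rewrite -[RHS]/(1 + boundary (q := 1) d y); lra.
have : fundamental_class rho b ((fun=> 1) + boundary (q := 1) (fun=> 0)).
  by exists (fun=> 0) => //; exact: chain0.
rewrite -E => -[c hc cE]; exists c => //; apply/funext => y.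
have := f_equal (fun f => f y) cE.
rewrite -[LHS]/(0 + boundary (q := 1) c y).
rewrite -[X in _ = X -> _]/(1 + boundary (q := 1) (fun=> 0) y) add0r => ->.
by rewrite boundary_edge fsbig1 ?addr0// => e _; rewrite mul0r.
Qed.

(** The range [P] is a parameter because a 1-chain comes with some bound on the length of its edges,
    not with the bound [3 * eps] of the net. *)
Definition edge_sum (P K : R) (v : G -> R) : \bar R :=
  (\esum_(x in [set: G]) \esum_(y in [set y : G | (mdist (val x) (val y) <= P)%R])
     (K * (`|v x - v y| * edge_weight x y))%:E)%E.

Lemma edge_sum_pairs P K v : 0 <= K -> edge_sum P K v =
  (\esum_(e in [set: G * G]) (`|v e.2 - v e.1| *
     (if (mdist (val e.1) (val e.2) <= P)%R then K * edge_weight e.1 e.2 else 0))%:E)%E.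
Proof.
move=> K0; rewrite /edge_sum esum_pairs; last first.
  by move=> x y _; rewrite lee_fin !mulr_ge0// (le_trans ler01)// edge_weight_ge1.
apply: eq_esum => e _; case: ifP => _; last by rewrite mulr0.
by congr EFin; rewrite distrC; lra.
Qed.

Lemma chain_of_inequality (K P : R) : 0 <= K -> 0 <= P ->
  (forall v : G -> R, finite_set [set x | v x != 0] ->
     (\esum_(x in [set: G]) (`|v x|)%:E <= edge_sum P K v)%E) ->
  exists2 c, chain rho b (q := 1) c & boundary (q := 1) c = fun=> 1.
Proof.
move=> K0 P0 H.
pose w (e : G * G) := if mdist (val e.1) (val e.2) <= P then K * edge_weight e.1 e.2 else 0.
have w0 e : 0 <= w e.
  by rewrite /w; case: ifP => // _; rewrite mulr_ge0// (le_trans ler01)// edge_weight_ge1.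
have wnear e : w e != 0 -> mdist (val e.1) (val e.2) <= P.
  by rewrite /w; case: ifP => //; rewrite eqxx.
have [||c [cw cdiv]] := @flow_exists R _ w w0.
- move=> x; apply: sub_finite_set (incident_near_finite P x) => e /= [we h].
  by split => //; exact: wnear.
- by move=> v fv; rewrite -edge_sum_pairs//; exact: H.
have cnear : near_supported P c.
  move=> e ce; apply: wnear; apply: contraNN ce => /eqP we; rewrite -normr_le0.
  by rewrite -we.
pose sw (e : G * G) := (e.2, e.1).
have csnear : near_supported P (c \o sw).
  by move=> e /cnear /=; rewrite metric_sym.
(* The flow need not be alternating. Reversing all edges turns its divergence into -1, so its
   antisymmetric part has divergence 1 again and obeys the same bounds. *)
pose c2 e := (c e - c (sw e)) / 2.
have wsw e : w (sw e) = w e by rewrite /w /sw/= metric_sym edge_weightC.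
exists (fun t => c2 (fst_vertex t, snd_vertex t)).
  apply: (@edge_chain _ _ _ _ _ _ K P) => //.
  - by move=> [x y]; rewrite /c2 /sw/=; lra.
  - move=> e; have h1 := cw e; have h2 := cw (sw e); rewrite wsw in h2.
    have h3 : w e <= K * edge_weight e.1 e.2.
      by rewrite /w; case: ifP => // _;
        rewrite mulr_ge0// (le_trans ler01)// edge_weight_ge1.
    rewrite /c2 normrM (@ger0_norm _ 2^-1) ?invr_ge0//.
    apply: le_trans h3; have := ler_normB (c e) (c (sw e)); lra.
  - move=> e eP; rewrite /c2; have H0 d : near_supported P d -> d e = 0.
      by move=> nd; apply/eqP; apply: contraTT eP => /nd; rewrite leNgt.
    by rewrite H0// -[c (sw e)]/((c \o sw) e) H0// subrr mul0r.
apply/funext => t; rewrite boundary_edge; set y := thead t.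
have [s us cs'] := near_seq1 P y.
have A := cdiv y.
have B : \sum_(e \in [set: G * G]) (c \o sw) e * incidence y e = -1.
  rewrite (reindex_fsbigT sw); last by exists sw => -[].
  rewrite -A -mulN1r mulr_fsumr; apply: eq_fsbigr => -[x z] _ /=.
  by rewrite /incidence /sw/=; lra.
rewrite (near_sum csnear us cs') in B.
have := near_sum cnear us cs'; rewrite /incidence A => {}A.
transitivity (\sum_(e \in [set: G * G]) c2 e * incidence y e).
  by apply: eq_fsbigr => e _; rewrite fst_edge snd_edge -surjective_pairing.
have c2near : near_supported P c2.
  move=> e; have [E|] := eqVneq (c e) 0; last by move=> /cnear.
  by rewrite /c2 E sub0r => h; apply: csnear; apply: contraNN h => /eqP /= ->;
    rewrite oppr0 mul0r.
rewrite (near_sum c2near us cs').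
transitivity ((\sum_(e <- s) c e * incidence y e - \sum_(e <- s) (c \o sw) e * incidence
  y e) / 2).
  rewrite -sumrB mulr_suml; apply: eq_bigr => e _; rewrite /c2/=; lra.
by rewrite -[X in X - _]A B; lra.
Qed.

(** Summation by parts: pairing [|v|] with the boundary of [c] gives the sum of [c] times the
    increments of [|v|] along the edges, and these are at most the increments of [v]. *)
Lemma inequality_of_chain c : chain rho b (q := 1) c ->
  boundary (q := 1) c = (fun=> 1) ->
  exists K P : R, [/\ 0 <= K, 0 <= P & forall v : G -> R,
     finite_set [set x | v x != 0] ->
     (\esum_(x in [set: G]) (`|v x|)%:E <= edge_sum P K v)%E].
Proof.
move=> hc bc; have [P P0 nc] := chain_near hc; have [[K K0 cK] _ _] := hc.
exists K, P; split => // v fv; rewrite edge_sum_pairs//.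
pose s0 := enum_fset (fset_set [set x | v x != 0]).
have us0 : uniq s0 by exact: fset_uniq.
have vs0 x : v x != 0 -> x \in s0 by move=> vx; rewrite in_fset_set//; exact/mem_set.
rewrite (esum_support us0)//; last by move=> x; rewrite eqe normr_eq0; exact: vs0.
(* A finite list containing all edges of length at most [P] that touch the support of [v], so that
   the two summations can be exchanged. *)
have [s us cs] := near_seq P s0.
have E1 y : y \in s0 -> \sum_(e <- s) c (edge e) * incidence y e = 1.
  move=> ys; have := f_equal (fun f => f [tuple y]) bc; rewrite boundary_edge.
  rewrite -[X in _ -> X = _](@near_sum P (c \o edge) y s)//.
  by move=> e h [E|E]; apply: cs => //; rewrite E; [left|right].
have E2 (u : G -> R) z : (forall x, u x != 0 -> x \in s0) ->
    \sum_(y <- s0) u y * (z == y)%:R = u z.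
  move=> us1; have [zs|zs] := boolP (z \in s0).
    rewrite (bigD1_seq z)//= eqxx mulr1 big1 ?addr0// => y yz.
    by rewrite eq_sym (negPf yz) mulr0.
  rewrite big_seq big1 => [|y ys]; first by apply/esym/eqP; apply: contraNT zs; exact: us1.
  by case: eqP => [E|]; [rewrite E ys in zs|rewrite mulr0].
have av x : `|v x| != 0 -> x \in s0 by rewrite normr_eq0; exact: vs0.
have -> : (\sum_(x <- s0) (`|v x|)%:E =
   (\sum_(e <- s) c (edge e) * (`|v e.2| - `|v e.1|))%:E)%E.
  rewrite sumEFin; congr EFin.
  transitivity (\sum_(y <- s0) `|v y| * \sum_(e <- s) c (edge e) * incidence y e).
    by rewrite !big_seq; apply: eq_bigr => y ys; rewrite E1// mulr1.
  under eq_bigr do rewrite mulr_sumr.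
  rewrite exchange_big/=; apply: eq_bigr => e _.
  rewrite -(E2 _ e.2 av) -(E2 _ e.1 av) -sumrB mulr_sumr.
  by apply: eq_bigr => y _; rewrite /incidence; lra.
apply: (@le_trans _ _ (\sum_(e <- s) (`|v e.2 - v e.1| *
   (if mdist (val e.1) (val e.2) <= P then K * edge_weight e.1 e.2 else 0))%:E)%E);
     last first.
  exact: esum_ge_seq.
rewrite sumEFin lee_fin; apply: ler_sum => e _.
have [eP|eP] := leP (mdist (val e.1) (val e.2)) P; last first.
  suff -> : c (edge e) = 0 by rewrite mul0r mulr0.
  by apply/eqP; apply: contraTT eP => /nc; rewrite -leNgt.
apply: (le_trans (ler_norm _)); rewrite normrM mulrC; apply: ler_pM => //.
  exact: ler_dist_dist.
by have := cK (edge e); rewrite tuple_dist_edge.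
Qed.

End HomologyInequality.

Lemma esum_pullback (R : realType) (T U : choiceType) (f : T -> U) (a : U -> \bar R) n :
  (forall j, ([set i | f i = j] #<= `I_n)%card) -> (forall j, 0 <= a j)%E ->
  (\esum_(i in [set: T]) a (f i) <= n%:R%:E * \esum_(j in [set: U]) a j)%E.
Proof.
move=> fn a0; have := @esum_neighbours_le R T U (fun i j => f i = j) a n fn a0.
apply: le_trans; apply: le_esum => i _.
have -> : [set j | f i = j] = [set f i] by apply/seteqP; split => j /= ->.
by rewrite esum_set1.
Qed.

(** * Transfer of the inequality to any quasi-lattice *)

Section LocalFiniteness.
Context {R : realType} {X : pmetricType R}.

Lemma lattice_ball_card (G : set X) (n : R -> nat) :
  (forall (x : X) (r : R), 0 < r -> (G `&` ball x r #<= `I_(n r))%card) ->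
  forall (x : X) (r : R), 0 < r ->
    ([set y : G | mdist x (val y) < r] #<= `I_(n r))%card.
Proof.
move=> Gn x r r0; apply/card_le_seqP => s us sr.
rewrite -(size_map (@set_val _ G)); apply: (card_le_seqP _ _).1 (Gn x r r0) _ _ _.
  by rewrite map_inj_uniq//; exact: val_inj.
move=> _ /mapP[y ys ->]; split; first exact: set_valP.
by rewrite ballEmdist; exact: sr.
Qed.

Lemma lattice_ball_finite (G : set X) : quasi_lattice G ->
  forall (x : G) (r : R), finite_set [set y : G | mdist (val x) (val y) <= r].
Proof.
move=> [_ [n Gn]] x r.
have r0 : 0 < Num.max r 0 + 1 by have : 0 <= Num.max r 0 by [rewrite le_max lexx orbT]; lra.
apply/finite_set_leP; exists (n (Num.max r 0 + 1)).
apply: card_le_trans (lattice_ball_card Gn (val x) r0); apply: subset_card_le => y /= h.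
by apply: le_lt_trans h _; have : r <= Num.max r 0 by [rewrite le_max lexx]; lra.
Qed.

End LocalFiniteness.

Section Transfer.
Context {R : realType} {X : pmetricType R}.
Variables (rho : R -> R) (hrho : control_function rho).

Lemma edge_sumZ (G : set X) (b : G) P K v : 0 <= K ->
  edge_sum rho b P K v = (K%:E * edge_sum rho b P 1 v)%E.
Proof.
have rho_ge1 := control_ge1 hrho.
move=> K0; rewrite /edge_sum -esumZl//.
  apply: eq_esum => x _; rewrite -esumZl//.
    by apply: eq_esum => y _; rewrite -EFinM mul1r.
  by move=> y _; rewrite lee_fin mul1r mulr_ge0// (le_trans ler01)// edge_weight_ge1.
move=> x _; apply: esum_ge0 => y _.
by rewrite lee_fin mul1r mulr_ge0// (le_trans ler01)// edge_weight_ge1.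
Qed.

(** [|w x|] is at most the increment of [w] from [x] to [phi (psi x)] plus [|w (phi (psi x))|]. The
    increment is along an edge of bounded length; the other term is treated by the inequality on the
    net for [w \o phi]. Both maps move points boundedly, so their fibres have bounded size. *)
Lemma inequality_transfer (eps : R) (N : set X) (o : X) (G : set X) (b : G) (C2 : R) :
  0 < eps -> maximal_net N eps -> quasi_lattice N -> quasi_lattice G -> 0 < C2 ->
  (forall v : N -> R, finite_set [set p | v p != 0] ->
    (\esum_(p in [set: N]) `|v p|%:E <= C2%:E *
       \esum_(p in [set: N]) \esum_(q in net_neighbours eps p)
         (`|v p - v q| * rho (edge_norm o (val p) (val q)))%:E)%E) ->
  exists K P : R, [/\ 0 <= K, 0 <= P & forall w : G -> R,
    finite_set [set x | w x != 0] ->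
    (\esum_(x in [set: G]) `|w x|%:E <= edge_sum rho b P K w)%E].
Proof.
move=> e0 [netC _] [_ [nN hN]] [[C C0 GC] [nG hG]] C20 H.
have rho_ge1 := control_ge1 hrho.
have /choice[phi phiP] (p : N) : exists x : G, mdist (val p) (val x) < C.
  by have [y Gy py] := GC (val p); exists (SigSub (mem_set Gy)).
have /choice[psi psiP] (x : G) : exists p : N, mdist (val x) (val p) < eps.
  by have [y Ny xy] := netC (val x); exists (SigSub (mem_set Ny)).
(* [C] accounts for the displacement by [phi], the other term for the change of base point. *)
have a0 : 0 <= C + mdist o (val b) by rewrite addr_ge0 ?mdist_ge0// ltW.
have [L L0 hL] := control_shift hrho a0.
(* Net neighbours are within [3 * eps], and [phi] moves each end by less than [C]; the distance from
   [x] to [phi (psi x)], below [eps + C], is covered too. *)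
pose P := 3 * eps + 2 * C.
pose n := nN C; pose m := nG eps.
have fib_phi x : ([set p | phi p = x] #<= `I_n)%card.
  apply: card_le_trans (lattice_ball_card hN (val x) C0); apply: subset_card_le => p /= <-.
  by rewrite metric_sym; exact: phiP.
have fib_psi p : ([set x | psi x = p] #<= `I_m)%card.
  apply: card_le_trans (lattice_ball_card hG (val p) e0); apply: subset_card_le => x /= <-.
  by rewrite metric_sym; exact: psiP.
(* The 1 pays for the increments from [x] to [phi (psi x)]. In the product [m] bounds the fibres of
   [psi], and [n] occurs twice, for the two ends of an edge pulled back by [phi]. *)
pose K := 1 + m%:R * C2 * L * n%:R * n%:R.
have K0 : 0 <= m%:R * C2 * L * n%:R * n%:R by rewrite !mulr_ge0// ltW.
exists K, P; split; [by rewrite /K; lra|by rewrite /P; lra|].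
move=> w fw; pose v := w \o phi.
have fv : finite_set [set p | v p != 0].
  apply: (@sub_finite_set _ _ (\bigcup_(x in [set x | w x != 0]) [set p | phi p = x])).
    by move=> p vp; exists (phi p).
  by apply: bigcup_finite => // x _; apply/finite_set_leP; exists n; exact: fib_phi.
pose W x y := edge_weight rho b x y.
have W0 x y : 0 <= W x y by rewrite (le_trans ler01)// edge_weight_ge1.
pose F x y : \bar R := (1 * (`|w x - w y| * W x y))%:E.
have F0 x y : (0 <= F x y)%E by rewrite lee_fin mul1r mulr_ge0.
pose Hxy x y : \bar R := (if y \in [set y : G | (mdist (val x) (val y) <= P)%R] then F x
  y else 0)%E.
have H0 x y : (0 <= Hxy x y)%E by rewrite /Hxy; case: ifP.
have HE : (\esum_(x in [set: G]) \esum_(y in [set: G]) Hxy x y = edge_sum rho b P 1 w)%E.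
  by apply: eq_esum => x _; rewrite [RHS]esum_mkcond.
have Hnear x y : mdist (val x) (val y) <= P -> Hxy x y = F x y.
  by move=> xy; rewrite /Hxy mem_set.
rewrite edge_sumZ; last by rewrite /K; lra.
rewrite /K EFinD ge0_muleDl ?lee_fin// mul1e.
apply: (@le_trans _ _ (\esum_(x in [set: G]) (`|w x - w (phi (psi x))|%:E + `|v (psi
  x)|%:E))%E).
  apply: le_esum => x _; rewrite -EFinD lee_fin.
  by have := ler_normD (w x - w (phi (psi x))) (v (psi x)); rewrite /v/= subrK.
rewrite esumD; [|by move=> x _; rewrite lee_fin|by move=> x _; rewrite lee_fin].
apply: leeD.
  rewrite -HE; apply: le_esum => x _.
  have near : mdist (val x) (val (phi (psi x))) <= P.
    have := metric_triangle (val x) (val (psi x)) (val (phi (psi x))).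
    have := psiP x; have := phiP (psi x); rewrite /P; lra.
  apply: (@le_trans _ _ (\sum_(y <- [:: phi (psi x)]) Hxy x y)%E); last exact: esum_ge_seq.
  rewrite big_seq1 Hnear// lee_fin mul1r.
  by rewrite ler_peMr//; exact: edge_weight_ge1.
apply: (le_trans (esum_pullback (a := fun p => `|v p|%:E) fib_psi _)) => [p|].
  by rewrite lee_fin.
rewrite -!mulrA EFinM -muleA; apply: lee_wpmul2l; first by rewrite lee_fin.
apply: (le_trans (H v fv)); rewrite EFinM -muleA; apply: lee_wpmul2l.
  by rewrite lee_fin ltW.
apply: (@le_trans _ _ (\esum_(p in [set: N]) (L%:E * \esum_(q in [set: N]) Hxy (phi p)
  (phi q)))%E).
  apply: le_esum => p _; rewrite -esumZl//; [|exact: ltW].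
  apply: (@le_trans _ _ (\esum_(q in net_neighbours eps p) (L%:E * Hxy (phi p) (phi q)))%E);
    last exact: esum_subset.
  apply: le_esum => q /= /andP[_ pq].
  have t1 := metric_triangle (val (phi p)) (val p) (val (phi q)).
  have t2 := metric_triangle (val p) (val q) (val (phi q)).
  have pp := phiP p; have qq := phiP q.
  rewrite Hnear; last by rewrite [mdist (val (phi p)) (val p)]metric_sym in t1;
    rewrite /P; clear -t1 t2 pp qq pq; lra.
  rewrite -EFinM lee_fin mul1r mulrCA; apply: ler_wpM2l => //.
  have m0 : 0 <= edge_norm o (val p) (val q) by rewrite le_max mdist_ge0.
  have := hL (Num.max (vertex_norm b (phi p)) (vertex_norm b (phi q))) (edge_norm o (val
    p) (val q)).
  rewrite (max_r m0); apply; first by rewrite le_max mdist_ge0.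
  rewrite /edge_norm ge_max /vertex_norm.
  set A := mdist (val (phi p)) _; set B := mdist (val (phi q)) _.
  have : A <= Num.max A B by rewrite le_max lexx.
  have : B <= Num.max A B by rewrite le_max lexx orbT.
  have := metric_triangle o (val b) (val p); have := metric_triangle o (val b) (val q).
  have := metric_triangle (val b) (val (phi p)) (val p).
  have := metric_triangle (val b) (val (phi q)) (val q).
  rewrite [mdist (val b) (val (phi p))]metric_sym [mdist (val b) (val (phi q))]metric_sym.
  rewrite [mdist (val (phi p)) (val p)]metric_sym [mdist (val (phi q)) (val q)]metric_sym.
  rewrite -/A -/B => t3 t4 t5 t6 t7 t8; apply/andP; clear -t3 t4 t5 t6 t7 t8 pp qq;
    split; lra.
have sH0 x : (0 <= \esum_(y in [set: G]) Hxy x y)%E by exact: esum_ge0.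
rewrite esumZl; [|exact: ltW|by move=> p _; exact: esum_ge0].
rewrite EFinM -muleA; apply: lee_wpmul2l; first by rewrite lee_fin ltW.
apply: (@le_trans _ _ (\esum_(p in [set: N]) (n%:R%:E * \esum_(y in [set: G]) Hxy (phi p)
  y))%E).
  by apply: le_esum => p _; exact: esum_pullback.
rewrite esumZl//; rewrite EFinM -muleA; apply: lee_wpmul2l; first by rewrite lee_fin.
rewrite -HE; exact: (esum_pullback (a := fun x => \esum_(y in [set: G]) Hxy x y)).
Qed.

End Transfer.

(** * Removing the measures of balls from the sums *)

Section MeasureWeights.
Context {R : realType} {X : pmetricType R}.
Variable mu : {outer_measure set X -> \bar R}.
Variables (N : set X) (r f g : R).
Hypotheses (f0 : 0 < f) (g0 : 0 < g).
Hypothesis fg : forall p : N, (f%:E <= mu (ball (val p) r) <= g%:E)%E.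
Local Open Scope ereal_scope.

Let m0 (p : N) : 0 <= mu (ball (val p) r).
Proof. by have /andP[+ _] := fg p; apply: le_trans; rewrite lee_fin ltW. Qed.

Lemma weighted_esum_le (A : set N) (a : N -> R) : (forall p, (0 <= a p)%R) ->
  \esum_(p in A) ((a p)%:E * mu (ball (val p) r)) <= g%:E * \esum_(p in A) (a p)%:E.
Proof.
move=> a0; rewrite -esumZl; [|exact: ltW|by move=> p _; rewrite lee_fin].
apply: le_esum => p _; rewrite muleC; apply: lee_wpmul2r; first by rewrite lee_fin.
by have /andP[] := fg p.
Qed.

Lemma weighted_esum_ge (A : set N) (a : N -> R) : (forall p, (0 <= a p)%R) ->
  (f%:E * (\esum_(p in A) (a p)%:E) <= \esum_(p in A) ((a p)%:E * mu (ball (val p) r)))%E.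
Proof.
move=> a0; rewrite -esumZl; [|exact: ltW|by move=> p _; rewrite lee_fin].
apply: le_esum => p _; rewrite [leRHS]muleC; apply: lee_wpmul2r; first by rewrite lee_fin.
by have /andP[] := fg p.
Qed.

Lemma weighted_double_esum_le (B : N -> set N) (a : N -> N -> R) :
  (forall p q, (0 <= a p q)%R) ->
  \esum_(p in [set: N]) \esum_(q in B p) ((a p q)%:E * mu (ball (val p) r)) <=
  g%:E * \esum_(p in [set: N]) \esum_(q in B p) (a p q)%:E.
Proof.
move=> a0; rewrite -esumZl; [|exact: ltW|by move=> p _; apply: esum_ge0 => q _;
  rewrite lee_fin].
apply: le_esum => p _; rewrite -esumZl; [|exact: ltW|by move=> q _; rewrite lee_fin].
apply: le_esum => q _; rewrite muleC; apply: lee_wpmul2r; first by rewrite lee_fin.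
by have /andP[] := fg p.
Qed.

Lemma weighted_double_esum_ge (B : N -> set N) (a : N -> N -> R) :
  (forall p q, (0 <= a p q)%R) ->
  (f%:E * (\esum_(p in [set: N]) \esum_(q in B p) (a p q)%:E) <=
   \esum_(p in [set: N]) \esum_(q in B p) ((a p q)%:E * mu (ball (val p) r)))%E.
Proof.
move=> a0; rewrite -esumZl; [|exact: ltW|by move=> p _; apply: esum_ge0 => q _;
  rewrite lee_fin].
apply: le_esum => p _; rewrite -esumZl; [|exact: ltW|by move=> q _; rewrite lee_fin].
apply: le_esum => q _; rewrite [leRHS]muleC; apply: lee_wpmul2r; first by rewrite lee_fin.
by have /andP[] := fg p.
Qed.

Lemma weighted_inequality_iff (B : N -> set N) (V : set (N -> R))
    (a : (N -> R) -> N -> R) (e : (N -> R) -> N -> N -> R) :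
  (forall v p, (0 <= a v p)%R) -> (forall v p q, (0 <= e v p q)%R) ->
  (exists C1 : R, (0 < C1)%R /\ forall v, V v ->
     \esum_(p in [set: N]) ((a v p)%:E * mu (ball (val p) r)) <=
     C1%:E * \esum_(p in [set: N]) \esum_(q in B p) ((e v p q)%:E * mu (ball (val p) r)))
       <->
  (exists C2 : R, (0 < C2)%R /\ forall v, V v ->
     \esum_(p in [set: N]) (a v p)%:E <=
     C2%:E * \esum_(p in [set: N]) \esum_(q in B p) (e v p q)%:E).
Proof.
move=> a0 e0; split=> [[C [C0 H]]|[C [C0 H]]].
  exists (f^-1 * (C * g))%R; split; first by rewrite !mulr_gt0// invr_gt0.
  move=> v Vv; rewrite EFinM -muleA -[leLHS]mul1e -(mulVf (lt0r_neq0 f0)) EFinM -muleA.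
  apply: lee_wpmul2l; first by rewrite lee_fin invr_ge0 ltW.
  apply: (le_trans (weighted_esum_ge _ (a0 v))); apply: (le_trans (H v Vv)).
  rewrite EFinM -muleA; apply: lee_wpmul2l; first by rewrite lee_fin ltW.
  exact: weighted_double_esum_le.
exists (g * (C * f^-1))%R; split; first by rewrite !mulr_gt0// invr_gt0.
move=> v Vv; apply: (le_trans (weighted_esum_le _ (a0 v))).
rewrite EFinM -muleA; apply: lee_wpmul2l; first by rewrite lee_fin ltW.
apply: (le_trans (H v Vv)); rewrite EFinM -muleA; apply: lee_wpmul2l.
  by rewrite lee_fin ltW.
rewrite -[leLHS]mul1e -(mulVf (lt0r_neq0 f0)) EFinM -muleA.
apply: lee_wpmul2l; first by rewrite lee_fin invr_ge0 ltW.
exact: weighted_double_esum_ge.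
Qed.

End MeasureWeights.

(** * Interpolating functions on a net *)

Section Partition.
Context {R : realType} {X : pmetricType R}.
Variables (N : set X) (eps : R) (n0 : nat) (Q : N -> seq N).
Hypothesis e0 : 0 < eps.
Hypothesis N_dense : forall x : X, exists p : N, mdist x (val p) < eps.
Hypothesis Q_uniq : forall p, uniq (Q p).
Hypothesis Q_mem : forall p q, (q \in Q p) = (mdist (val p) (val q) < 3 * eps).
Hypothesis Q_size : forall p, (size (Q p) <= n0)%N.
Variable (v : N -> R).

Local Notation rad := (3 / 2 * eps).

(** Since the radius [3 / 2 * eps] exceeds [eps], some bump is at least [eps / 2] at every point.
    Two bumps overlap only if their centres are closer than [3 * eps], so near [p] only the points
    of [Q p] matter. *)
Definition bump (q : N) (x : X) : R := Num.max 0 (rad - mdist x (val q)).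
Definition total_bump (x : X) : R := \sum_(q \in [set: N]) bump q x.
Definition interpolation (x : X) : R :=
  (\sum_(q \in [set: N]) v q * bump q x) / total_bump x.
Definition variation_at (p : N) : R := \sum_(q <- Q p) `|v p - v q|.

Lemma bump_ge0 q x : 0 <= bump q x.
Proof. by rewrite le_max lexx. Qed.

Lemma bump_support q x : bump q x != 0 -> mdist x (val q) < rad.
Proof.
rewrite ltNge; apply: contraNN => h.
by rewrite /bump max_l// subr_le0.
Qed.

Lemma bump_lipschitz q x y : `|bump q x - bump q y| <= mdist x y.
Proof.
have h1 := metric_triangle x y (val q); have h2 := metric_triangle y x (val q).
rewrite (metric_sym y x) in h2; have h3 := mdist_ge0 x y.
rewrite /bump ler_norml; case: (leP 0 (rad - mdist x (val q))) => a;
  case: (leP 0 (rad - mdist y (val q))) => c; apply/andP; split; (have := e0; lra).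
Qed.

Lemma bump_mem p q x : mdist (val p) x < rad -> bump q x != 0 -> q \in Q p.
Proof.
move=> px /bump_support xq; rewrite Q_mem; have := metric_triangle (val p) x (val q).
by move: px xq; (have := e0; lra).
Qed.

Lemma total_bumpE p x : mdist (val p) x < rad ->
  total_bump x = \sum_(q <- Q p) bump q x.
Proof. by move=> px; apply: fsbig_support => // q; exact: bump_mem. Qed.

Lemma bump_sumE (w : N -> R) p x : mdist (val p) x < rad ->
  \sum_(q \in [set: N]) w q * bump q x = \sum_(q <- Q p) w q * bump q x.
Proof.
move=> px; apply: fsbig_support => // q; rewrite mulf_eq0 negb_or => /andP[_].
exact: bump_mem.
Qed.

Lemma near_net x : exists2 p : N, mdist (val p) x < eps & mdist (val p) x < rad.
Proof.
have [p xp] := N_dense x; rewrite metric_sym in xp; exists p => //.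
by apply: (lt_trans xp); (have := e0; lra).
Qed.

Lemma total_bump_ge x : eps / 2 <= total_bump x.
Proof.
have [p px px'] := near_net x; rewrite (total_bumpE px').
have pQ : p \in Q p by rewrite Q_mem mdistxx mulr_gt0.
rewrite (bigD1_seq p)//=; apply: (@le_trans _ _ (bump p x)).
  by rewrite /bump le_max; apply/orP; right; rewrite metric_sym; (have := e0; lra).
by rewrite lerDl sumr_ge0// => q _; exact: bump_ge0.
Qed.

Lemma total_bump_gt0 x : 0 < total_bump x.
Proof. by apply: lt_le_trans (total_bump_ge x); (have := e0; lra). Qed.

Lemma bump_le_total q x : bump q x <= total_bump x.
Proof.
have [->|qx] := eqVneq (bump q x) 0; first exact/ltW/total_bump_gt0.
have [p px px'] := near_net x; rewrite (total_bumpE px').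
rewrite (bigD1_seq q)//=; last exact: bump_mem qx.
by rewrite lerDl sumr_ge0// => r _; exact: bump_ge0.
Qed.

(** The weights [bump q x / total_bump x] sum to 1, so constants drop out and only differences
    [v q - v p] enter the estimates. *)
Lemma interpolationB p x : mdist (val p) x < rad ->
  interpolation x - v p = \sum_(q <- Q p) (v q - v p) * (bump q x / total_bump x).
Proof.
move=> px; have t0 := total_bump_gt0 x.
rewrite /interpolation (bump_sumE v px).
have E : v p = (\sum_(q <- Q p) v p * bump q x) / total_bump x.
  by rewrite -mulr_sumr -(total_bumpE px) mulfK// gt_eqF.
rewrite [X in _ - X = _]E -mulrBl -sumrB mulr_suml; apply: eq_bigr => q _.
by rewrite -mulrBl mulrA.
Qed.

Lemma interpolation_close p x : mdist (val p) x < rad ->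
  `|interpolation x - v p| <= variation_at p.
Proof.
move=> px; rewrite interpolationB//; apply: le_trans (ler_norm_sum _ _ _) _.
apply: ler_sum => q _; rewrite normrM distrC ler_piMr//.
have t0 := total_bump_gt0 x.
by rewrite ger0_norm ?divr_ge0 ?bump_ge0 ?(ltW t0)// ler_pdivrMr// mul1r bump_le_total.
Qed.

(** A bump is 1-Lipschitz, a total of at most [n0] bumps is [n0]-Lipschitz, and the denominator is
    at least [eps / 2]. *)
Definition lip_const : R := 2 * (n0%:R + 1) / eps.

Lemma lip_const_ge0 : 0 <= lip_const.
Proof. by rewrite divr_ge0 ?mulr_ge0 ?addr_ge0// ltW. Qed.

Lemma variation_at_ge0 p : 0 <= variation_at p.
Proof. by rewrite sumr_ge0. Qed.

Lemma bump_quotient_lipschitz (p q : N) x y : mdist (val p) x < rad -> mdist (val p) y <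
  rad ->
  `|bump q x / total_bump x - bump q y / total_bump y| <= lip_const * mdist x y.
Proof.
move=> px py; have tx := total_bump_gt0 x; have ty := total_bump_gt0 y.
have d0 := mdist_ge0 x y.
have -> : bump q x / total_bump x - bump q y / total_bump y =
   ((bump q x - bump q y) + (bump q y / total_bump y) * (total_bump y - total_bump x))
   / total_bump x.
  by field; rewrite !gt_eqF.
rewrite normrM (@ger0_norm _ (total_bump x)^-1) ?invr_ge0 ?(ltW tx)// ler_pdivrMr//.
have hS : `|total_bump y - total_bump x| <= n0%:R * mdist x y.
  rewrite (total_bumpE px) (total_bumpE py) -sumrB.
  apply: le_trans (ler_norm_sum _ _ _) _.
  apply: (@le_trans _ _ (\sum_(q <- Q p) mdist x y)).
    by apply: ler_sum => r _; rewrite distrC; exact: bump_lipschitz.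
  rewrite big_const_seq count_predT iter_addr addr0 -[leLHS]mulr_natl.
  by apply: ler_wpM2r => //; rewrite ler_nat.
have hq : 0 <= bump q y / total_bump y <= 1.
  by rewrite divr_ge0 ?bump_ge0 ?(ltW ty)//= ler_pdivrMr// mul1r bump_le_total.
apply: (@le_trans _ _ ((n0%:R + 1) * mdist x y)).
  apply: (le_trans (ler_normD _ _)); rewrite mulrDl mul1r addrC lerD//.
    rewrite normrM -[leRHS]mul1r; apply: ler_pM => //.
    by case/andP: hq => h1 h2; rewrite ger0_norm.
  exact: bump_lipschitz.
have -> : lip_const * mdist x y * total_bump x =
    ((n0%:R + 1) * mdist x y) * (2 / eps * total_bump x) by rewrite /lip_const; ring.
rewrite -[leLHS]mulr1.
apply: ler_wpM2l; first by rewrite mulr_ge0// addr_ge0.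
by rewrite mulrAC ler_pdivlMr// mul1r; have := total_bump_ge x; (have := e0; lra).
Qed.

Lemma interpolation_lipschitz (p : N) x y : mdist (val p) x < rad -> mdist (val p) y <
  rad ->
  `|interpolation x - interpolation y| <= lip_const * variation_at p * mdist x y.
Proof.
move=> px py.
have -> : interpolation x - interpolation y =
  (interpolation x - v p) - (interpolation y - v p) by (have := e0; lra).
rewrite !(@interpolationB p)// -sumrB; apply: le_trans (ler_norm_sum _ _ _) _.
rewrite [lip_const * _]mulrC -mulrA mulr_suml; apply: ler_sum => q _.
rewrite -mulrBr normrM distrC; apply: ler_wpM2l => //.
exact: (bump_quotient_lipschitz _ px py).
Qed.

Lemma interpolation_bound (s : seq N) x : uniq s -> (forall q, v q != 0 -> q \in s) ->
  `|interpolation x| <= \sum_(q <- s) `|v q| * \1_(ball (val q) rad) x.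
Proof.
move=> us vs; have t0 := total_bump_gt0 x; rewrite /interpolation (fsbig_support us);
  last first.
  by move=> q; rewrite mulf_eq0 negb_or => /andP[/vs].
rewrite mulr_suml; apply: le_trans (ler_norm_sum _ _ _) _.
apply: ler_sum => q _; rewrite -mulrA normrM; apply: ler_wpM2l => //.
have [->|qx] := eqVneq (bump q x) 0; first by rewrite mul0r normr0.
rewrite indicE mem_set ?ballEmdist/=; last by rewrite metric_sym; exact: bump_support.
by rewrite ger0_norm ?divr_ge0 ?bump_ge0 ?(ltW t0)// ler_pdivrMr// mul1r bump_le_total.
Qed.

Lemma interpolation_continuous : continuous interpolation.
Proof.
move=> x; apply/cvgrPdist_lt => e epos.
have [p px px'] := near_net x.
pose K := lip_const * variation_at p.
have K0 : 0 <= K by rewrite mulr_ge0 ?lip_const_ge0 ?variation_at_ge0.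
apply/nbhs_ballP; exists (Num.min (eps / 2) (e / (K + 1))).
  by rewrite /= lt_min !divr_gt0//; (have := e0; lra).
move=> y; rewrite ballEmdist /= lt_min => /andP[xy1 xy2].
have py : mdist (val p) y < rad.
  have := metric_triangle (val p) x y; (have := e0; lra).
apply: le_lt_trans (interpolation_lipschitz px' py) _; rewrite -/K.
move: xy2; rewrite ltr_pdivlMr; last (have := e0; lra).
by apply: le_lt_trans; rewrite mulrC; apply: ler_wpM2l; [exact: mdist_ge0|(have := e0;
  lra)].
Qed.

End Partition.

(** The Lipschitz estimate for the interpolation holds only near a common net point, that is, for
    short steps; the steps add up by additivity of the integral. *)
Lemma increments_local_to_global (R : realType) (f : R -> R) (G : R -> \bar R) (l d : R) :
  0 < d -> measurable_fun [set: R] G -> (forall x, 0 <= G x)%E ->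
  (forall s t : R, 0 <= s -> s <= t -> t <= l -> t - s <= d ->
     (`|f s - f t|%:E <= \int[lebesgue_measure]_(x in `[s, t]) G x)%E) ->
  forall s t : R, 0 <= s -> s <= t -> t <= l ->
     (`|f s - f t|%:E <= \int[lebesgue_measure]_(x in `[s, t]) G x)%E.
Proof.
move=> d0 mG G0 H s t s0 st tl.
have [k hk] : exists k : nat, t - s <= d * k%:R.
  exists (Num.truncn ((t - s) / d)).+1; rewrite mulrC -ler_pdivrMr//.
  exact/ltW/truncnS_gt.
elim: k t st tl hk => [|k IH] t st tl hk.
  by apply: H => //; apply: (le_trans hk); rewrite mulr0 ltW.
have [td|td] := leP (t - s) d; first exact: H.
have h1 : s <= t - d by lra.
have h2 : t - d <= t by lra.
rewrite (@ge0_integral_itv_split _ G s (t - d) t)//.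
apply: (@le_trans _ _ (`|f s - f (t - d)|%:E + `|f (t - d) - f t|%:E)%E).
  by rewrite -EFinD lee_fin ler_distD.
apply: leeD.
  by apply: IH => //; [lra|move: hk; rewrite -natr1; lra].
by apply: H => //; lra.
Qed.

(** * Borel functions and sums of indicators of balls *)

Section BorelFunctions.
Context {R : realType} {X : pmetricType R}.

Lemma continuous_borel (f : X -> R) : continuous f -> borel_fun (EFin \o f).
Proof.
move=> cf; apply/measurable_EFinP.
apply: (@measurability _ _ (g_sigma_algebraType (@open X)) R setT f (@RGenOInfty.G R)).
  exact: RGenOInfty.measurableE.
move=> _ [_ [a ->] <-]; rewrite setTI; apply: sub_sigma_algebra.
by apply: (continuousP f).1 => //; exact: rray_open.
Qed.

Lemma mdist_continuous (o : X) : continuous (mdist o : X -> R).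
Proof.
move=> x; apply/cvgrPdist_lt => e e0; apply/nbhs_ballP; exists e => // y.
rewrite ballEmdist/= => xy; apply: le_lt_trans xy.
have := metric_triangle o x y; have := metric_triangle o y x.
by rewrite (metric_sym y x) ler_norml => *; apply/andP; split; lra.
Qed.

Lemma control_borel (rho : R -> R) (o : X) : control_function rho ->
  borel_fun (fun x : X => (rho (mdist o x))%:E).
Proof.
move=> [_ mono _ _]; apply/measurable_EFinP.
(* [rho] is monotone on nonnegative reals only; clamped at zero, it is monotone on the line and
   hence measurable. *)
pose rho' t := rho (Num.max 0 t).
have -> : (fun x : X => rho (mdist o x)) = rho' \o mdist o.
  by apply/funext => x; rewrite /rho' /= max_r// mdist_ge0.
apply: (@measurableT_comp _ _ _ (g_sigma_algebraType (@open X)) R R rho').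
  apply: nondecreasing_measurable => // s t st; apply: mono.
    by rewrite le_max lexx.
  by rewrite ge_max !le_max lexx/= st orbT.
by have /measurable_EFinP := continuous_borel (@mdist_continuous o).
Qed.

End BorelFunctions.

Section BallSums.
Context {R : realType} {X : pmetricType R}.
Variable mu : {outer_measure set X -> \bar R}.
Hypothesis mu_borel : forall A, borel_set A -> mu.-caratheodory A.
Local Notation cmu := (cmeasure mu).
Variables (N : set X) (r : R).

Definition ball_sum (s : seq N) (a : N -> R) (x : X) : R :=
  \sum_(p <- s) a p * \1_(ball (val p) r) x.

Lemma ball_sum_ge0 s a x : (forall p, 0 <= a p) -> 0 <= ball_sum s a x.
Proof. by move=> a0; rewrite sumr_ge0// => p _; rewrite mulr_ge0. Qed.

Lemma ball_sum_borel s a : borel_fun (EFin \o ball_sum s a).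
Proof.
apply/measurable_EFinP; apply: measurable_sum => p.
apply: measurable_funM; first exact: measurable_cst.
apply: (@measurable_indic _ (g_sigma_algebraType (@open X))); exact: borel_ball.
Qed.

Lemma ball_sum_ge s a (p : N) x : (forall p, 0 <= a p) -> p \in s -> mdist (val p) x < r ->
  a p <= ball_sum s a x.
Proof.
move=> a0 ps px; rewrite /ball_sum (big_rem p)//= indicE mem_set ?ballEmdist//= mulr1.
by rewrite lerDl sumr_ge0// => q _; rewrite mulr_ge0.
Qed.

Lemma integral_ball_sum s a : (forall p, 0 <= a p) ->
  (\int[cmu]_x (ball_sum s a x)%:E = \sum_(p <- s) (a p)%:E * mu (ball (val p) r))%E.
Proof.
move=> a0; under eq_integral do rewrite -sumEFin.
rewrite ge0_integral_sum//; last 2 first.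
- move=> p; apply/measurable_EFinP; apply: measurable_funM; first exact: measurable_cst.
  by apply: measurable_indic; exact: measurable_ball.
- by move=> p x _; rewrite lee_fin mulr_ge0.
apply: eq_bigr => p _; under eq_integral do rewrite EFinM.
rewrite ge0_integralZl_EFin//.
- rewrite integral_indic//; last exact: measurable_ball.
  by rewrite setIT.
- by apply/measurable_EFinP; apply: measurable_indic; exact: measurable_ball.
Qed.

Lemma integrable_ball_sum s a : (forall p, 0 <= a p) ->
  (forall p : N, mu (ball (val p) r) < +oo)%E ->
  cmu.-integrable setT (EFin \o ball_sum s a).
Proof.
move=> a0 fin; apply/integrableP; split.
  by apply: borel_cmeasurable => //; exact: ball_sum_borel.
under eq_integral do rewrite /= ger0_norm ?ball_sum_ge0//.
rewrite integral_ball_sum//; apply: lte_sum_pinfty => p _.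
by rewrite lte_mul_pinfty ?lee_fin.
Qed.

Lemma integral_ball_sum_weight s a b (w : X -> R) (W : N -> R) :
  (forall p, 0 <= a p) -> (forall x, 0 <= w x) -> borel_fun (EFin \o w) ->
  0 <= b -> (forall p : N, mu (ball (val p) r) <= b%:E)%E ->
  (forall (p : N) x, mdist (val p) x < r -> w x <= W p) ->
  (\int[cmu]_x ((ball_sum s a x)%:E * (w x)%:E) <= (\sum_(p <- s) a p * Num.max 0 (W p) *
    b)%:E)%E.
Proof.
move=> a0 w0 mw b0 hb hW; pose a' p := a p * Num.max 0 (W p).
have a'0 p : 0 <= a' p by rewrite mulr_ge0// le_max lexx.
apply: (@le_trans _ _ (\int[cmu]_x (ball_sum s a' x)%:E)%E).
  apply: ge0_le_integral => //.
  - by move=> x _; rewrite -EFinM lee_fin mulr_ge0// ball_sum_ge0.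
  - apply: emeasurable_funM; apply: borel_cmeasurable => //; exact: ball_sum_borel.
  - by apply: borel_cmeasurable => //; exact: ball_sum_borel.
  - move=> x _; rewrite -EFinM lee_fin /ball_sum mulr_suml; apply: ler_sum => p _.
    rewrite /a' -mulrA -[leRHS]mulrA; apply: ler_wpM2l => //.
    rewrite indicE; case: (boolP (x \in _)) => [/set_mem|_]; last by rewrite mul0r mulr0.
    rewrite ballEmdist/= => px; rewrite mul1r mulr1 le_max; apply/orP; right.
    exact: hW.
rewrite integral_ball_sum// -sumEFin; apply: lee_sum => p _.
by rewrite -/(a' p) [leRHS]EFinM; apply: lee_wpmul2l => //; rewrite lee_fin.
Qed.

End BallSums.

Lemma upper_gradient_weak (R : realType) (X : pmetricType R)
    (mu : {outer_measure set X -> \bar R}) (u g : X -> \bar R) :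
  (forall A, borel_set A -> mu.-caratheodory A) ->
  upper_gradient u g -> weak_upper_gradient mu u g.
Proof.
move=> mB [mg g0 H]; split => //; exists set0; split; last by move=> c hc _; exact: H.
apply/null_familyP => // e e0; exists (cst 0%E); last by rewrite integral0 lee_fin ltW.
by split => //; exact: measurable_cst.
Qed.

Lemma finite_enum (T : choiceType) (A : set T) : finite_set A ->
  exists2 s : seq T, uniq s & forall x, (x \in s) <-> A x.
Proof.
move=> fA; exists (enum_fset (fset_set A)); first exact: fset_uniq.
by move=> x; rewrite in_fset_set//; split => [/set_mem|/mem_set].
Qed.

Section InterpolationGradient.
Context {R : realType} {X : pmetricType R}.
Variables (N : set X) (eps : R) (n0 : nat) (Q : N -> seq N).
Hypothesis e0 : 0 < eps.
Hypothesis N_dense : forall x : X, exists p : N, mdist x (val p) < eps.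
Hypothesis Q_uniq : forall p, uniq (Q p).
Hypothesis Q_mem : forall p q, (q \in Q p) = (mdist (val p) (val q) < 3 * eps).
Hypothesis Q_size : forall p, (size (Q p) <= n0)%N.
Variables (v : N -> R) (s : seq N).
Hypothesis s_mem : forall p, variation_at Q v p != 0 -> p \in s.
Local Notation rad := (3 / 2 * eps).

(** A sum over balls rather than a maximum, so that its weighted integral becomes a sum over net
    points. *)
Definition gradient_bound (x : X) : R :=
  ball_sum rad s (fun p => lip_const eps n0 * variation_at Q v p) x.

Let a0 p : 0 <= lip_const eps n0 * variation_at Q v p.
Proof. by rewrite mulr_ge0 ?variation_at_ge0// lip_const_ge0. Qed.

Lemma gradient_bound_ge (p : N) x : mdist (val p) x < rad ->
  lip_const eps n0 * variation_at Q v p <= gradient_bound x.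
Proof.
move=> px; have [E|/s_mem ps] := eqVneq (variation_at Q v p) 0.
  by rewrite E mulr0 ball_sum_ge0.
exact: (@ball_sum_ge _ _ _ _ _ (fun p => lip_const eps n0 * variation_at Q v p)).
Qed.

Lemma interpolation_upper_gradient :
  upper_gradient (EFin \o interpolation eps v) (EFin \o gradient_bound).
Proof.
have mh : borel_fun (EFin \o gradient_bound) by exact: ball_sum_borel.
have h0 x : (0 <= (EFin \o gradient_bound) x)%E by rewrite lee_fin ball_sum_ge0.
split => // c /andP[c0 rc]; rewrite /upper_gradient_along /=.
have mg := measurable_arc_path mh rc.
have l0 := len_ge0 c.
(* A subarc of length at most [eps / 4] that starts within [eps] of a net point stays within
   [5 / 4 * eps] of it, inside the radius of the local estimate. *)
have e4 : 0 < eps / 4 by have := e0; lra.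
have /(_ _ 0 (len c) (lexx _) l0 (lexx _)) := @increments_local_to_global R
  (interpolation eps v \o arc_path c) (fun s => (gradient_bound (arc_path c s))%:E)
  (len c) (eps / 4) e4 mg (fun x => h0 _).
rewrite line_integralE//= !arc_pathE ?lexx ?l0// arc_param0// arc_param_len//.
apply=> {l0} t1 t2 t10 t12 t2l td.
have [p zp] := N_dense (arc_path c t1).
have near t : t1 <= t -> t <= t2 -> mdist (val p) (arc_path c t) < rad.
  move=> h1 h2; have := metric_triangle (val p) (arc_path c t1) (arc_path c t).
  have := arc_path_lipschitz t1 t rc; rewrite ler0_norm; last lra.
  rewrite metric_sym in zp; have := e0; lra.
have nt1 := near t1 (lexx _) t12; have nt2 := near t2 t12 (lexx _).
pose k := lip_const eps n0 * variation_at Q v p.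
apply: (@le_trans _ _ (k * (t2 - t1))%:E).
  rewrite lee_fin; apply: le_trans (interpolation_lipschitz e0 N_dense Q_uniq Q_mem
    Q_size v nt1 nt2) _.
  apply: ler_wpM2l; first exact: a0.
  by have := arc_path_lipschitz t1 t2 rc; rewrite ler0_norm; lra.
apply: (@le_trans _ _ (\int[lebesgue_measure]_(x in `[t1, t2]) (cst k%:E x))%E).
  rewrite integral_cst// EFinM; apply: lee_wpmul2l; first by rewrite lee_fin; exact: a0.
  rewrite -[leRHS]/(lebesgue_measure [set` `[t1, t2]]) lebesgue_measure_itv/= lte_fin
    -EFinB; case: ltP => // h.
  by rewrite lee_fin subr_le0.
apply: ge0_le_integral => //.
- by move=> x _; rewrite lee_fin; exact: a0.
- exact: measurable_funS mg.
- move=> x /=; rewrite in_itv/= => /andP[h1 h2].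
  by rewrite lee_fin; apply: gradient_bound_ge; exact: near.
Qed.

End InterpolationGradient.

(** * From the Sobolev inequality to the net *)

Section SobolevToDiscrete.
Context {R : realType} {X : pmetricType R}.
Variable mu : {outer_measure set X -> \bar R}.
Local Notation cmu := (cmeasure mu).

Lemma sobolev_discrete (eps : R) (N : set X) (o : X) (rho : R -> R) :
  (forall A, borel_set A -> mu.-caratheodory A) ->
  uniform_space mu -> 0 < eps -> maximal_net N eps -> control_function rho ->
  sobolev11 mu rho ->
  exists C2 : R, 0 < C2 /\ forall v : N -> R, finite_set [set p | v p != 0] ->
    (\esum_(p in [set: N]) `|v p|%:E <= C2%:E *
       \esum_(p in [set: N]) \esum_(q in net_neighbours eps p)
         (`|v p - v q| * rho (edge_norm o (val p) (val q)))%:E)%E.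
Proof.
move=> mB hunif e0 hN hrho [C [z0 [C0 sob]]].
have [n hn] := net_uniformly_locally_finite mB hunif e0 hN.
have [f [g [fg0 _ fgmu]]] := hunif.
have cardN := lattice_ball_card hn.
have e3 : 0 < 3 * eps by lra.
have finN (p : X) r : 0 < r -> finite_set [set q : N | mdist p (val q) < r].
  by move=> r0; apply/finite_set_leP; exists (n r); exact: cardN.
have N_dense x : exists p : N, mdist x (val p) < eps.
  by have [y Ny xy] := hN.1 x; exists (SigSub (mem_set Ny)).
pose Q (p : N) := enum_fset (fset_set [set q : N | mdist (val p) (val q) < 3 * eps]).
have Q_uniq p : uniq (Q p) by exact: fset_uniq.
have Q_mem p q : (q \in Q p) = (mdist (val p) (val q) < 3 * eps).
  rewrite in_fset_set; last exact: finN.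
  by apply/idP/idP => [/set_mem|/mem_set].
pose n0 := n (3 * eps).
have Q_size p : (size (Q p) <= n0)%N by apply: geq_card_fset_set; exact: cardN.
pose rad := 3 / 2 * eps.
have rad0 : 0 < rad by rewrite /rad; lra.
(* Two radii occur: the balls of radius [eps / 2] are disjoint and recover [|v p|] from [u], those
   of radius [rad] carry the gradient. *)
have e20 : 0 < eps / 2 by lra.
have [f0 g0] := fg0 _ e20; have [_ gr0] := fg0 _ rad0.
set f2 := f (eps / 2) in f0; set g2 := g (eps / 2) in g0; set gr := g rad in gr0.
have muf (p : N) : (f2%:E <= mu (ball (val p) (eps / 2)))%E by have /andP[] := fgmu (val
  p) _ e20.
have mug (p : N) : (mu (ball (val p) (eps / 2)) <= g2%:E)%E by have /andP[] := fgmu (val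
  p) _ e20.
have mur (p : N) : (mu (ball (val p) rad) <= gr%:E)%E by have /andP[] := fgmu (val p) _
  rad0.
have mur_fin (p : N) : (mu (ball (val p) rad) < +oo)%E by rewrite (le_lt_trans (mur p))
  ?ltry.
(* The weight moves from the base point [z0] of the Sobolev inequality to [o], and from a point of a
   ball to its centre. *)
have a0 : 0 <= mdist o z0 + rad by rewrite addr_ge0 ?mdist_ge0// ltW.
have [L L0 hL] := control_shift hrho a0.
pose K := lip_const eps n0.
have K0 : 0 <= K by exact: lip_const_ge0.
(* [f2] is the least measure of a ball on which [|v p|] is recovered, [C * (K * L * gr)] comes from
   the Sobolev inequality for [u], and [g2] from the error [D p] between [u] and [v p]. *)
pose C2 := f2^-1 * (C * (K * L * gr) + g2).
have KLg : 0 <= K * L * gr := mulr_ge0 (mulr_ge0 K0 (ltW L0)) (ltW gr0).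
have Cpos : 0 <= C * (K * L * gr) := mulr_ge0 (ltW C0) KLg.
exists C2; split; first by rewrite mulr_gt0 ?invr_gt0//; lra.
move=> v fv; have [sv usv sv_mem] := finite_enum fv.
pose D p := variation_at Q v p.
have D0 p : 0 <= D p by exact: variation_at_ge0.
pose E := (\esum_(p in [set: N]) \esum_(q in net_neighbours eps p)
         (`|v p - v q| * rho (edge_norm o (val p) (val q)))%:E)%E.
have rho1 := control_ge1 hrho.
have en0 p q : 0 <= edge_norm o p q by rewrite le_max mdist_ge0.
have D_le p : ((D p * rho (mdist o (val p)))%:E <= \esum_(q in net_neighbours eps p)
         (`|v p - v q| * rho (edge_norm o (val p) (val q)))%:E)%E.
  pose s := [seq q <- Q p | q != p].
  apply: (@le_trans _ _ (\sum_(q <- s) (`|v p - v q| * rho (edge_norm o (val p) (val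
    q)))%:E)%E).
    rewrite sumEFin lee_fin /D /variation_at mulr_suml (bigID (fun q => q == p))/=.
    rewrite big1 ?add0r; last by move=> q /eqP ->; rewrite subrr normr0 mul0r.
    rewrite big_filter; apply: ler_sum => q _; apply: ler_wpM2l => //.
    by have [_ mono _ _] := hrho; apply: mono; rewrite ?mdist_ge0// le_max lexx.
  apply: esum_ge_seq => [|q]; first exact: filter_uniq.
  rewrite mem_filter Q_mem => /andP[qp pq];
    rewrite /net_neighbours/= mdist_gt0 (ltW pq) andbT.
  by apply: contraNN qp => /eqP/val_inj ->.
have fD : finite_set [set p | D p != 0].
  apply: (@sub_finite_set _ _ (\bigcup_(q in [set q | v q != 0])
     [set p : N | mdist (val q) (val p) < 3 * eps])); last first.
    by apply: bigcup_finite => // q _; exact: finN.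
  move=> p /=; apply: contra_neqP => nex; rewrite /D /variation_at big_seq big1// => q qQ.
  have vz r : mdist (val p) (val r) < 3 * eps -> v r = 0.
    move=> pr; apply/eqP; apply: contra_notT nex => vr; exists r => //=.
    by rewrite metric_sym.
  rewrite !vz ?subrr ?normr0 ?mdistxx//; by rewrite -Q_mem.
have [sD usD sD_mem] := finite_enum fD.
have s_mem p : variation_at Q v p != 0 -> p \in sD by move=> /(sD_mem p).2.
pose u := interpolation eps v.
pose h := gradient_bound eps n0 Q v sD.
have ug : upper_gradient (EFin \o u) (EFin \o h).
  exact: (interpolation_upper_gradient e0 N_dense Q_uniq Q_mem Q_size s_mem).
have KD0 p : 0 <= K * D p by rewrite mulr_ge0.
have ih : cmu.-integrable setT (EFin \o h) by exact: integrable_ball_sum.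
have mu_u : borel_fun (EFin \o u).
  exact: continuous_borel (interpolation_continuous e0 N_dense Q_uniq Q_mem Q_size (v :=
    v)).
have iu : cmu.-integrable setT (EFin \o u).
  apply: le_integrable (integrable_ball_sum mB sv (fun p => normr_ge0 (v p)) mur_fin) => //.
    exact: borel_cmeasurable.
  move=> x _; rewrite /= lee_fin [leRHS]ger0_norm ?ball_sum_ge0//.
  apply: (interpolation_bound e0 N_dense Q_uniq Q_mem) => // q vq; exact/sv_mem.
have bu : bounded_support (EFin \o u).
  pose M := \sum_(q <- sv) mdist o (val q) + rad.
  exists o, (M + 1); pose A := [set y : X | mdist o y <= M].
  have cA : closed A.
    apply: (@preimage_closed _ _ (mdist o) [set t | t <= M]); last exact: closed_le.
    by move=> y _; exact: mdist_continuous.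
  apply: (@subset_trans _ A); last by move=> y; rewrite /A ballEmdist/= => yM;
    apply: le_lt_trans yM _; rewrite ltrDl.
  rewrite ((closure_id A).1 cA); apply: closure_subset => y /=; rewrite eqe => uy.
  have [q qsv qy] : exists2 q, q \in sv & mdist (val q) y < rad.
    apply: contrapT => nex; move: uy; apply/negP; rewrite negbK -normr_le0.
    apply: (le_trans (interpolation_bound e0 N_dense Q_uniq Q_mem y usv _)).
      by move=> q vq; exact/sv_mem.
    rewrite big_seq big1// => q qsv; rewrite indicE memNset ?mulr0//.
    by rewrite ballEmdist/= => qy; apply: nex; exists q.
  rewrite /A/= /M (big_rem q)//=.
  have : 0 <= \sum_(y0 <- rem q sv) mdist o (val y0) by rewrite sumr_ge0// => z _;
    exact: mdist_ge0.
  by have := metric_triangle o (val q) y; clear -qy; lra.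
have [G mG] : exists G, minimal_weak_upper_gradient mu (EFin \o u) G.
  apply: (minimal_weak_upper_gradient_exists mB (h := EFin \o h)); split => //.
  exact: upper_gradient_weak.
have nu : newton11 mu (EFin \o u) by split => //; exists (EFin \o h).
have S1 := sob _ _ nu bu mG.
have [[mGb G0 _] iG Gmin] := mG.
(* [S1] involves the minimal gradient [G]; its minimality allows the explicit [h] in its place. *)
have Gh := Gmin _ (upper_gradient_weak mB ug) ih.
pose w (x : X) := rho (mdist z0 x).
have mw : borel_fun (EFin \o w) by exact: control_borel.
have w0 x : 0 <= w x by rewrite (le_trans ler01)// rho1// mdist_ge0.
have S2 : (\int[cmu]_x (G x * (w x)%:E) <= \int[cmu]_x ((h x)%:E * (w x)%:E))%E.
  apply: ae_ge0_le_integral => //.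
  - by move=> x _; rewrite mule_ge0// lee_fin.
  - by apply: emeasurable_funM; exact: borel_cmeasurable.
  - by move=> x _; rewrite -EFinM lee_fin mulr_ge0// ball_sum_ge0.
  - by apply: emeasurable_funM; apply: borel_cmeasurable => //; exact: ball_sum_borel.
  - by move: Gh; apply: (@filterS _ _ (ae_filter_ringOfSetsType cmu)) => x Ghx _;
    apply: lee_wpmul2r => //; rewrite lee_fin.
pose W (p : N) := L * rho (mdist o (val p)).
have W0 p : 0 <= W p by rewrite mulr_ge0 ?(ltW L0)// (le_trans ler01)// rho1// mdist_ge0.
have S3 := @integral_ball_sum_weight _ _ mu mB N rad sD (fun p => K * D p) gr w W
  KD0 w0 mw (ltW gr0) mur.
have {S3}S3 : (\int[cmu]_x ((h x)%:E * (w x)%:E) <= (K * L * gr)%:E * E)%E.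
  apply: (@le_trans _ _ ((\sum_(p <- sD) K * D p * Num.max 0 (W p) * gr)%:E)).
    apply: S3 => p x px; rewrite /W /w.
    have := hL _ (mdist z0 x) (mdist_ge0 o (val p)); rewrite (max_r (mdist_ge0 _ _)); apply.
    have := metric_triangle z0 o x; have := metric_triangle o (val p) x.
    by rewrite (metric_sym z0 o); clear -px; lra.
  rewrite -sumEFin; apply: (@le_trans _ _ (\sum_(p <- sD) (K * L * gr)%:E * (D p * rho
    (mdist o (val p)))%:E)%E).
    by apply: lee_sum => p _; rewrite max_r// -EFinM lee_fin /W; clear; lra.
  rewrite -ge0_sume_distrr; last first.
    by move=> p _; rewrite lee_fin mulr_ge0// (le_trans ler01)// rho1// mdist_ge0.
  apply: lee_wpmul2l; first by rewrite lee_fin.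
  apply: (@le_trans _ _ (\sum_(p <- sD) \esum_(q in net_neighbours eps p)
         (`|v p - v q| * rho (edge_norm o (val p) (val q)))%:E)%E).
    by apply: lee_sum => p _; exact: D_le.
  exact: esum_ge_seq.
have S4 : (\int[cmu]_x `|(EFin \o u) x| <= (C * (K * L * gr))%:E * E)%E.
  apply: (le_trans S1); rewrite EFinM -muleA; apply: lee_wpmul2l;
    first by rewrite lee_fin ltW.
  exact: le_trans S2 S3.
(* On the ball of radius [eps / 2] about [p], [|v p|] is at most [|u|] plus [D p]; these balls are
   disjoint, so the integrals add up. *)
have main (s : seq N) : uniq s ->
    (f2%:E * (\sum_(p <- s) `|v p|%:E) <= \int[cmu]_x `|(EFin \o u) x| + g2%:E * E)%E.
  move=> us; pose B (p : N) := ball (val p) (eps / 2) : set (caratheodory_type mu).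
  have mBp p : measurable (B p) by exact: measurable_ball.
  have near p x : B p x -> mdist (val p) x < rad.
    by rewrite /B ballEmdist/= /rad => px; apply: lt_trans px _; clear -e0; lra.
  have mabs : measurable_fun [set: caratheodory_type mu] (fun x => `|(EFin \o u) x|%E).
    by apply: measurableT_comp => //; exact: borel_cmeasurable.
  have step p : (f2%:E * `|v p|%:E <= \int[cmu]_(x in B p) `|(EFin \o u) x| + g2%:E * (D
    p)%:E)%E.
    apply: (@le_trans _ _ (\int[cmu]_(x in B p) (`|(EFin \o u) x| + (D p)%:E))%E).
      apply: (@le_trans _ _ (\int[cmu]_(x in B p) (cst `|v p|%:E x))%E).
        by rewrite integral_cst// muleC; apply: lee_wpmul2l; [rewrite lee_fin|exact: muf].
      apply: ge0_le_integral => //; first by move=> x _; rewrite /= lee_fin.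
      - by apply: emeasurable_funD => //; exact: measurable_funS mabs.
      - move=> x /near px; rewrite /= -EFinD lee_fin.
        have := interpolation_close e0 N_dense Q_uniq Q_mem v px; rewrite -/u -/(D p).
        by have := ler_normD (v p - u x) (u x); rewrite subrK (distrC (v p)); clear; lra.
    rewrite ge0_integralD//; [|exact: measurable_funS mabs|by move=> x _; rewrite lee_fin].
    apply: leeD2l; rewrite integral_cst// muleC; apply: lee_wpmul2r;
      first by rewrite lee_fin.
    exact: mug.
  rewrite ge0_sume_distrr; last by move=> p _; rewrite lee_fin.
  apply: (@le_trans _ _ (\sum_(p <- s) (\int[cmu]_(x in B p) `|(EFin \o u) x| + g2%:E *
    (D p)%:E))%E).
    by apply: lee_sum => p _; exact: step.
  rewrite big_split/=; apply: leeD.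
    rewrite -ge0_integral_bigsetU//.
    - by apply: ge0_subset_integral => //; exact: bigsetU_measurable.
    - apply/trivIsetP => p q _ _ pq; apply/seteqP; split => // x [].
      rewrite /B !ballEmdist/= => px qx.
      have := hN.2 (val p) (val q) (set_valP p) (set_valP q) _.
      have := metric_triangle (val p) x (val q); rewrite (metric_sym x) => h1 h2.
      have : eps <= mdist (val p) (val q) by apply: h2 => /val_inj E'; move: pq;
        rewrite E' eqxx.
      by clear -h1 px qx; lra.
    - exact: measurable_funS mabs.
  rewrite -ge0_sume_distrr; last by move=> p _; rewrite lee_fin.
  apply: lee_wpmul2l; first by rewrite lee_fin ltW.
  apply: (@le_trans _ _ (\sum_(p <- s) \esum_(q in net_neighbours eps p)
         (`|v p - v q| * rho (edge_norm o (val p) (val q)))%:E)%E); last exact: esum_ge_seq.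
  apply: lee_sum => p _; apply: le_trans (D_le p); rewrite lee_fin ler_peMr//.
  by apply: rho1; exact: mdist_ge0.
have E0 : (0 <= E)%E.
  apply: esum_ge0 => p _; apply: esum_ge0 => q _; rewrite lee_fin mulr_ge0//.
  by rewrite (le_trans ler01)// rho1.
apply: esum_le_fsets => s us _; rewrite /C2 EFinM -muleA -[leLHS]mul1e.
rewrite -(mulVf (lt0r_neq0 f0)) EFinM -muleA; apply: lee_wpmul2l.
  by rewrite lee_fin invr_ge0 ltW.
apply: (le_trans (main s us)); rewrite EFinD ge0_muleDl ?lee_fin//; last exact: ltW.
exact: leeD2r.
Qed.

End SobolevToDiscrete.

(** * Consequences of the Poincaré inequality *)

Section FiniteRepresentative.
Context {R : realType} {X : pmetricType R}.
Variable mu : {outer_measure set X -> \bar R}.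
Hypothesis mu_borel : forall A, borel_set A -> mu.-caratheodory A.
Local Notation cmu := (cmeasure mu).
Local Open Scope ereal_scope.
Implicit Types (u g : X -> \bar R).

(* By the convention |oo - oo| = oo, the curves with an endpoint where u is infinite
   carry an infinite line integral of any upper gradient, hence have modulus zero; so
   making u finite there does not change its weak upper gradients. *)
Lemma weak_upper_gradient_congr u u' g (F : set (@curve R X)) : null_family mu F ->
  (forall c, 0 < clength c < +oo -> ~ F c ->
     u (c (cstart c)) = u' (c (cstart c)) /\ u (c (cend c)) = u' (c (cend c))) ->
  weak_upper_gradient mu u g -> weak_upper_gradient mu u' g.
Proof.
move=> F0 E [mg g0 [F' [F'0 H]]]; split => //; exists (F `|` F'); split.
  exact: null_familyU.
move=> c hc nF; have [e1 e2] := E c hc (fun h => nF (or_introl h)).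
rewrite /upper_gradient_along -e1 -e2; apply: H => // h; apply: nF; by right.
Qed.

Lemma fine_representative_endpoints u k : upper_gradient u k ->
  forall c, 0 < clength c < +oo -> ~ (line_integral k c = +oo) ->
  u (c (cstart c)) = (fine (u (c (cstart c))))%:E /\
  u (c (cend c)) = (fine (u (c (cend c))))%:E.
Proof.
move=> [mk k0 H] c hc nF; have := H c hc; rewrite /upper_gradient_along.
have : line_integral k c < +oo by rewrite ltey; apply/eqP.
case: (u (c (cstart c))) => [a| |]; case: (u (c (cend c))) => [b| |] //= h1 h2;
  by have := le_lt_trans h2 h1; rewrite ltxx.
Qed.

(** The exchange of [u] and its finite part is used in both directions: for [g] itself and,
    backwards, for every competitor. *)
Lemma fine_representative_minimal u g : newton11 mu u ->
  minimal_weak_upper_gradient mu u g ->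
  minimal_weak_upper_gradient mu (EFin \o (fine \o u)) g.
Proof.
move=> [_ [k uk ik]] [wg ig ming].
have [mk k0 _] := uk.
have N0 := null_family_infinite mu_borel mk k0 ik.
have E := fine_representative_endpoints uk.
split => //; first exact: (weak_upper_gradient_congr N0 E wg).
move=> h wh ih; apply: ming => //; apply: (weak_upper_gradient_congr N0 _ wh).
by move=> c hc nF; have [e1 e2] := E c hc nF; split.
Qed.

End FiniteRepresentative.

Section PoincareBalls.
Context {R : realType} {X : pmetricType R}.
Variable mu : {outer_measure set X -> \bar R}.
Hypothesis mu_borel : forall A, borel_set A -> mu.-caratheodory A.
Local Notation cmu := (cmeasure mu).
Variables (f g : R -> R).
Hypothesis f0 : forall r, 0 < r -> 0 < f r.
Hypothesis fg : forall (x : X) (r : R), 0 < r -> ((f r)%:E <= mu (ball x r) <= (g r)%:E)%E.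
Variables (RP CP tau : R).
Hypotheses (CP0 : 0 < CP) (tau1 : 1 <= tau).
Hypothesis poincare : forall (x : X) (r : R), 0 < r <= RP ->
  forall (u : X -> R) (G : X -> \bar R),
    cmu.-integrable (ball x (tau * r)) (EFin \o u) ->
    minimal_weak_upper_gradient mu (EFin \o u) G ->
    (average mu (ball x r) (fun y => `|(u y)%:E - average mu (ball x r) (EFin \o u)|)
     <= (CP * r)%:E * average mu (ball x (tau * r)) G)%E.
Variables (u : X -> R) (G : X -> \bar R).
Variable eps : R.
Hypotheses (eps0 : 0 < eps) (eps_RP : 4 * eps <= RP).
Hypothesis iu : cmu.-integrable setT (EFin \o u).
Hypothesis mG : minimal_weak_upper_gradient mu (EFin \o u) G.

Let G0 x : (0 <= G x)%E. Proof. by have [[]] := mG. Qed.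

Lemma mu_ball_fin (x : X) r : 0 < r ->
  exists2 M, mu (ball x r) = M%:E & f r <= M <= g r.
Proof.
move=> r0; have /andP[h1 h2] := fg x r0; exists (fine (mu (ball x r))).
  rewrite fineK// ge0_fin_numE; first exact: le_lt_trans h2 (ltry _).
  by apply: le_trans h1; rewrite lee_fin ltW// f0.
move: h1 h2; case: (mu (ball x r)) => // M.
by rewrite !lee_fin => -> ->.
Qed.

Let iuB (x : X) r : cmu.-integrable (ball x r) (EFin \o u).
Proof. by apply: integrableS iu => //; exact: measurable_ball. Qed.

Definition mean (x : X) (r : R) : R := fine (average mu (ball x r) (EFin \o u)).

Lemma meanE (x : X) r : average mu (ball x r) (EFin \o u) = (mean x r)%:E.
Proof.
rewrite /mean fineK// /average fin_numM//; apply: integrable_fin_num => //.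
exact: measurable_ball.
Qed.

Let absI (x : X) r (a : R) : (0 <= \int[cmu]_(y in ball x r) `|u y - a|%:E)%E.
Proof. by apply: integral_ge0 => y _; rewrite lee_fin. Qed.

Let mabs (x : X) r (a : R) : measurable_fun (ball x r : set (caratheodory_type mu))
  (fun y => `|u y - a|%:E).
Proof.
have /integrableP[/measurable_EFinP mu_u _] := iuB x r.
apply/measurable_EFinP; apply: measurableT_comp => //.
by apply: measurable_funB => //; exact: measurable_cst.
Qed.

Lemma poincare_ball (x : X) r : 0 < r <= RP ->
  (\int[cmu]_(y in ball x r) `|u y - mean x r|%:E <=
    (CP * r * g r / f (tau * r))%:E * \int[cmu]_(y in ball x (tau * r)) G y)%E.
Proof.
move=> rRP; have /andP[r0 _] := rRP.
have := poincare rRP (iuB x _) mG; rewrite meanE /average.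
have tr0 : 0 < tau * r by rewrite mulr_gt0//; have := tau1; lra.
have [M ME /andP[M1 M2]] := mu_ball_fin x r0;
  have [M' ME' /andP[M'1 M'2]] := mu_ball_fin x tr0.
have fr := f0 r0; have ftr := f0 tr0.
have Mp : 0 < M by exact: lt_le_trans M1.
have M'p : 0 < M' by exact: lt_le_trans M'1.
rewrite ME ME' /= => H.
have I0 := absI x r (mean x r).
have I'0 : (0 <= \int[cmu]_(y in ball x (tau * r)) G y)%E by exact: integral_ge0.
rewrite -[leLHS]mul1e -(mulfV (lt0r_neq0 Mp)) EFinM -muleA.
apply: (le_trans (lee_wpmul2l _ H)); first by rewrite lee_fin ltW.
rewrite !muleA -!EFinM; apply: lee_wpmul2r => //; rewrite lee_fin.
have -> : M * (CP * r) / M' = CP * r * (M / M') by ring.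
have -> : CP * r * g r / f (tau * r) = CP * r * (g r / f (tau * r)) by ring.
apply: ler_wpM2l; first by rewrite mulr_ge0 ?(ltW r0)// ltW.
apply: ler_pM => //; [exact: ltW|by rewrite invr_ge0 ltW|].
by rewrite lef_pV2 ?posrE.
Qed.

Lemma mean_close (z x : X) r (e a : R) : 0 < e -> ball z e `<=` ball x r ->
  (`|mean z e - a|%:E <= (f e)^-1%:E * \int[cmu]_(y in ball x r) `|u y - a|%:E)%E.
Proof.
move=> e0 sub; have [M ME /andP[M1 _]] := mu_ball_fin z e0.
have fe := f0 e0; have Mp : 0 < M by exact: lt_le_trans M1.
have mB := measurable_ball mu_borel z e.
have muM : cmu (ball z e) = M%:E by exact: ME.
have ia : cmu.-integrable (ball z e) (cst a%:E).
  apply/integrableP; split; first exact: measurable_cst.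
  have -> : (fun y : X => `|cst a%:E y|%E) = cst `|a|%:E by [].
  by rewrite integral_cst// muM -EFinM ltry.
have fu : (\int[cmu]_(y in ball z e) (EFin \o u) y)%E \is a fin_num.
  by apply: integrable_fin_num.
apply: (@le_trans _ _ (M^-1%:E * \int[cmu]_(y in ball z e) `|u y - a|%:E)%E).
  have -> : `|mean z e - a|%:E =
      (M^-1%:E * `|\int[cmu]_(y in ball z e) ((EFin \o u) y - cst a%:E y)|)%E.
    have -> : `|mean z e - a|%:E = `|(mean z e - a)%:E|%E by [].
    rewrite integralB// integral_cst// EFinB -meanE /average ME /= muM.
    rewrite -[M^-1%:E in RHS]gee0_abs ?lee_fin ?invr_ge0 ?(ltW Mp)// -abseM.
    rewrite -(fineK fu); set I := fine _; move: I => I;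
      rewrite EFinN -[LHS]/(`|M^-1%:E * I%:E - a%:E|%E) -!EFinM -!EFinB -?EFinM;
        congr (`|_%:E|%E).
    by field; rewrite gt_eqF.
  apply: lee_wpmul2l; first by rewrite lee_fin invr_ge0 ltW.
  apply: (le_trans (le_abse_integral _ _ _)) => //.
    by have /integrableP[] := integrableB mB (iuB z e) ia.
apply: lee_pmul.
- by rewrite lee_fin invr_ge0 ltW.
- exact: absI.
- by rewrite lee_fin lef_pV2 ?posrE.
- apply: ge0_subset_integral => //; first exact: measurable_ball.
Qed.

(** The factor in [poincare_ball] at radius [4 * eps]. In [mean_step], the means at both points are
    compared with the mean over this one larger ball. *)
Definition poincare_scale : R := CP * (4 * eps) * g (4 * eps) / f (tau * (4 * eps)).

Lemma poincare_scale_ge0 : 0 <= poincare_scale.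
Proof.
have e4 : 0 < 4 * eps by have := eps0; lra.
rewrite /poincare_scale; have fe := f0 e4.
have [M _ /andP[M1 M2]] := mu_ball_fin point e4.
have g4 : 0 <= g (4 * eps) by apply: le_trans (le_trans M1 M2); exact: ltW.
have ft : 0 < f (tau * (4 * eps)) by apply: f0; rewrite mulr_gt0//; have := tau1; lra.
by rewrite divr_ge0 ?(ltW ft)// mulr_ge0// mulr_ge0 ?(ltW CP0)//; lra.
Qed.

Definition energy (x : X) (r : R) : \bar R := (\int[cmu]_(y in ball x r) G y)%E.

Lemma mean_step (z z' : X) : mdist z z' <= 3 * eps ->
  (`|mean z eps - mean z' eps|%:E <=
    (2 * poincare_scale / f eps)%:E * energy z (tau * (4 * eps)))%E.
Proof.
move=> zz'; have e0 := eps0.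
have e4 : 0 < 4 * eps <= RP by apply/andP; split; [lra|exact: eps_RP].
have P := poincare_ball z e4; set a := mean z (4 * eps) in P.
have c1 : (`|mean z eps - a|%:E <= (f eps)^-1%:E * (poincare_scale%:E * energy z (tau *
  (4 * eps))))%E.
  apply: (le_trans (@mean_close z z (4 * eps) eps a e0 _)).
    by move=> y; rewrite !ballEmdist/=; lra.
  by apply: lee_wpmul2l => //; rewrite lee_fin invr_ge0 ltW// f0.
have c2 : (`|mean z' eps - a|%:E <= (f eps)^-1%:E * (poincare_scale%:E * energy z (tau *
  (4 * eps))))%E.
  apply: (le_trans (@mean_close z' z (4 * eps) eps a e0 _)).
    by move=> y; rewrite !ballEmdist/=; have := metric_triangle z z' y; lra.
  by apply: lee_wpmul2l => //; rewrite lee_fin invr_ge0 ltW// f0.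
apply: (@le_trans _ _ (`|mean z eps - a|%:E + `|mean z' eps - a|%:E)%E).
  by rewrite -EFinD lee_fin (distrC (mean z' eps)) ler_distD.
apply: (le_trans (leeD c1 c2)); rewrite muleA -EFinM.
have J0 : (0 <= energy z (tau * (4 * eps)))%E by exact: integral_ge0.
have s0 := poincare_scale_ge0.
have k0 : 0 <= (f eps)^-1 * poincare_scale by rewrite mulr_ge0// invr_ge0 ltW// f0.
rewrite -ge0_muleDl ?lee_fin// -EFinD; apply: lee_wpmul2r => //.
rewrite lee_fin; have -> : 2 * poincare_scale / f eps = 2 * ((f eps)^-1 * poincare_scale)
  by ring.
lra.
Qed.

Lemma energy_ge0 (x : X) r : (0 <= energy x r)%E.
Proof. exact: integral_ge0. Qed.

Lemma energy_subset (x y : X) r r' : ball x r `<=` ball y r' ->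
  (energy x r <= energy y r')%E.
Proof.
move=> sub; apply: ge0_subset_integral => //; try exact: measurable_ball.
have [_ iG _] := mG; have /integrableP[mGG _] := iG.
by apply: measurable_funS mGG.
Qed.

(** The mean [a] over the larger ball is intermediate: the Poincaré inequality controls [u - a], and
    [a] differs from [mean z eps] by one more energy term. *)
Lemma ball_integral_le (z : X) :
  (\int[cmu]_(y in ball z eps) `|u y|%:E <=
    (poincare_scale * (1 + g eps / f eps))%:E * energy z (tau * (4 * eps)) +
    (g eps)%:E * `|mean z eps|%:E)%E.
Proof.
have e0 := eps0; have fe := f0 e0; have s0 := poincare_scale_ge0.
have e4 : 0 < 4 * eps <= RP by apply/andP; split; [lra|exact: eps_RP].
have [M ME /andP[M1 M2]] := mu_ball_fin z e0.
have Mp : 0 < M by exact: lt_le_trans M1.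
have ge : 0 <= g eps by apply: le_trans M2; exact: ltW.
have P := poincare_ball z e4; set a := mean z (4 * eps) in P.
have sub : ball z eps `<=` ball z (4 * eps) by move=> y; rewrite !ballEmdist/=; lra.
have c1 := mean_close a e0 sub.
have J0 := energy_ge0 z (tau * (4 * eps)).
have mB := measurable_ball mu_borel z eps.
apply: (@le_trans _ _ (\int[cmu]_(y in ball z eps) (`|u y - a|%:E + cst `|a|%:E y))%E).
  apply: ge0_le_integral => //.
  - have /integrableP[/measurable_EFinP mu_u _] := iuB z eps.
    by apply/measurable_EFinP; exact: measurableT_comp.
  - by apply: emeasurable_funD => //; exact: mabs.
  - by move=> y _; rewrite /= -EFinD lee_fin -{1}(subrK a (u y)) ler_normD.
rewrite ge0_integralD//; last by move=> y _; rewrite /= lee_fin.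
have -> : (\int[cmu]_(y in ball z eps) cst `|a|%:E y)%E = (`|a| * M)%:E.
  by rewrite integral_cst// EFinM; congr (_ * _)%E; exact: ME.
have c2 : (\int[cmu]_(y in ball z eps) `|u y - a|%:E <=
    poincare_scale%:E * energy z (tau * (4 * eps)))%E.
  apply: le_trans P; apply: ge0_subset_integral => //; exact: measurable_ball.
have c3 : ((`|a| * M)%:E <= (g eps)%:E * (`|mean z eps|%:E +
    ((f eps)^-1 * poincare_scale)%:E * energy z (tau * (4 * eps))))%E.
  apply: (@le_trans _ _ ((g eps)%:E * (`|mean z eps|%:E + `|mean z eps - a|%:E))%E).
    rewrite -EFinD -EFinM lee_fin mulrC; apply: ler_pM => //; first exact: ltW.
    by have := ler_normB (mean z eps) (mean z eps - a); rewrite opprB addrC subrK.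
  apply: lee_wpmul2l; first by rewrite lee_fin.
  apply: leeD2l; apply: (le_trans c1); rewrite EFinM -muleA.
  by apply: lee_wpmul2l => //; rewrite lee_fin invr_ge0 ltW.
have k0 : 0 <= (f eps)^-1 * poincare_scale by rewrite mulr_ge0// invr_ge0 ltW.
have J1 : (0 <= ((f eps)^-1 * poincare_scale)%:E * energy z (tau * (4 * eps)))%E.
  by apply: mule_ge0 => //; rewrite lee_fin.
apply: (le_trans (leeD c2 c3)).
have -> : ((g eps)%:E * (`|mean z eps|%:E +
    ((f eps)^-1 * poincare_scale)%:E * energy z (tau * (4 * eps))) =
    (g eps)%:E * `|mean z eps|%:E +
    (g eps * ((f eps)^-1 * poincare_scale))%:E * energy z (tau * (4 * eps)))%E.
  by rewrite ge0_muleDr// muleA -EFinM.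
have -> : poincare_scale * (1 + g eps / f eps) = poincare_scale + g eps * ((f eps)^-1 *
  poincare_scale) by ring.
rewrite EFinD ge0_muleDl ?lee_fin//; last exact: mulr_ge0.
by rewrite -addeA leeD2l// addeC.
Qed.

(** The number of steps of length at most [3 * eps] covering a curve of length [k * P], times the
    cost of a step in [mean_step]. *)
Definition chain_const (k P : R) : R :=
  (Num.truncn (k * P / (3 * eps))).+1%:R * (2 * poincare_scale / f eps).

Lemma chain_const_ge0 (k P : R) : 0 <= chain_const k P.
Proof.
have fe := f0 eps0; rewrite mulr_ge0// divr_ge0 ?(ltW fe)// mulr_ge0//.
exact: poincare_scale_ge0.
Qed.

(** The curve is cut into equal pieces of arc length. It stays within [k * P] of [x], so the
    enlarged Poincaré balls along it all lie in one ball about [x]. *)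
Lemma mean_chain (k P : R) : 1 <= k -> 0 <= P ->
  (forall x y : X, exists c : @curve R X,
     [/\ c (cstart c) = x, c (cend c) = y, rectifiable c &
         (clength c <= (k * mdist x y)%:E)%E]) ->
  forall x y : X, mdist x y <= P ->
    (`|mean x eps - mean y eps|%:E <=
      (chain_const k P)%:E * energy x (k * P + tau * (4 * eps)))%E.
Proof.
move=> k1 P0 qc; have e0 := eps0; have s0 := poincare_scale_ge0; have fe := f0 e0.
pose n := (Num.truncn (k * P / (3 * eps))).+1.
have n0 : 0 < n%:R :> R by rewrite ltr0n.
have hn : k * P <= 3 * eps * n%:R.
  by rewrite [leRHS]mulrC -ler_pdivrMr; [exact/ltW/truncnS_gt|lra].
pose c1 := 2 * poincare_scale / f eps.
have c10 : 0 <= c1 by rewrite divr_ge0 ?(ltW fe)// mulr_ge0.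
move=> x y xy; have [c [cx cy rc lc]] := qc x y.
have lP : len c <= k * P.
  move: lc; rewrite lenE// lee_fin => /le_trans; apply.
  by apply: ler_wpM2l => //; lra.
have l0 := len_ge0 c.
pose d := len c / n%:R.
have d0 : 0 <= d by rewrite divr_ge0// ltW.
have d3 : d <= 3 * eps by rewrite /d ler_pdivrMr//; lra.
pose z i := arc_path c (i%:R * d).
have z0 : z 0%N = x by rewrite /z mul0r arc_pathE ?lexx ?l0// arc_param0.
have zn : z n = y.
  rewrite /z; have -> : n%:R * d = len c by rewrite /d mulrC divfK// gt_eqF.
  by rewrite arc_pathE ?lexx ?l0// arc_param_len.
have xz i : (i <= n)%N -> mdist x (z i) <= k * P.
  move=> iN; rewrite -z0; apply: (le_trans (arc_path_lipschitz _ _ rc)).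
  rewrite mul0r sub0r normrN ger0_norm ?mulr_ge0//; apply: le_trans lP.
  by rewrite /d mulrA ler_pdivrMr// mulrC ler_wpM2l// ler_nat.
have step i : mdist (z i) (z i.+1) <= 3 * eps.
  apply: (le_trans (arc_path_lipschitz _ _ rc)); apply: le_trans d3.
  by rewrite -natr1 mulrDl mul1r opprD addrA subrr sub0r normrN ger0_norm.
set E := energy x _.
have E0 : (0 <= E)%E by exact: energy_ge0.
have Ez i : (i <= n)%N -> (energy (z i) (tau * (4 * eps)) <= E)%E.
  move=> iN; apply: energy_subset => w; rewrite !ballEmdist/= => zw.
  by have := metric_triangle x (z i) w; have := xz i iN; lra.
have : forall i, (i <= n)%N ->
    (`|mean x eps - mean (z i) eps|%:E <= (i%:R * c1)%:E * E)%E.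
  elim=> [_|i IH iN]; first by rewrite z0 subrr normr0 !mul0r mul0e.
  apply: (@le_trans _ _ (`|mean x eps - mean (z i) eps|%:E +
      `|mean (z i) eps - mean (z i.+1) eps|%:E)%E).
    by rewrite -EFinD lee_fin ler_distD.
  rewrite -natr1 mulrDl mul1r EFinD ge0_muleDl ?lee_fin//; last by rewrite mulr_ge0.
  apply: leeD; first by apply: IH; exact: ltnW.
  apply: (le_trans (mean_step (step i))); apply: lee_wpmul2l; first by rewrite lee_fin.
  by apply: Ez; exact: ltnW.
by move=> /(_ n (leqnn n)); rewrite zn.
Qed.

End PoincareBalls.

Section Overlap.
Context {R : realType} {X : pmetricType R}.
Variable mu : {outer_measure set X -> \bar R}.
Hypothesis mu_borel : forall A, borel_set A -> mu.-caratheodory A.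
Local Notation cmu := (cmeasure mu).

Lemma sum_integral_patch (I : Type) (s : seq I) (B : I -> set X) (H : X -> \bar R) :
  (forall i, measurable (B i : set (caratheodory_type mu))) ->
  measurable_fun [set: caratheodory_type mu] H -> (forall x, 0 <= H x)%E ->
  (\sum_(i <- s) \int[cmu]_(x in B i) H x = \int[cmu]_x \sum_(i <- s) (H \_ (B i)) x)%E.
Proof.
move=> mB mH H0; rewrite ge0_integral_sum//.
- by apply: eq_bigr => i _; rewrite [LHS]integral_mkcond.
- move=> i; apply/(measurable_restrictT _ _).1 => //.
  exact: measurable_funS mH.
- by move=> i x _; apply: erestrict_ge0.
Qed.

Lemma overlap_bound (N : set X) (r : R) (n : nat) (H : X -> \bar R) :
  (forall x : X, ([set p : N | mdist x (val p) < r] #<= `I_n)%card) ->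
  measurable_fun [set: caratheodory_type mu] H -> (forall x, 0 <= H x)%E ->
  (\esum_(p in [set: N]) \int[cmu]_(x in ball (val p) r) H x <=
    n%:R%:E * \int[cmu]_x H x)%E.
Proof.
move=> cN mH H0; apply: esum_le_fsets => s us _.
rewrite (@sum_integral_patch _ s (fun p : N => ball (val p) r))//; last first.
  by move=> p; exact: measurable_ball.
rewrite -ge0_integralZl//; apply: ge0_le_integral => //.
- by move=> x _; apply: sume_ge0 => p _; exact: erestrict_ge0.
- apply: emeasurable_sum => p; apply/(measurable_restrictT _ _).1 => //.
    exact: measurable_ball.
  exact: measurable_funS mH.
- by apply: emeasurable_funM => //; exact: measurable_cst.
move=> x _; pose t := [seq p <- s | mdist (val p) x < r].
have -> : (\sum_(p <- s) (H \_ (ball (val p) r)) x = \sum_(p <- t) H x)%E.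
  rewrite [RHS]big_filter [RHS]big_mkcond/=; apply: eq_bigr => p _; rewrite /patch.
  suff -> : (x \in (ball (val p) r : set X)) = (mdist (val p) x < r) by [].
  by apply/idP/idP => [/set_mem|h]; [|apply/mem_set]; rewrite ballEmdist.
apply: (@le_trans _ _ ((size t)%:R%:E * H x)%E).
  by apply: sum_seq_le.
apply: lee_wpmul2r => //; rewrite lee_fin ler_nat.
apply: (card_le_seqP _ _).1 (cN x) _ _ _; first exact: filter_uniq.
by move=> p; rewrite mem_filter metric_sym => /andP[].
Qed.

End Overlap.

(** * From the net to the Sobolev inequality *)

Section DiscreteToSobolev.
Context {R : realType} {X : pmetricType R}.
Variable mu : {outer_measure set X -> \bar R}.
Local Notation cmu := (cmeasure mu).

Lemma discrete_sobolev (RP eps : R) (N : set X) (o : N) (rho : R -> R) (K P : R) :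
  (forall A, borel_set A -> mu.-caratheodory A) -> quasiconvex X ->
  uniform_space mu -> local_poincare11 mu RP -> 0 < eps -> 4 * eps <= RP ->
  maximal_net N eps -> control_function rho -> 0 <= K -> 0 <= P ->
  (forall v : N -> R, finite_set [set x | v x != 0] ->
     (\esum_(x in [set: N]) `|v x|%:E <= edge_sum rho o P K v)%E) ->
  sobolev11 mu rho.
Proof.
move=> mB [k [k1 qc]] hunif [RP0 [CP [tau [CP0 tau1 poin]]]] e0 eRP hN hrho K0 P0 ineq.
have [n hn] := net_uniformly_locally_finite mB hunif e0 hN.
have [f [g [fg0 _ fg]]] := hunif.
have f0 r : 0 < r -> 0 < f r by move=> /fg0[].
have cardN := lattice_ball_card hn.
have finN (p : X) r : 0 < r -> finite_set [set q : N | mdist p (val q) < r].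
  by move=> r0; apply/finite_set_leP; exists (n r); exact: cardN.
have N_dense x : exists p : N, mdist x (val p) < eps.
  by have [y Ny xy] := hN.1 x; exists (SigSub (mem_set Ny)).
have poincare x r : 0 < r <= RP -> forall (u : X -> R) (G : X -> \bar R),
    cmu.-integrable (ball x (tau * r)) (EFin \o u) ->
    minimal_weak_upper_gradient mu (EFin \o u) G ->
    (average mu (ball x r) (fun y => `|(u y)%:E - average mu (ball x r) (EFin \o u)|)
     <= (CP * r)%:E * average mu (ball x (tau * r)) G)%E.
  by move=> h; have [_] := poin x r h; exact.
pose r1 := k * P + tau * (4 * eps).
have t4 : 0 < tau * (4 * eps) by rewrite mulr_gt0//; lra.
have kP : 0 <= k * P by rewrite mulr_ge0//; lra.
have r10 : 0 < r1 by rewrite /r1; lra.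
have r1e : tau * (4 * eps) <= r1 by rewrite /r1; lra.
(* [L] compares the weights at the two ends of an edge, [L2] those at the centre and at a point of a
   ball of radius [r1]. *)
have [L L0 hL] := control_shift hrho P0.
have [L2 L20 hL2] := control_shift hrho (ltW r10).
have rho1 := control_ge1 hrho.
pose sc : R := CP * (4 * eps) * g (4 * eps) / f (tau * (4 * eps)).
pose a1 := sc * (1 + g eps / f eps).
pose m := n (P + 1); pose m1 := n r1.
have P1 : 0 < P + 1 by lra.
have ge0 : 0 < g eps by have [] := fg0 _ e0.
have g40 : 0 < g (4 * eps) by have [|//] := fg0 (4 * eps); rewrite mulr_gt0.
have ft0 := f0 _ t4; have fe0 := f0 _ e0.
have a10 : 0 <= a1.
  rewrite /a1 mulr_ge0//; first by rewrite divr_ge0 ?(ltW ft0)// !mulr_ge0 ?(ltW CP0)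
    ?(ltW g40)//; lra.
  by rewrite addr_ge0// divr_ge0// ltW.
pose Kc := chain_const f g CP tau eps k P.
have Kc0 : 0 <= Kc by exact: (chain_const_ge0 f0 fg CP0 tau1 e0).
(* At most [m] edges start at a given point; each costs the bound [K] of the inequality, the weight
   factor [L] and the chaining constant [Kc]. *)
pose c1 := m%:R * (K * L * Kc).
have c10 : 0 <= c1 by rewrite mulr_ge0// mulr_ge0// mulr_ge0// ltW.
pose C := (a1 + g eps * c1) * (L2 * m1%:R) + 1.
have C0 : 0 < C.
  have : 0 <= (a1 + g eps * c1) * (L2 * m1%:R).
    by rewrite mulr_ge0// ?addr_ge0// mulr_ge0// ltW.
  by rewrite /C; clear; lra.
exists C, (val o); split => // u G nu [x0 [r0 bs]] mG.
(* [u] may be infinite on a null set, whereas the Poincaré inequality concerns real functions; the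
   finite part has the same minimal gradients and the same integral of the absolute value. *)
pose ut : X -> R := fine \o u.
have iu : cmu.-integrable setT u by have [] := nu.
have mu_u : measurable_fun [set: caratheodory_type mu] u by have /integrableP[] := iu.
have mut : measurable_fun [set: caratheodory_type mu] (EFin \o ut).
  by apply/measurable_EFinP; apply: (@measurableT_comp _ _ _ _ _ _ (@fine R)) => //;
    exact: fine_measurable.
have iut : cmu.-integrable setT (EFin \o ut).
  apply: le_integrable iu => // x _; rewrite /ut /=.
  by case: (u x) => [a| |] //=; rewrite ?normr0 ?leey.
have mGt := fine_representative_minimal mB nu mG.
have [[mGb G0 _] iG _] := mG.
have mGc := borel_cmeasurable mB mGb.
have absE : (\int[cmu]_x `|u x| = \int[cmu]_x `|ut x|%:E)%E.
  apply: ge0_ae_eq_integral => //.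
  - exact: measurableT_comp.
  - by apply/measurable_EFinP; apply: measurableT_comp => //; apply/measurable_EFinP.
  - have := integrable_ae measurableT iu.
    apply: (@filterS _ _ (ae_filter_ringOfSetsType cmu)) => x /(_ Logic.I) ux _.
    by rewrite /ut /= -[in LHS](fineK ux).
pose v (p : N) := mean mu ut (val p) eps.
(* Net points whose [eps]-ball meets the support are within [r0 + eps] of [x0]; the maximum keeps
   the radius positive whatever the sign of [r0]. *)
pose r2 := Num.max r0 0 + eps.
have r20 : 0 < r2 by have : 0 <= Num.max r0 0 by [rewrite le_max lexx orbT]; rewrite /r2;
  clear -e0; lra.
have ut_supp y : ut y != 0 -> mdist x0 y < r0.
  move=> uy; have : ball x0 r0 y; last by rewrite ballEmdist.
  apply: bs; apply: subset_closure => /=; apply: contraNN uy => /eqP E.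
  by rewrite /ut /= E.
have [sA usA sA_mem] := finite_enum (finN x0 r2 r20).
have r0r2 : r0 + eps <= r2 by have : r0 <= Num.max r0 0 by [rewrite le_max lexx];
  rewrite /r2; clear; lra.
have v_supp p : v p != 0 -> p \in sA.
  move=> vp; apply/sA_mem => /=; apply: contraNT vp; rewrite -leNgt => far.
  rewrite /v /mean /average integral0_eq ?mule0// => y; rewrite ballEmdist/= => py.
  apply/eqP; rewrite eqe; apply/negPn/negP => /ut_supp x0y.
  by have := metric_triangle x0 y (val p); rewrite (metric_sym y);
    clear -r0r2 x0y py far; lra.
have fv : finite_set [set p | v p != 0].
  by apply: (@sub_finite_set _ _ [set` sA]) => [p /v_supp//|]; exact: finite_seq.
pose J (p : N) := energy mu G (val p) r1.
have J0 p : (0 <= J p)%E by exact: (energy_ge0 mGt).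
pose rp (p : N) := rho (mdist (val p) (val o)).
have rp1 p : 1 <= rp p by apply: rho1; exact: mdist_ge0.
have rp0 p : 0 <= rp p by rewrite (le_trans ler01).
pose S := (\esum_(p in [set: N]) (J p * (rp p)%:E))%E.
have JS0 p : (0 <= J p * (rp p)%:E)%E by rewrite mule_ge0// lee_fin.
(* The [eps]-balls about the points of [sA] cover the set where [ut] is nonzero. *)
have step1 : (\int[cmu]_x `|ut x|%:E <= \sum_(p <- sA) \int[cmu]_(x in ball (val p) eps)
  `|ut x|%:E)%E.
  have mabs : measurable_fun [set: caratheodory_type mu] (fun x => `|ut x|%:E).
    by apply/measurable_EFinP; apply: measurableT_comp => //; apply/measurable_EFinP.
  rewrite (sum_integral_patch sA (fun p => measurable_ball mB (val p) eps))//.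
  apply: ge0_le_integral => //.
  - apply: emeasurable_sum => p; apply/(measurable_restrictT _ _).1 => //.
      exact: measurable_ball.
    exact: measurable_funS mabs.
  move=> x _; have [->|ux] := eqVneq (ut x) 0.
    by rewrite normr0; apply: sume_ge0 => p _; apply: erestrict_ge0 => y _; rewrite lee_fin.
  have [p xp] := N_dense x.
  have psA : p \in sA.
    by apply/sA_mem => /=; have := metric_triangle x0 x (val p); have := ut_supp _ ux;
      clear -r0r2 xp; lra.
  rewrite (big_rem p)//= /patch mem_set; last by rewrite ballEmdist/= metric_sym.
  by rewrite leeDl//; apply: sume_ge0 => q _; case: ifP => // _; rewrite lee_fin.
have mean_bound (x y : X) : mdist x y <= P ->
    (`|mean mu ut x eps - mean mu ut y eps|%:E <= Kc%:E * energy mu G x r1)%E.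
  exact: (mean_chain mB f0 fg CP0 tau1 poincare e0 eRP iut mGt k1 P0 qc).
have local_bound (p : N) : (\int[cmu]_(x in ball (val p) eps) `|ut x|%:E <=
    a1%:E * (J p * (rp p)%:E) + (g eps)%:E * `|v p|%:E)%E.
  apply: (le_trans (ball_integral_le mB f0 fg CP0 tau1 poincare e0 eRP iut mGt (val p))).
  apply: leeD2r; apply: lee_wpmul2l; first by rewrite lee_fin.
  apply: (@le_trans _ _ (J p)).
    by apply: (energy_subset mB mGt) => y; rewrite !ballEmdist/=; clear -r1e; lra.
  by rewrite -[leLHS]mule1; apply: lee_wpmul2l => //; rewrite lee_fin.
(* The energy around [x] bounds all edges at [x] at once, so the inner sum costs only the count
   [m]. *)
have edge_bound : (edge_sum rho o P K v <= c1%:E * S)%E.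
  rewrite /S -esumZl//; apply: le_esum => x _.
  have -> : (c1%:E * (J x * (rp x)%:E) =
     m%:R%:E * ((K * L * Kc)%:E * (J x * (rp x)%:E)))%E by rewrite /c1 [(m%:R *
       _)%:E]EFinM -muleA.
  have KLK0 : 0 <= K * L * Kc by rewrite mulr_ge0// mulr_ge0// ltW.
  apply: esum_card_le.
  - apply: card_le_trans (cardN (val x) (P + 1) P1); apply: subset_card_le => y /=.
    by move=> h; apply: (le_lt_trans h); rewrite ltrDl.
  - by rewrite mule_ge0// lee_fin.
  move=> y /= xy; have vb := mean_bound _ _ xy; rewrite -/(v x) -/(v y) -/(J x) in vb.
  have W : edge_weight rho o x y <= L * rp x.
    have := hL (mdist (val x) (val o)) (Num.max (vertex_norm o x) (vertex_norm o y))
      (mdist_ge0 _ _).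
    have vm0 : 0 <= Num.max (vertex_norm o x) (vertex_norm o y) by rewrite le_max mdist_ge0.
    rewrite (max_r vm0).
    apply; rewrite ge_max /vertex_norm; apply/andP; split; first by rewrite lerDl.
    by have := metric_triangle (val y) (val x) (val o);
      rewrite (metric_sym (val y) (val x)); clear -xy; lra.
  apply: (@le_trans _ _ ((K * L * rp x)%:E * `|v x - v y|%:E)%E).
    rewrite -EFinM lee_fin -mulrA -[leRHS]mulrA; apply: ler_wpM2l => //.
    by rewrite mulrC; apply: ler_wpM2r.
  apply: (le_trans (lee_wpmul2l _ vb)).
    by rewrite lee_fin mulr_ge0// mulr_ge0// ltW.
  rewrite muleA -EFinM [(J x * _)%E]muleC muleA -EFinM.
  by rewrite (_ : K * L * rp x * Kc = K * L * Kc * rp x)//; ring.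
pose H x := (G x * (rho (mdist (val o) x))%:E)%E.
have w0 x : 0 <= rho (mdist (val o) x) by rewrite (le_trans ler01)// rho1// mdist_ge0.
have H0 x : (0 <= H x)%E by rewrite mule_ge0// lee_fin.
have mH : measurable_fun [set: caratheodory_type mu] H.
  by apply: emeasurable_funM => //; apply: borel_cmeasurable => //; exact: control_borel.
(* The weight at the centre moves under the integral at the price [L2]; all balls then carry the
   same integrand and bounded overlap applies. *)
have JH p : (J p * (rp p)%:E <= L2%:E * \int[cmu]_(x in ball (val p) r1) H x)%E.
  have mBp := measurable_ball mB (val p) r1.
  rewrite muleC /J /energy -!ge0_integralZl//; last 4 first.
  - exact: measurable_funS mH.
  - by rewrite lee_fin ltW.
  - exact: measurable_funS mGc.
  - by rewrite lee_fin.
  apply: ge0_le_integral => //.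
  - by move=> x _; rewrite mule_ge0// lee_fin.
  - by apply: emeasurable_funM; [exact: measurable_cst|exact: measurable_funS mGc].
  - by apply: emeasurable_funM; [exact: measurable_cst|exact: measurable_funS mH].
  move=> x; rewrite ballEmdist/= => px; rewrite /H muleCA muleC -EFinM.
  apply: lee_wpmul2l => //; rewrite lee_fin.
  have := hL2 (mdist (val o) x) (mdist (val p) (val o)) (mdist_ge0 _ _).
  rewrite (max_r (mdist_ge0 _ _)); apply.
  by have := metric_triangle (val p) x (val o); rewrite (metric_sym x); clear -px; lra.
have SH : (S <= (L2 * m1%:R)%:E * \int[cmu]_x H x)%E.
  apply: (@le_trans _ _ (L2%:E * \esum_(p in [set: N]) \int[cmu]_(x in ball (val p) r1) H
    x)%E).
    rewrite -esumZl; [|exact: ltW|by move=> p _; exact: integral_ge0].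
    by apply: le_esum => p _; exact: JH.
  rewrite EFinM -muleA; apply: lee_wpmul2l; first by rewrite lee_fin ltW.
  by apply: overlap_bound => // x; exact: cardN.
have S0 : (0 <= S)%E by apply: esum_ge0.
rewrite absE; apply: (le_trans step1).
apply: (@le_trans _ _ (\sum_(p <- sA) (a1%:E * (J p * (rp p)%:E) + (g eps)%:E * `|v
  p|%:E))%E).
  by apply: lee_sum => p _; exact: local_bound.
rewrite big_split/=.
apply: (@le_trans _ _ (a1%:E * S + (g eps)%:E * (c1%:E * S))%E).
  apply: leeD.
    rewrite -ge0_sume_distrr//; apply: lee_wpmul2l; first by rewrite lee_fin.
    exact: esum_ge_seq.
  rewrite -ge0_sume_distrr; last by move=> p _; rewrite lee_fin.
  apply: lee_wpmul2l; first by rewrite lee_fin ltW.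
  apply: le_trans edge_bound; apply: le_trans (ineq v fv); exact: esum_ge_seq.
rewrite muleA -EFinM -ge0_muleDl ?lee_fin//; last by rewrite mulr_ge0// ltW.
rewrite -EFinD; have a1c : 0 <= a1 + g eps * c1 by rewrite addr_ge0// mulr_ge0// ltW.
apply: (le_trans (lee_wpmul2l _ SH)); first by rewrite lee_fin.
rewrite muleA -EFinM; apply: lee_wpmul2r; first exact: integral_ge0.
by rewrite lee_fin lerDl.
Qed.

End DiscreteToSobolev.

Theorem theorem12 (R : realType) (X : pmetricType R)
    (mu : {outer_measure set X -> \bar R})
    (hX : metric_measure_space mu)
    (hquasi : quasiconvex X)
    (hunif : uniform_space mu)
    (RP : R) (hP : local_poincare11 mu RP)
    (eps : R) (heps : 0 < eps <= Num.min 2 (RP / 4))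
    (N : set X) (hN : maximal_net N eps)
    (o : X) (hoN : N o) (ho : mu [set o] = 0%E)
    (rho : R -> R) (hrho : control_function rho) :
  [<-> sobolev11 mu rho;
       exists C1 : R, 0 < C1 /\
         forall v : N -> R, finite_set [set p | v p != 0] ->
           (\esum_(p in [set: N]) (`|v p|%:E * mu (ball (val p) eps))
            <= C1%:E *
               \esum_(p in [set: N]) \esum_(q in net_neighbours eps p)
                  ((`|v p - v q| * rho (edge_norm o (val p) (val q)))%:E
                   * mu (ball (val p) eps)))%E;
       exists C2 : R, 0 < C2 /\
         forall v : N -> R, finite_set [set p | v p != 0] ->
           (\esum_(p in [set: N]) `|v p|%:E
            <= C2%:E *
               \esum_(p in [set: N]) \esum_(q in net_neighbours eps p)
                  (`|v p - v q| * rho (edge_norm o (val p) (val q)))%:E)%E;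
       forall G : set X, quasi_lattice G -> forall b : G,
         coarse_homology rho b (fundamental_class rho b) /\
         homology_class rho b 0 = fundamental_class rho b].
Proof.
have [[mB _] _ _] := hX; have /andP[e0] := heps; rewrite le_min => /andP[_ eRP].
have e4 : 4 * eps <= RP by lra.
have rho1 := control_ge1 hrho.
have latN : quasi_lattice N.
  split; first by exists eps => //; exact: hN.1.
  exact: (net_uniformly_locally_finite mB hunif e0 hN).
have [f [g [fg0 _ fg]]] := hunif; have [f0 g0] := fg0 _ e0.
have iff23 := @weighted_inequality_iff R X mu N eps (f eps) (g eps) f0 g0
  (fun p => fg (val p) eps e0) (@net_neighbours R X N eps)
  [set v | finite_set [set p | v p != 0]] (fun v p => `|v p|)
  (fun v p q => `|v p - v q| * rho (edge_norm o (val p) (val q)))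
  (fun v p => normr_ge0 _) _.
have /iff23{}iff23 : forall (v : N -> R) (p q : N),
    0 <= `|v p - v q| * rho (edge_norm o (val p) (val q)).
  by move=> v p q; rewrite mulr_ge0// (le_trans ler01)// rho1// le_max mdist_ge0.
tfae.
(* The Sobolev inequality gives the form without measures, and the uniform bounds turn it into the
   weighted one. *)
- by move=> h; apply/iff23; exact: (sobolev_discrete o mB hunif e0 hN hrho).
- by move=> /iff23.
- move=> [C2 [C20 H]] G latG b; apply/fundamental_class_zero => //.
    exact: lattice_ball_finite.
  have [K [P [K0 P0 HG]]] := inequality_transfer hrho b e0 hN latN latG C20 H.
  exact: (chain_of_inequality (lattice_ball_finite latG) rho1 K0 P0 HG).
(* The homological hypothesis is applied to the net itself, with base point [o]. *)
- move=> H; pose b : N := SigSub (mem_set hoN).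
  have finN := lattice_ball_finite latN.
  have [c hc bc] := (fundamental_class_zero finN b rho1).2 (H N latN b).
  have [K [P [K0 P0 ineq]]] := inequality_of_chain finN rho1 hc bc.
  exact: (discrete_sobolev mB hquasi hunif hP e0 e4 hN hrho K0 P0 ineq).
Qed.
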